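(* Let $n\ge1$. The elliptic polygonal $n$-cone is semistable if and only if $1\le n\le6$. In fact, when $1\le n\le5$ it is stable, while for $n=6$ it is semistable but not stable.
   Context: All rings are commutative, Noetherian, with $1$. For a local ring $(R,\mathfrak m)$ of dimension $d$ and an $\mathfrak m$-primary ideal $I$, $\ell$ denotes length and $e(I)=\lim_{m\to\infty} d!\,\ell(R/I^m)/m^d$ is the Hilbert--Samuel multiplicity. The Lech--Mumford constant is $c_{LM}(R)=\sup_{\sqrt I=\mathfrak m}\frac{e(I)}{d!\,\ell(R/I)}$. $R$ is semistable if $c_{LM}(R[[T]])=1$; stable if it is semistable and the supremum defining $c_{LM}(R[[T]])$ is not attained. Let $k$ be a field. The elliptic polygonal $n$-cone is (the completed affine cone over a generic $n$-gon in $\mathbb{P}^{n-1}$, with degenerate cases $n=1,2$) the local ring: $k[[x,y,z]]/(x^2-xyz+y^3)$ if $n=1$; $k[[x,y,z]]/(x^2-xyz)$ if $n=2$; and, if $n\ge3$, $k[[x_1,\dots,x_n]]/(P_1\cap\cdots\cap P_n)$, where $P_1=(x_1,\dots,x_{n-2})$, $P_2=(x_2,\dots,x_{n-1})$, $\dots$, $P_n=(x_n,x_1,\dots,x_{n-3})$, i.e. $P_i=(x_i,x_{i+1},\dots,x_{i+n-3})$ with indices modulo $n$. *)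

(* Defs.v *)
From HB Require Import structures.
From mathcomp Require Import all_boot all_order all_algebra.
From mathcomp Require Import all_classical all_reals all_analysis.

Set Implicit Arguments.
Unset Strict Implicit.
Unset Printing Implicit Defensive.

Import Order.TTheory GRing.Theory Num.Theory.
Import numFieldNormedType.Exports.

Local Open Scope classical_set_scope.
Local Open Scope ring_scope.
Local Open Scope quotient_scope.

(* k[[x_0, ..., x_(n-1)]] is the type [mseries k n]: a series is the family of
   its coefficients, indexed by the exponents in N^n.  The record keeps the
   Cauchy product apart from the pointwise product that function types carry. *)
Record mseries (R : Type) (n : nat) : Type :=
  MSeries { mcoef : {ffun 'I_n -> nat} -> R }.

HB.instance Definition _ (R : Type) (n : nat) := [isNew for @mcoef R n].
HB.instance Definition _ (R : choiceType) (n : nat) :=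
  [Choice of mseries R n by <:].

Section MSeriesZmod.
Variables (R : zmodType) (n : nat).
Implicit Types f g h : mseries R n.

Lemma mseriesP f g : mcoef f =1 mcoef g -> f = g.
Proof. by move=> fg; apply: val_inj; apply/funext. Qed.

Definition mseries0 : mseries R n := MSeries (fun=> 0).
Definition mseries_opp f : mseries R n := MSeries (fun m => - mcoef f m).
Definition mseries_add f g : mseries R n :=
  MSeries (fun m => mcoef f m + mcoef g m).

Fact mseries_addA : associative mseries_add.
Proof. by move=> f g h; apply: mseriesP => m /=; rewrite addrA. Qed.
Fact mseries_addC : commutative mseries_add.
Proof. by move=> f g; apply: mseriesP => m /=; rewrite addrC. Qed.
Fact mseries_add0 : left_id mseries0 mseries_add.
Proof. by move=> f; apply: mseriesP => m /=; rewrite add0r. Qed.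
Fact mseries_addN : left_inverse mseries0 mseries_opp mseries_add.
Proof. by move=> f; apply: mseriesP => m /=; rewrite addNr. Qed.

HB.instance Definition _ := GRing.isZmodule.Build (mseries R n)
  mseries_addA mseries_addC mseries_add0 mseries_addN.

End MSeriesZmod.

Section MSeriesRing.
Variables (R : comPzRingType) (n : nat).
Implicit Types (f g h : mseries R n) (m : {ffun 'I_n -> nat}).

Definition mseries1 : mseries R n := MSeries (fun m => (m == 0)%:R).
Definition mseries_mul f g : mseries R n :=
  MSeries (fun m =>
    \sum_(p \in [set p : {ffun 'I_n -> nat} * {ffun 'I_n -> nat} |
                 p.1 + p.2 = m]) mcoef f p.1 * mcoef g p.2).

(* The Cauchy product as a sum over a finite box of exponents, from which the
   ring axioms follow. *)
Section Box.
Variable N : nat.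
Let box := {ffun 'I_n -> 'I_N.+1}.

Definition unbox (a : box) : {ffun 'I_n -> nat} := [ffun i => val (a i)].

Lemma unbox_inj : injective unbox.
Proof.
by move=> a b /ffunP ab; apply/ffunP => i; apply/val_inj; have := ab i; rewrite !ffunE.
Qed.

Lemma unbox_surj m : (forall i, m i <= N)%N -> {a | unbox a = m}.
Proof.
by move=> mN; exists [ffun i => inord (m i)]; apply/ffunP => i; rewrite !ffunE /= inordK ?ltnS.
Qed.

Lemma mcoefM_box f g m : (forall i, m i <= N)%N ->
  mcoef (mseries_mul f g) m =
  \sum_(a : box) \sum_(b : box | unbox a + unbox b == m)
     mcoef f (unbox a) * mcoef g (unbox b).
Proof.
move=> mN; pose u (q : box * box) := (unbox q.1, unbox q.2).
have -> : mcoef (mseries_mul f g) m =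
    \sum_(p \in u @` [set` [pred q : box * box | unbox q.1 + unbox q.2 == m]])
      mcoef f p.1 * mcoef g p.2.
  apply: eq_fsbigl; apply/seteqP; split=> [[a b] /= abm|_ [q /= /eqP qm <-]] //.
  have [|a' a'E] := @unbox_surj a.
    by move=> i; apply: leq_trans (mN i); rewrite -abm ffunE leq_addr.
  have [|b' b'E] := @unbox_surj b.
    by move=> i; apply: leq_trans (mN i); rewrite -abm ffunE leq_addl.
  by exists (a', b'); [apply/eqP; rewrite /= a'E b'E | rewrite /u /= a'E b'E].
rewrite fsbig_image; last first.
  by move=> [a b] [c d] _ _ [/unbox_inj -> /unbox_inj ->].
rewrite pair_big_dep /= -(@bigfs _ _ _ _ (index_enum _)) ?index_enum_uniq //.
by move=> i _; rewrite mem_index_enum.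
Qed.

End Box.

Let bnd m := (\max_i m i)%N.
Let bndP m i : (m i <= bnd m)%N. Proof. exact: leq_bigmax. Qed.

Fact mseries_mulC : commutative mseries_mul.
Proof.
move=> f g; apply: mseriesP => m.
rewrite !(mcoefM_box _ _ (@bndP m)) (exchange_big_dep xpredT) //=.
apply: eq_bigr => b _; apply: eq_big => a; first by rewrite addrC.
by rewrite mulrC.
Qed.

Fact mseries_mul1 : left_id mseries1 mseries_mul.
Proof.
move=> f; apply: mseriesP => m; rewrite (mcoefM_box _ _ (@bndP m)).
have [z zE] : {a : {ffun 'I_n -> 'I_(bnd m).+1} | unbox a = 0}.
  by apply: unbox_surj => i; rewrite ffunE.
have [c cE] := unbox_surj (@bndP m).
rewrite (bigD1 z) //= [X in _ + X]big1 => [|a az]; last first.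
  rewrite big1 // => b _; case: eqP => [a0|_]; last by rewrite mul0r.
  by case/eqP: az; apply: (@unbox_inj (bnd m)); rewrite a0 zE.
rewrite addr0 (big_pred1 c) => [|b]; first by rewrite zE cE eqxx mul1r.
by rewrite zE add0r -[X in _ == X]cE (inj_eq (@unbox_inj _)).
Qed.

Fact mseries_mulDl : left_distributive mseries_mul +%R.
Proof.
move=> f g h; apply: mseriesP => m.
transitivity (mcoef (mseries_mul f h) m + mcoef (mseries_mul g h) m); last by [].
rewrite !(mcoefM_box _ _ (@bndP m)) -big_split /=.
by apply: eq_bigr => a _; rewrite -big_split /=; apply: eq_bigr => b _; rewrite mulrDl.
Qed.

Let mulA_aux f g h m : mcoef (mseries_mul (mseries_mul f g) h) m =
  let N := bnd m in
  \sum_(c : {ffun 'I_n -> 'I_N.+1}) \sum_(d : {ffun 'I_n -> 'I_N.+1})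
  \sum_(b : {ffun 'I_n -> 'I_N.+1} | unbox c + unbox d + unbox b == m)
     mcoef f (unbox c) * mcoef g (unbox d) * mcoef h (unbox b).
Proof.
rewrite (mcoefM_box _ _ (@bndP m)).
set N := bnd m; pose box := {ffun 'I_n -> 'I_N.+1}.
transitivity (\sum_(a : box) \sum_(c : box) \sum_(d : box)
   \sum_(b : box) (if (unbox c + unbox d == unbox a) &&
     (unbox a + unbox b == m) then
     mcoef f (unbox c) * mcoef g (unbox d) * mcoef h (unbox b) else 0)).
  apply: eq_bigr => a _.
  rewrite (mcoefM_box (N := N)); last first.
    by move=> i; rewrite ffunE -ltnS ltn_ord.
  rewrite -big_distrr /= mulr_suml; apply: eq_bigr => c _.
  rewrite mulr_suml big_mkcond; apply: eq_bigr => d _.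
  case: eqP => _ /=; last by rewrite big1.
  by rewrite mulr_sumr [LHS]big_mkcond.
rewrite exchange_big; apply: eq_bigr => c _.
rewrite exchange_big; apply: eq_bigr => d _.
rewrite exchange_big [RHS]big_mkcond; apply: eq_bigr => b _.
case: eqP => [cdb|cdb]; last first.
  by rewrite big1 // => a _; case: eqP => //= <-; case: eqP.
have [|a aE] := @unbox_surj N (unbox c + unbox d).
  by move=> i; apply: leq_trans (@bndP m i); rewrite -cdb [leqRHS]ffunE leq_addr.
rewrite (bigD1 a) //= big1 => [|a' a'a]; first by rewrite aE cdb !eqxx addr0.
by rewrite -aE (inj_eq (@unbox_inj _)) eq_sym (negPf a'a).
Qed.

Fact mseries_mulA : associative mseries_mul.
Proof.
move=> f g h; apply: mseriesP => m.
rewrite mseries_mulC !mulA_aux /=.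
under eq_bigr do under eq_bigr do rewrite big_mkcond.
under [RHS]eq_bigr do under eq_bigr do rewrite big_mkcond.
rewrite [RHS]exchange_big; apply: eq_bigr => d _.
rewrite [RHS]exchange_big; apply: eq_bigr => b _.
apply: eq_bigr => c _.
by rewrite addrC addrA mulrC mulrA.
Qed.

HB.instance Definition _ := GRing.Zmodule_isComPzRing.Build (mseries R n)
  mseries_mulA mseries_mulC mseries_mul1 mseries_mulDl.

Definition mvar (i : 'I_n) : mseries R n :=
  MSeries (fun m => (m == [ffun j => nat_of_bool (j == i)])%:R).
End MSeriesRing.

Section Ideals.
Variable R : comPzRingType.
Implicit Types (I J S : set R).

Definition is_ideal I : Prop :=
  I 0 /\ forall a x y : R, I x -> I y -> I (a * x + y).

Definition prime_ideal I : Prop :=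
  [/\ is_ideal I, ~ I 1 & forall x y : R, I (x * y) -> I x \/ I y].

Definition maximal_ideal I : Prop :=
  [/\ is_ideal I, ~ I 1 &
      forall J, is_ideal J -> ~ J 1 -> I `<=` J -> J = I].

Definition ideal_gen S : set R := smallest is_ideal S.

Definition radical I : set R := [set x | exists n : nat, I (x ^+ n)].

Definition ideal_pow I (m : nat) : set R :=
  ideal_gen [set \prod_(i < m) f i | f in [set f : 'I_m -> R | forall i, I (f i)]].

Lemma ideal_gen_ideal S : is_ideal (ideal_gen S).
Proof.
split=> [J [] []//|a x y Sx Sy J JS].
by have [[_ JD] _] := JS; apply: JD; [exact: Sx|exact: Sy].
Qed.

Definition in_ideal_gen S : R -> bool := fun x => `[< ideal_gen S x >].

Fact in_ideal_gen_zmod S : zmod_closed (in_ideal_gen S).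
Proof.
have [S0 SD] := ideal_gen_ideal S.
split=> [|x y /asboolP Sx /asboolP Sy]; apply/asboolP => //.
by rewrite addrC -mulN1r; apply: SD.
Qed.
HB.instance Definition _ S :=
  GRing.isZmodClosed.Build R (in_ideal_gen S) (in_ideal_gen_zmod S).

Definition ideal_gen_zmod S : zmodClosed R :=
  GRing.ZmodClosed.clone R (in_ideal_gen S) _.

End Ideals.

(* The quotient R/(S) by the ideal generated by an arbitrary subset S; S = R is
   allowed and gives the zero ring. *)
Definition quot_ring (R : comPzRingType) (S : set R) : Type :=
  {ideal_quot ideal_gen_zmod S}.

Section QuotientRing.
Variables (R : comPzRingType) (S : set R).
Local Notation Q := (quot_ring S).
Local Notation Q0 := {ideal_quot ideal_gen_zmod S}.

HB.instance Definition _ := GRing.Zmodule.on Q.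

Definition quot_pi : R -> Q := \pi_Q0.

Lemma quot_piP (P : Q -> Prop) : (forall x, P (quot_pi x)) -> forall q, P q.
Proof. by move=> PH q; rewrite -[q](@reprK _ Q0); apply: PH. Qed.

Lemma quot_pi_eq x y : quot_pi x = quot_pi y <-> ideal_gen S (x - y).
Proof.
have E : `[< ideal_gen S (x - y) >] = (quot_pi x == quot_pi y).
  exact: (@Quotient.idealrBE R (ideal_gen_zmod S) x y).
split=> [/eqP|/asboolT]; first by rewrite -E => /asboolP.
by rewrite E => /eqP.
Qed.

Lemma quot_piD x y : quot_pi (x + y) = quot_pi x + quot_pi y.
Proof. exact: (@Quotient.pi_add R (ideal_gen_zmod S)). Qed.

Definition quot_one : Q := quot_pi 1.
Definition quot_mul (p q : Q) : Q :=
  quot_pi (repr (p : Q0) * repr (q : Q0)).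

Lemma quot_piM x y : quot_mul (quot_pi x) (quot_pi y) = quot_pi (x * y).
Proof.
have [_ SD] := ideal_gen_ideal S; have S0 := (ideal_gen_ideal S).1.
have r z : ideal_gen S (repr (quot_pi z : Q0) - z).
  by apply/quot_pi_eq; apply: (@reprK _ Q0).
apply/quot_pi_eq.
set x' := repr _; set y' := repr _.
have -> : x' * y' - x * y = y' * (x' - x) + (x * (y' - y) + 0).
  by rewrite addr0 !mulrBr [y' * x']mulrC [y' * x]mulrC addrA subrK.
by apply: (SD _ _ _ (r x)); apply: (SD _ _ _ (r y)).
Qed.

Fact quot_mulA : associative quot_mul.
Proof.
by elim/quot_piP=> x; elim/quot_piP=> y; elim/quot_piP=> z; rewrite !quot_piM mulrA.
Qed.
Fact quot_mulC : commutative quot_mul.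
Proof. by elim/quot_piP=> x; elim/quot_piP=> y; rewrite !quot_piM mulrC. Qed.
Fact quot_mul1 : left_id quot_one quot_mul.
Proof. by elim/quot_piP=> x; rewrite quot_piM mul1r. Qed.
Fact quot_mulDl : left_distributive quot_mul +%R.
Proof.
elim/quot_piP=> x; elim/quot_piP=> y; elim/quot_piP=> z.
by rewrite -quot_piD !quot_piM mulrDl quot_piD.
Qed.
HB.instance Definition _ := GRing.Zmodule_isComPzRing.Build Q
  quot_mulA quot_mulC quot_mul1 quot_mulDl.

Definition quot_scale (a : R) (q : Q) : Q := quot_pi a * q.

Fact quot_scaleA a b q : quot_scale a (quot_scale b q) = quot_scale (a * b) q.
Proof. by rewrite /quot_scale mulrA; congr (_ * _); apply: quot_piM. Qed.
Fact quot_scale1 : left_id 1 quot_scale.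
Proof. exact: mul1r. Qed.
Fact quot_scaleDr : right_distributive quot_scale +%R.
Proof. by move=> a p q; apply: mulrDr. Qed.
Fact quot_scaleDl q : {morph quot_scale^~ q : a b / a + b}.
Proof. by move=> a b; rewrite /quot_scale quot_piD mulrDl. Qed.
HB.instance Definition _ := GRing.Zmodule_isLmodule.Build R Q
  quot_scaleA quot_scale1 quot_scaleDr quot_scaleDl.

End QuotientRing.

(* The lengths d of the strictly increasing chains c 0 < ... < c d whose
   members all satisfy P. *)
Definition chain_lengths (T : Type) (P : set (set T)) : set nat :=
  [set d | exists c : nat -> set T,
     (forall i, (i <= d)%N -> P (c i)) /\
     (forall i, (i < d)%N -> c i `<` c i.+1)].

(* The supremum is taken in nat, with default value 0 when the chains have
   unbounded length.  For a Noetherian local ring R with maximal ideal m, this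
   happens neither for the dimension of R nor for the length of R/I when I is
   m-primary. *)
Definition krull_dim (R : comPzRingType) : nat :=
  supremum 0%N (chain_lengths (@prime_ideal R)).

Definition is_submodule (R : pzRingType) (M : lmodType R) (N : set M) : Prop :=
  N 0 /\ forall (a : R) (x y : M), N x -> N y -> N (a *: x + y).

Definition module_length (R : pzRingType) (M : lmodType R) : nat :=
  supremum 0%N (chain_lengths (@is_submodule R M)).

(* l(R/I), the length of R/I as an R-module *)
Definition colength (R : comPzRingType) (I : set R) : nat :=
  module_length (quot_ring I : lmodType R).

(* For a local ring R, "the radical of I is maximal" says that it is the maximal
   ideal of R. *)
Definition max_primary (R : comPzRingType) (I : set R) : Prop :=
  is_ideal I /\ maximal_ideal (radical I).

Section LechMumford.
Variables (K : realType) (R : comPzRingType).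

Definition multiplicity (I : set R) : K :=
  let d := krull_dim R in
  limn (fun m : nat =>
          d`!%:R * (colength (ideal_pow I m))%:R / m%:R ^+ d : K).

Definition lech_ratio (I : set R) : K :=
  multiplicity I / ((krull_dim R)`!%:R * (colength I)%:R).

Definition lech_mumford : \bar K :=
  ereal_sup [set (lech_ratio I)%:E | I in @max_primary R].

Definition lech_mumford_attained : Prop :=
  exists2 I : set R, max_primary I & (lech_ratio I)%:E = lech_mumford.

End LechMumford.

Definition semistable (K : realType) (R : comPzRingType) : Prop :=
  lech_mumford K (mseries R 1) = 1%E.

Definition stable (K : realType) (R : comPzRingType) : Prop :=
  semistable K R /\ ~ lech_mumford_attained K (mseries R 1).

(* With variables and primes indexed from 0, P_i = (x_i, x_(i+1), ..., x_(i+n-3)), indices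
   modulo n. *)
Definition polygon_prime (k : fieldType) (n : nat) (i : 'I_n) :
    set (mseries k n) :=
  ideal_gen [set mvar k l | l in
    [set l : 'I_n | exists2 j : nat, (j < n - 2)%N & l = ((i + j) %% n)%N :> nat]].

(* The value at n = 0 is a placeholder. *)
Definition elliptic_cone (k : fieldType) (n : nat) : comPzRingType :=
  let x : mseries k 3 := mvar k 0 in
  let y : mseries k 3 := mvar k 1 in
  let z : mseries k 3 := mvar k 2 in
  match n with
  | 1 => quot_ring [set x ^+ 2 - x * y * z + y ^+ 3]
  | 2 => quot_ring [set x ^+ 2 - x * y * z]
  | _ => quot_ring (\bigcap_(i in [set: 'I_n]) @polygon_prime k n i)
  end.

(* Main.v *)
(** Present R = A[[T]] as a quotient of a power series ring over k, with a monomial order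
    for which the initial ideal of the relations contains the Stanley-Reisner ideal of a
    p-gon: the relations are monomial for n >= 3 (p = n), and for n <= 2 suitable weights
    make xyz the initial term of x^2 - xyz + c y^3 (p = 3).  Passing from an m-primary ideal I
    to its initial ideal keeps the colength and does not decrease the multiplicity, so one
    may count monomials in p octants N^3 glued cyclically along their walls.

    In an octant let h(a, b) be the least c such that x^a y^b T^c is initial in I.  Sums of m
    initial exponents of I are initial exponents of I^m, so the heights for I^m are at most
    m times the linear interpolation of h on the triangulation of the quadrant by the lines
    where a, b or a + b is an integer.  Hence e(I) is at most the sum, over all
    triangles, of the heights of their three vertices.  An interior lattice point lies in 6
    triangles, a point of a wall in 3 and the corner in 1, so after gluing this sum is
    6 l(R/I) - (6 - p) h(0, 0), where h(0, 0) > 0.  This gives e(I) <= 3! l(R/I) for p <= 6,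
    strictly for p < 6.  Conversely the ratios of the powers of the maximal ideal tend to 1, and
    the maximal ideal itself has ratio n / 6 for n >= 3.

    That dim R = 3 follows from Hilbert functions: along a strict chain of primes the order of
    growth drops by at least one at each step, by the Artin-Rees lemma.  For n <= 2 a chain
    of length 3 starts at a prime obtained from Zorn's lemma, maximal among the ideals that
    contain the equation and avoid the elements s x^N with s outside (x, y). *)

From HB Require Import structures.
From mathcomp Require Import all_boot all_order all_algebra.
From mathcomp Require Import all_classical all_reals all_analysis.
From mathcomp Require Import zify ring lra.
Require Import Defs.

Set Implicit Arguments.
Unset Strict Implicit.
Unset Printing Implicit Defensive.

Import Order.TTheory GRing.Theory Num.Theory.
Import numFieldNormedType.Exports.

Local Open Scope classical_set_scope.
Local Open Scope ring_scope.

(** * Exponents and monomial orders *)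

(** Lengths and dimensions are suprema of chain lengths, so everything has to be read off from
    chains of ideals. A strict inclusion of ideals of power series always brings a new leading
    exponent, and conversely missing leading exponents can be added one at a time along a chain;
    this turns every length into a count of exponents. Two orders are at work. One has the polygon
    in its initial ideal and bounds e(I) for every I. The other, by total degree, computes the
    Hilbert function of the powers of the maximal ideal. For n <= 2 they differ: xyz is initial in
    the first and x^2 in the second, so the bound uses three octants although the multiplicity is 2.
    Since e(I) is only bounded from above, a cover of the standard exponents of I^m is enough, and
    walls may be counted twice at a cost of O(m^2). The exact bookkeeping on walls and corner is
    done for I alone. For n = 2 the equation x (x - yz) is reducible, for n = 1 no factor is
    visible. The prime from Zorn's lemma treats both cases at once, without factoring. *)

Notation expo q := {ffun 'I_q -> nat}.

Section Exponents.
Variable q : nat.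
Implicit Types (a b c e : expo q) (w : 'I_q -> nat).

Lemma expoD a b i : (a + b) i = (a i + b i)%N. Proof. by rewrite ffunE. Qed.

Lemma expo0 i : (0 : expo q) i = 0%N. Proof. by rewrite ffunE. Qed.

Lemma expo_addIr c : injective (fun a => a + c).
Proof.
move=> a b /ffunP ab; apply/ffunP => i.
by have := ab i; rewrite !expoD => /addIn.
Qed.

Lemma expo_addrI c : injective (fun a => c + a).
Proof. by move=> a b; rewrite ![c + _]addrC => /expo_addIr. Qed.

Definition edvd a b := [forall i, (a i <= b i)%N].
Definition esub a b : expo q := [ffun i => (a i - b i)%N].

Lemma esubK a b : edvd a b -> a + esub b a = b.
Proof. by move=> /forallP ab; apply/ffunP => i; rewrite expoD ffunE subnKC. Qed.

Lemma edvdP a b : reflect (exists c, b = a + c) (edvd a b).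
Proof.
apply: (iffP idP) => [/esubK <-|[c ->]]; first by exists (esub b a).
by apply/forallP => i; rewrite expoD leq_addr.
Qed.

Lemma edvdD a b : edvd a (a + b). Proof. by apply/edvdP; exists b. Qed.

Definition eunit i : expo q := [ffun j => nat_of_bool (j == i)].

Lemma eunitE i j : eunit i j = (j == i) :> nat. Proof. by rewrite ffunE. Qed.

Lemma expoMn a n i : (a *+ n) i = (a i * n)%N.
Proof. by elim: n => [|n IH]; rewrite ?muln0 ?mulr0n ?expo0 // mulrS expoD IH mulnS. Qed.

Definition wdeg w a := (\sum_i w i * a i)%N.

Lemma wdegD w a b : wdeg w (a + b) = (wdeg w a + wdeg w b)%N.
Proof. by rewrite -big_split; apply: eq_bigr => i _; rewrite expoD mulnDr. Qed.

Lemma wdeg0 w : wdeg w 0 = 0%N.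
Proof. by rewrite /wdeg big1 // => i _; rewrite expo0 muln0. Qed.

Lemma wdegMn w a n : wdeg w (a *+ n) = (wdeg w a * n)%N.
Proof. by elim: n => [|n IH]; rewrite ?wdeg0 ?muln0 // mulrS wdegD IH mulnS. Qed.

Lemma wdeg_eunit w i : wdeg w (eunit i) = w i.
Proof.
rewrite /wdeg (bigD1 i) //= big1 ?eunitE ?eqxx ?muln1 ?addn0 // => j ji.
by rewrite eunitE (negPf ji) muln0.
Qed.

Lemma leq_wdeg w a i : (0 < w i)%N -> (a i <= wdeg w a)%N.
Proof. by move=> wi; rewrite /wdeg (bigD1 i) //=; nia. Qed.

Lemma wdeg_gt0 w a : (forall i, 0 < w i)%N -> (0 < wdeg w a)%N = (a != 0).
Proof.
move=> w0; apply/idP/idP => [|a0]; first by apply: contraL => /eqP ->; rewrite wdeg0.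
rewrite lt0n; apply: contra a0 => /eqP wa0; apply/eqP/ffunP => i.
by have := leq_wdeg a (w0 i); rewrite wa0 leqn0 expo0 => /eqP.
Qed.

End Exponents.

(** With ranks in [nat], every nonzero series has a term of least rank, and a series of rank at
    least N for all N is 0. The first fact gives leading exponents, the second the convergence of
    division. *)
Record monomial_order q (rho : expo q -> nat) : Prop := MonomialOrder {
  mo_inj : injective rho;
  mo_add : forall a b c, (rho a < rho b -> rho (a + c)%R < rho (b + c)%R)%N }.

Definition refines q (w : 'I_q -> nat) (rho : expo q -> nat) : Prop :=
  forall a b, (wdeg w a < wdeg w b -> rho a < rho b)%N.

Section MonomialOrderTheory.
Variables (q : nat) (rho : expo q -> nat).
Hypothesis rhoP : monomial_order rho.
Implicit Types a b c : expo q.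

Lemma mo_lt_add2r c a b : (rho (a + c)%R < rho (b + c)%R)%N = (rho a < rho b)%N.
Proof.
apply/idP/idP; last exact: mo_add.
case: (ltngtP (rho a) (rho b)) => // [ba|/(mo_inj rhoP) ->]; last by rewrite ltnn.
by have := mo_add rhoP c ba; lia.
Qed.

Lemma mo_le_add2r c a b : (rho (a + c)%R <= rho (b + c)%R)%N = (rho a <= rho b)%N.
Proof. by rewrite leqNgt mo_lt_add2r -leqNgt. Qed.

Lemma mo_le_add2l c a b : (rho (c + a)%R <= rho (c + b)%R)%N = (rho a <= rho b)%N.
Proof. by rewrite ![c + _]addrC mo_le_add2r. Qed.

(* Otherwise the multiples of [a] would form an infinite descending chain. *)
Lemma mo_ge0 a : (rho 0%R <= rho a)%N.
Proof.
rewrite leqNgt; apply/negP => a0.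
have H n : (rho (a *+ n)%R + n <= rho 0%R)%N.
  elim: n => [|n IH]; first by rewrite mulr0n addn0.
  by apply: leq_trans IH; rewrite -addSnnS leq_add2r; have := mo_add rhoP (a *+ n) a0; rewrite -mulrS add0r.
by have := H (rho 0%R).+1; lia.
Qed.

Lemma mo_leDr a b : (rho a <= rho (a + b)%R)%N.
Proof. by rewrite -{1}[a]addr0 mo_le_add2l mo_ge0. Qed.

Lemma mo_leD a b a' b' : (rho a <= rho a' -> rho b <= rho b' ->
  rho (a + b)%R <= rho (a' + b')%R)%N.
Proof. by move=> aa' bb'; apply: (@leq_trans (rho (a' + b)%R)); rewrite ?mo_le_add2r ?mo_le_add2l. Qed.

(** This is why leading terms cannot cancel in a product: no other pair of exponents of at least
    these ranks has the same sum. *)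
Lemma mo_eqD a b a' b' : (rho a <= rho a')%N -> (rho b <= rho b')%N ->
  a' + b' = a + b -> a' = a /\ b' = b.
Proof.
move=> aa' bb' ab.
suff aE : a' = a by split=> //; move: ab; rewrite aE => /expo_addrI.
apply: (mo_inj rhoP); apply/eqP; rewrite eqn_leq aa' andbT leqNgt; apply/negP => a'a.
have := mo_add rhoP b a'a; have : (rho (a' + b)%R <= rho (a' + b')%R)%N by rewrite mo_le_add2l.
by rewrite ab; lia.
Qed.

Lemma refines_le w a b : refines w rho -> (rho a <= rho b -> wdeg w a <= wdeg w b)%N.
Proof. by move=> wr ab; rewrite leqNgt; apply/negP => /wr; lia. Qed.

End MonomialOrderTheory.

(** * A monomial order refining given positive weights *)

Section WeightOrder.
Implicit Types (f g : nat -> nat) (B q : nat).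

Definition digits B q f := (\sum_(i < q) f i * B ^ i)%N.

Lemma digitsS B q f : digits B q.+1 f = (digits B q f + f q * B ^ q)%N.
Proof. by rewrite /digits big_ord_recr. Qed.

Lemma digits_lt B q f : (0 < B)%N -> (forall i, i < q -> f i < B)%N ->
  (digits B q f < B ^ q)%N.
Proof.
move=> B0; elim: q => [|q IH] fB; first by rewrite /digits big_ord0.
have := IH (fun i iq => fB i (ltnW iq)); have := fB q (ltnSn q).
by rewrite digitsS expnS; nia.
Qed.

(** The comparison is decided by the highest digit that differs, whatever the base. Adding an
    exponent raises the weighted degree and so the base of [weight_order]; this allows comparisons
    before and after to be matched. *)
Lemma digits_base B C q f g : (0 < B)%N -> (0 < C)%N ->
  (forall i, i < q -> f i < B /\ f i < C)%N ->
  (forall i, i < q -> g i < B /\ g i < C)%N ->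
  (digits B q f < digits B q g)%N = (digits C q f < digits C q g)%N.
Proof.
move=> B0 C0; elim: q => [|q IH] fBC gBC; first by rewrite /digits !big_ord0.
have D X h : (0 < X)%N -> (forall i, i < q.+1 -> h i < X)%N -> (digits X q h < X ^ q)%N.
  by move=> X0 hX; apply: digits_lt => // i iq; apply: hX; lia.
have := D B f B0 (fun i iq => (fBC i iq).1); have := D C f C0 (fun i iq => (fBC i iq).2).
have := D B g B0 (fun i iq => (gBC i iq).1); have := D C g C0 (fun i iq => (gBC i iq).2).
have {IH} := IH (fun i iq => fBC i (ltnW iq)) (fun i iq => gBC i (ltnW iq)).
rewrite !digitsS; set b := (B ^ q)%N; set c := (C ^ q)%N.
move: (f q) (g q) (digits B q f) (digits B q g) (digits C q f) (digits C q g).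
move=> x y fb gb fc gc E gcl gbl fcl fbl.
case: (ltngtP x y) => xy; last by rewrite xy !ltn_add2r.
  by apply/idP/idP => _; nia.
by apply/idP/idP; nia.
Qed.

Lemma digits_inj B q f g : (0 < B)%N -> (forall i, i < q -> f i < B)%N ->
  (forall i, i < q -> g i < B)%N -> digits B q f = digits B q g ->
  forall i, (i < q)%N -> f i = g i.
Proof.
move=> B0; elim: q => [|q IH] fB gB E i //.
have fq := digits_lt B0 (fun j jq => fB j (ltnW jq)).
have gq := digits_lt B0 (fun j jq => gB j (ltnW jq)).
move: E fq gq; rewrite !digitsS; set b := (B ^ q)%N.
set fb := digits B q f; set gb := digits B q g => E fq gq.
have fg : f q = g q by nia.
rewrite ltnS leq_eqVlt => /predU1P[->|] //; apply: IH => [j jq|j jq|].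
- by apply: fB; lia.
- by apply: gB; lia.
- by rewrite -/fb -/gb; lia.
Qed.

Variables (q : nat) (w : 'I_q.+1 -> nat).
Hypothesis w_gt0 : forall i, (0 < w i)%N.
Implicit Types a b c : expo q.+1.

Let dig B a := digits B q.+1 (fun i => a (inord i)).

(* Weighted degree first; inside one degree d, base-(d+1) expansion, that is, the
   reverse lexicographic order of the exponents. *)
Definition weight_order a :=
  let B := (wdeg w a).+1 in (B ^ q.+2 + dig B a)%N.

Let dig_lt B a : (wdeg w a < B)%N -> (dig B a < B ^ q.+1)%N.
Proof.
move=> aB; apply: digits_lt => [|i iq]; first by lia.
by apply: leq_ltn_trans aB; apply: leq_wdeg.
Qed.

Let digD B a b : dig B (a + b) = (dig B a + dig B b)%N.
Proof.
rewrite /dig /digits -big_split; apply: eq_bigr => i _.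
by rewrite expoD mulnDl.
Qed.

(** There are q + 1 digits, so the digit part is below B^(q+1), while B^(q+2) grows by at least
    B^(q+1) when B grows by one. *)
Lemma weight_order_refines : refines w weight_order.
Proof.
move=> a b ab; rewrite /weight_order /=.
set B := (wdeg w a).+1; set C := (wdeg w b).+1.
have := @dig_lt B a (ltnSn _).
have : (B.+1 ^ q.+2 <= C ^ q.+2)%N by rewrite leq_exp2r.
have BB : (B ^ q.+1 <= B.+1 ^ q.+1)%N by rewrite leq_exp2r.
by rewrite !(expnS _ q.+1); nia.
Qed.

Let weight_order_lt a b : wdeg w a = wdeg w b ->
  (weight_order a < weight_order b)%N = (dig (wdeg w a).+1 a < dig (wdeg w a).+1 b)%N.
Proof. by move=> ab; rewrite /weight_order /= ab ltn_add2l. Qed.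

Lemma weight_orderP : monomial_order weight_order.
Proof.
split=> [a b ab|a b c].
  have wab : wdeg w a = wdeg w b.
    by case: (ltngtP (wdeg w a) (wdeg w b)) => // /weight_order_refines; rewrite ab ltnn.
  apply/ffunP => i; rewrite -[i]inord_val.
  move: ab; rewrite /weight_order /= wab => /addnI E.
  by apply: (digits_inj _ _ _ E) => // j _; [rewrite ltnS -wab|rewrite ltnS]; apply: leq_wdeg.
case: (ltngtP (wdeg w a) (wdeg w b)) => [ab _|ba|wab].
- by apply: weight_order_refines; rewrite !wdegD ltn_add2r.
- by have := weight_order_refines ba; lia.
rewrite !weight_order_lt ?wdegD ?wab // !digD ltn_add2r.
have le_ab e : wdeg w e = wdeg w b -> forall i, (e i < (wdeg w b).+1)%N.
  by move=> <- i; rewrite ltnS leq_wdeg.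
rewrite /dig (@digits_base _ (wdeg w b + wdeg w c).+1) // => i _; split.
- exact: le_ab.
- by apply: (leq_trans (le_ab _ wab _)); rewrite ltnS leq_addr.
- exact: le_ab.
- by apply: (leq_trans (le_ab _ erefl _)); rewrite ltnS leq_addr.
Qed.

End WeightOrder.

(** * Coefficients and ideals *)

Section Coefficients.
Variables (R : comPzRingType) (q : nat).
Implicit Types (f g : mseries R q) (a b e m : expo q).

Lemma mcoef0 m : mcoef (0 : mseries R q) m = 0. Proof. by []. Qed.
Lemma mcoef1 m : mcoef (1 : mseries R q) m = (m == 0)%:R. Proof. by []. Qed.
Lemma mcoefD f g m : mcoef (f + g) m = mcoef f m + mcoef g m. Proof. by []. Qed.
Lemma mcoefB f g m : mcoef (f - g) m = mcoef f m - mcoef g m. Proof. by []. Qed.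

Lemma mcoef_sum (I : Type) (r : seq I) (P : pred I) (F : I -> mseries R q) m :
  mcoef (\sum_(i <- r | P i) F i) m = \sum_(i <- r | P i) mcoef (F i) m.
Proof. by elim/big_rec2: _ => //= i x y _ <-. Qed.

Lemma mcoefME f g m N : (forall i, m i <= N)%N ->
  mcoef (f * g) m =
  \sum_(a : {ffun 'I_q -> 'I_N.+1}) \sum_(b : {ffun 'I_q -> 'I_N.+1} | unbox a + unbox b == m)
     mcoef f (unbox a) * mcoef g (unbox b).
Proof. exact: mcoefM_box. Qed.

Lemma mcoefM_supp f g m : mcoef (f * g) m != 0 ->
  exists a b, [/\ a + b = m, mcoef f a != 0 & mcoef g b != 0].
Proof.
move=> fg; apply: contrapT => H; case/eqP: fg.
rewrite (@mcoefME _ _ _ (\max_i m i)) => [|i]; last exact: leq_bigmax.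
rewrite big1 // => a _; rewrite big1 // => b /eqP ab.
have [fa|fa] := eqVneq (mcoef f (unbox a)) 0; first by rewrite fa mul0r.
have [gb|gb] := eqVneq (mcoef g (unbox b)) 0; first by rewrite gb mulr0.
by case: H; exists (unbox a), (unbox b).
Qed.

Lemma mcoefM_one f g a b :
  (forall a' b', a' + b' = a + b -> mcoef f a' != 0 -> mcoef g b' != 0 -> a' = a) ->
  mcoef (f * g) (a + b) = mcoef f a * mcoef g b.
Proof.
move=> H; pose N := (\max_i (a + b)%R i)%N.
have abN i : ((a + b)%R i <= N)%N by exact: leq_bigmax.
rewrite (mcoefME _ _ abN).
have [|a0 a0E] := @unbox_surj q N a.
  by move=> i; apply: leq_trans (abN i); rewrite expoD leq_addr.
have [|b0 b0E] := @unbox_surj q N b.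
  by move=> i; apply: leq_trans (abN i); rewrite expoD leq_addl.
rewrite (bigD1 a0) //= [X in _ + X]big1 => [|a1 a1a]; last first.
  rewrite big1 // => b1 /eqP ab.
  have [fa|fa] := eqVneq (mcoef f (unbox a1)) 0; first by rewrite fa mul0r.
  have [gb|gb] := eqVneq (mcoef g (unbox b1)) 0; first by rewrite gb mulr0.
  by case/eqP: a1a; apply: unbox_inj; rewrite a0E; apply: (H _ _ ab).
rewrite addr0 (big_pred1 b0) => [|b1]; first by rewrite a0E b0E.
rewrite a0E -b0E /= [X in _ = X]eq_sym -(inj_eq (@unbox_inj q N)) eq_sym.
by rewrite (inj_eq (@expo_addrI _ a)).
Qed.

Definition mono (c : R) e : mseries R q := MSeries (fun m => if m == e then c else 0).

Lemma mcoef_mono c e m : mcoef (mono c e) m = if m == e then c else 0.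
Proof. by []. Qed.

Lemma mono1 : mono 1 0 = 1.
Proof. by apply: mseriesP => m; rewrite mcoef1 mcoef_mono; case: ifP. Qed.

Lemma mcoef_monoM c e f m : mcoef (mono c e * f) (e + m) = c * mcoef f m.
Proof.
rewrite mcoefM_one ?mcoef_mono ?eqxx // => a b _.
by rewrite mcoef_mono; case: (eqVneq a e) => // _; rewrite eqxx.
Qed.

Lemma mcoef_monoM_supp c e f m : mcoef (mono c e * f) m != 0 ->
  exists2 b, m = e + b & mcoef f b != 0.
Proof.
move=> /mcoefM_supp[a [b [<-]]]; rewrite mcoef_mono.
by case: (eqVneq a e) => [-> _ fb|_]; [by exists b|by rewrite eqxx].
Qed.

Lemma monoM c d a b : mono c a * mono d b = mono (c * d) (a + b).
Proof.
apply: mseriesP => m; rewrite mcoef_mono; case: eqP => [->|mab].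
  by rewrite mcoef_monoM mcoef_mono eqxx.
apply/eqP/negPn/negP => /mcoef_monoM_supp[e mE].
by rewrite mcoef_mono; case: (eqVneq e b) => [eb|_]; [case: mab; rewrite mE eb|rewrite eqxx].
Qed.

Lemma monoX c a n : mono c a ^+ n = mono (c ^+ n) (a *+ n).
Proof.
elim: n => [|n IH]; first by rewrite !expr0 mulr0n mono1.
by rewrite !exprS IH monoM mulrS.
Qed.

Lemma mvarE i : mvar R i = mono 1 (eunit i).
Proof. by apply: mseriesP => m /=; rewrite /eunit; case: eqP. Qed.

End Coefficients.

Section IdealBasics.
Variable R : comPzRingType.
Implicit Types (I J : set R) (x y : R).

Lemma ideal0 I : is_ideal I -> I 0. Proof. by case. Qed.

Lemma idealD I x y : is_ideal I -> I x -> I y -> I (x + y).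
Proof. by move=> [_ H] Ix Iy; rewrite -[x]mul1r; apply: H. Qed.

Lemma idealM I a x : is_ideal I -> I x -> I (a * x).
Proof. by move=> [I0 H] Ix; rewrite -[a * x]addr0; apply: H. Qed.

Lemma idealN I x : is_ideal I -> I x -> I (- x).
Proof. by move=> HI Ix; rewrite -mulN1r; apply: idealM. Qed.

Lemma idealB I x y : is_ideal I -> I x -> I y -> I (x - y).
Proof. by move=> HI Ix Iy; apply: idealD => //; apply: idealN. Qed.

Lemma ideal_sum I (T : Type) (r : seq T) (F : T -> R) :
  is_ideal I -> (forall i, I (F i)) -> I (\sum_(i <- r) F i).
Proof.
move=> HI HF; elim/big_ind: _ => // [|x y]; [exact: ideal0|exact: idealD].
Qed.

Lemma sub_ideal_gen I : I `<=` ideal_gen I.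
Proof. exact: sub_gen_smallest. Qed.

Lemma ideal_gen_sub I J : is_ideal J -> I `<=` J -> ideal_gen I `<=` J.
Proof. exact: smallest_sub. Qed.

Lemma ideal_gen_id I : is_ideal I -> ideal_gen I = I.
Proof.
by move=> HI; apply/seteqP; split; [apply: ideal_gen_sub|apply: sub_ideal_gen].
Qed.

Definition ideal_add I J : set R := [set z | exists x y, [/\ I x, J y & z = x + y]].

Lemma ideal_add_ideal I J : is_ideal I -> is_ideal J -> is_ideal (ideal_add I J).
Proof.
move=> HI HJ; split.
  by exists 0, 0; split; rewrite ?addr0 //; apply: ideal0.
move=> a _ _ [x [y [Ix Jy ->]]] [x' [y' [Ix' Jy' ->]]].
exists (a * x + x'), (a * y + y'); split; last by rewrite mulrDr addrACA.
- by apply: HI.2.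
- by apply: HJ.2.
Qed.

Lemma ideal_addl I J : is_ideal J -> I `<=` ideal_add I J.
Proof. by move=> HJ x Ix; exists x, 0; rewrite addr0; split=> //; apply: ideal0. Qed.

Lemma ideal_addr I J : is_ideal I -> J `<=` ideal_add I J.
Proof. by move=> HI x Jx; exists 0, x; rewrite add0r; split=> //; apply: ideal0. Qed.

Lemma ideal_add_sub I J K : is_ideal K -> I `<=` K -> J `<=` K -> ideal_add I J `<=` K.
Proof. by move=> HK IK JK _ [x [y [/IK Kx /JK Ky ->]]]; apply: idealD. Qed.

Definition ideal_scale x I : set R := [set x * y | y in I].

Lemma ideal_scale_ideal x I : is_ideal I -> is_ideal (ideal_scale x I).
Proof.
move=> HI; split; first by exists 0; rewrite ?mulr0 //; apply: ideal0.
move=> a _ _ [y Iy <-] [z Iz <-]; exists (a * y + z); first exact: HI.2.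
by rewrite mulrDr mulrCA.
Qed.

Lemma is_idealT : is_ideal [set: R]. Proof. by []. Qed.

End IdealBasics.

(** * Leading exponents and division *)

Section Leading.
Variables (k : fieldType) (q : nat) (rho : expo q -> nat).
Hypothesis rhoP : monomial_order rho.
Local Notation S := (mseries k q).
Implicit Types (f g v : S) (a b e m : expo q) (B : set S).

(** The leading exponent is the smallest one, since a power series need not have a largest. *)
Definition is_lead f e :=
  mcoef f e != 0 /\ forall e', mcoef f e' != 0 -> (rho e <= rho e')%N.

Definition leads B e := exists2 f, B f & is_lead f e.

Lemma lead_exists f : f != 0 -> exists e, is_lead f e.
Proof.
move=> f0; have [e fe] : exists e, mcoef f e != 0.
  apply: contrapT => H; case/eqP: f0; apply: mseriesP => m.
  by apply/eqP/negPn/negP => fm; apply: H; exists m.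
have ex : exists n, `[< exists2 e', mcoef f e' != 0 & rho e' = n >].
  by exists (rho e); apply/asboolP; exists e.
case: (ex_minnP ex) => n /asboolP[e' fe' <-] H.
by exists e'; split=> // e'' fe''; apply: H; apply/asboolP; exists e''.
Qed.

Lemma lead_mono c e : c != 0 -> is_lead (mono c e) e.
Proof.
move=> c0; split=> [|e']; rewrite mcoef_mono ?eqxx //.
by case: (eqVneq e' e) => [->|_]; rewrite ?eqxx.
Qed.

Lemma lead_mul f g a b : is_lead f a -> is_lead g b ->
  is_lead (f * g) (a + b) /\ mcoef (f * g) (a + b) = mcoef f a * mcoef g b.
Proof.
move=> [fa fm] [gb gm].
have E : mcoef (f * g) (a + b) = mcoef f a * mcoef g b.
  apply: mcoefM_one => a' b' ab /fm aa' /gm bb'.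
  by have [] := mo_eqD rhoP aa' bb' ab.
split=> //; split=> [|e' /mcoefM_supp[a' [b' [<- /fm aa' /gm bb']]]].
  by rewrite E mulf_neq0.
exact: mo_leD.
Qed.

Lemma lead_monoM c e f a : c != 0 -> is_lead f a -> is_lead (mono c e * f) (e + a).
Proof. by move=> c0 fa; have [] := lead_mul (lead_mono e c0) fa. Qed.

Lemma lead_neq0 f e : is_lead f e -> f != 0.
Proof. by move=> [fe _]; apply: contra fe => /eqP ->; rewrite mcoef0. Qed.

Lemma leads_add B e a : is_ideal B -> leads B e -> leads B (e + a).
Proof.
move=> HB [f Bf fe]; exists (mono 1 a * f); first exact: idealM.
by rewrite addrC; apply: lead_monoM; rewrite ?oner_eq0.
Qed.

Lemma leads_sub B B' : B `<=` B' -> forall e, leads B e -> leads B' e.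
Proof. by move=> BB' e [f /BB' Bf fe]; exists f. Qed.

Definition order_ideal N : set S := [set f | forall e, mcoef f e != 0 -> (N <= rho e)%N].

Definition weight_ideal (w : 'I_q -> nat) N : set S :=
  [set f | forall e, mcoef f e != 0 -> (N <= wdeg w e)%N].

Let supp_ideal (t : expo q -> nat) N : (forall a b, t b <= t (a + b)%R)%N ->
  is_ideal [set f : S | forall e, mcoef f e != 0 -> (N <= t e)%N].
Proof.
move=> tD; split=> [e|c f g Hf Hg e]; first by rewrite mcoef0 eqxx.
rewrite mcoefD; have [E|ge _] := eqVneq (mcoef g e) 0; last exact: Hg.
rewrite E addr0 => /mcoefM_supp[a [b [<- _ fb]]].
exact: leq_trans (Hf b fb) (tD a b).
Qed.

Lemma order_ideal_ideal N : is_ideal (order_ideal N).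
Proof. by apply: supp_ideal => a b; rewrite addrC mo_leDr. Qed.

Lemma weight_ideal_ideal w N : is_ideal (weight_ideal w N).
Proof. by apply: supp_ideal => a b; rewrite wdegD leq_addl. Qed.

Lemma order_ideal_bigcap f : (forall N, order_ideal N f) -> f = 0.
Proof.
move=> H; apply: mseriesP => e; apply/eqP/negPn/negP => fe.
by have := H (rho e).+1 e fe; rewrite ltnn.
Qed.

Section Division.
Variables (s : nat) (g : 'I_s -> S) (mu : 'I_s -> expo q) (B : set S).
Hypothesis HB : is_ideal B.
Hypothesis Bg : forall i, B (g i).
Hypothesis g_lead : forall i, is_lead (g i) (mu i).
Hypothesis Blead : forall e, leads B e -> exists i, edvd (mu i) e.

(** By injectivity at most one exponent has rank N, so one monomial multiple of one divisor removes
    it. The hypotheses on [v] stand under the existential so that [choice] yields a function of all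
    pairs (N, v). *)
Let step N v : exists u : 'I_s -> S, B v -> order_ideal N v ->
  order_ideal N.+1 (v - \sum_i u i * g i) /\
  forall i e, mcoef (u i) e != 0 -> rho (e + mu i) = N.
Proof.
case: (pselect (B v /\ order_ideal N v)) => [[Bv Nv]|nH]; last by exists (fun=> 0) => Bv Nv; case: nH.
case: (pselect (exists2 e, rho e = N & mcoef v e != 0)) => [[e eN ve]|nH]; last first.
  exists (fun=> 0) => _ _; split=> [e|i e]; last by rewrite mcoef0 eqxx.
  rewrite big1 => [|i _]; last by rewrite mul0r.
  rewrite subr0 => ve; rewrite ltn_neqAle Nv // andbT; apply/eqP => eN.
  by apply: nH; exists e.
have lve : is_lead v e by split=> // e'; rewrite eN; apply: Nv.
have [i ie] := Blead (ex_intro2 _ _ v Bv lve).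
have [gi _] := g_lead i.
pose c := mcoef v e / mcoef (g i) (mu i).
exists (fun j => if j == i then mono c (esub e (mu i)) else 0) => _ _; split; last first.
  move=> j a; case: (eqVneq j i) => [->|_]; last by rewrite mcoef0 eqxx.
  rewrite mcoef_mono; case: (eqVneq a (esub e (mu i))) => [-> _|_]; last by rewrite eqxx.
  by rewrite addrC esubK.
rewrite (bigD1 i) //= eqxx big1 => [|j /negPf ->]; last by rewrite mul0r.
rewrite addr0 => a; rewrite mcoefB => H.
have Na : (N <= rho a)%N.
  have [E|va] := eqVneq (mcoef v a) 0; last exact: Nv.
  move: H; rewrite E sub0r oppr_eq0 => /mcoef_monoM_supp[b -> gb].
  rewrite -eN -{1}(esubK ie) addrC mo_le_add2l //.
  by have [_ ->] := g_lead i.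
rewrite ltn_neqAle Na andbT; apply/eqP; rewrite -eN => /(mo_inj rhoP) ae.
have E : mcoef (mono c (esub e (mu i)) * g i) e = mcoef v e.
  by have := mcoef_monoM c (esub e (mu i)) (g i) (mu i); rewrite [X in mcoef _ X]addrC esubK // /c divfK.
by case/eqP: H; rewrite -ae E subrr.
Qed.

(* The quotients are assembled coefficientwise: the division step at order N only
   produces the terms [e] of the i-th quotient with [rho (e + mu i) = N]. *)
Theorem division v : B v -> exists h : 'I_s -> S, v = \sum_i h i * g i /\
  forall i e, mcoef (h i) e != 0 ->
    exists2 e0, mcoef v e0 != 0 & (rho e0 <= rho (e + mu i)%R)%N.
Proof.
have [->|v0] := eqVneq v 0.
  move=> _; exists (fun=> 0); split=> [|i e]; last by rewrite mcoef0 eqxx.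
  by rewrite big1 // => i _; rewrite mul0r.
have [e0 [ve0 vmin]] := lead_exists v0 => Bv.
have /choice[F HF] : forall x : nat * S, exists u : 'I_s -> S,
    B x.2 -> order_ideal x.1 x.2 ->
    order_ideal x.1.+1 (x.2 - \sum_i u i * g i) /\
    forall i e, mcoef (u i) e != 0 -> rho (e + mu i) = x.1.
  by move=> x; apply: step.
(* Starting at the order of [v] instead of 0 gives the lower bound on the terms of the quotients, on
   which Artin-Rees rests. *)
pose N0 := rho e0.
pose r := fix r j := if j is j'.+1 then r j' - \sum_i F ((N0 + j')%N, r j') i * g i else v.
have rP j : B (r j) /\ order_ideal (N0 + j) (r j).
  elim: j => [|j [Brj Nrj]] /=; first by split=> // e; rewrite addn0; apply: vmin.
  rewrite addnS; have [H _] := HF (N0 + j, r j)%N Brj Nrj; split=> //.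
  apply: idealB => //; apply: ideal_sum => // i; exact: idealM.
pose u j := F ((N0 + j)%N, r j).
have uP j i e : mcoef (u j i) e != 0 -> rho (e + mu i) = (N0 + j)%N.
  by move=> ue; have [Brj Nrj] := rP j; have [_] := HF (N0 + j, r j)%N Brj Nrj; apply.
pose h i : S := MSeries (fun e => if (N0 <= rho (e + mu i)%R)%N
                         then mcoef (u (rho (e + mu i)%R - N0)%N i) e else 0).
exists h; split; last first.
  move=> i e /=; case: leqP => // [N0e _|_]; last by rewrite eqxx.
  by exists e0.
have rE j : r j = v - \sum_i (\sum_(j' < j) u j' i) * g i.
  elim: j => [|j IH] /=.
    by rewrite big1 ?subr0 // => i _; rewrite big_ord0 mul0r.
  rewrite {1}IH -addrA -opprD -big_split /=; congr (_ - _).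
  by apply: eq_bigr => i _; rewrite big_ord_recr /= mulrDl.
apply/eqP; rewrite -subr_eq0; apply/eqP/order_ideal_bigcap => N.
(* The remainder after N steps has order at least N, and [h i] differs from its first N partial
   quotients only in terms [a] with [rho (a + mu i)] at least N. *)
have -> : v - \sum_i h i * g i = r N + \sum_i (\sum_(j < N) u j i - h i) * g i.
  rewrite rE -addrA; congr (_ + _); rewrite addrC -sumrB -sumrN; apply: eq_bigr => i _.
  by rewrite mulrBl addrAC subrr add0r.
apply: (idealD (order_ideal_ideal N)).
  by move=> e /(rP N).2; apply: leq_trans; rewrite leq_addl.
apply: (ideal_sum _ (order_ideal_ideal N)) => i e /mcoefM_supp[a [b [<- ha gb]]].
have mb : (rho (mu i) <= rho b)%N by have [_ ->] := g_lead i.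
suff : (N <= rho (a + mu i)%R)%N by move/leq_trans; apply; rewrite mo_le_add2l.
rewrite leqNgt; apply/negP => aN; case/eqP: ha.
rewrite mcoefB mcoef_sum /=; case: leqP => N0a; last first.
  rewrite subr0 big1 // => j _; apply/eqP/negPn/negP => /uP; lia.
have jN : (rho (a + mu i)%R - N0 < N)%N by lia.
rewrite (bigD1 (Ordinal jN)) //= big1 ?addr0 ?subrr // => j /eqP jj.
apply/eqP/negPn/negP => /uP E; apply: jj; apply/val_inj => /=; lia.
Qed.

End Division.
End Leading.

(** * Standard bases and the Artin-Rees lemma *)

Section Dickson.

(** Each index is chosen where [f] is least on the tail after the previous one. *)
Lemma nondecreasing_subseq (f : nat -> nat) : exists phi : nat -> nat,
  (forall i, phi i < phi i.+1)%N /\ (forall i, f (phi i) <= f (phi i.+1))%N.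
Proof.
have /choice[g gP] : forall n, exists m, (n <= m)%N /\ forall m', (n <= m')%N -> (f m <= f m')%N.
  move=> n.
  have ex : exists v, `[< exists2 m, (n <= m)%N & f m = v >] by exists (f n); apply/asboolP; exists n.
  case: (ex_minnP ex) => v /asboolP[m nm <-] H; exists m; split=> // m' nm'.
  by apply: H; apply/asboolP; exists m'.
pose phi := fix phi n := if n is n'.+1 then g (phi n').+1 else g 0%N.
exists phi; split=> i /=; first by have [] := gP (phi i).+1.
have [gi _] := gP (phi i).+1.
case: i gi => [|i] gi /=; apply: (gP _).2 => //.
by apply: leq_trans gi; apply: leqW; have [] := gP (phi i).+1.
Qed.

Lemma increasing_ge (phi : nat -> nat) : (forall i, phi i < phi i.+1)%N ->
  forall i j, (i < j)%N -> (phi i < phi j)%N.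
Proof.
move=> H i; elim=> // j IH; rewrite ltnS leq_eqVlt => /predU1P[->//|/IH].
by move/ltn_trans; apply.
Qed.

Lemma expo_subseq q (u : nat -> expo q) :
  exists phi : nat -> nat, (forall i, phi i < phi i.+1)%N /\ forall i, edvd (u (phi i)) (u (phi i.+1)).
Proof.
suff : forall s : seq 'I_q, exists phi : nat -> nat, (forall i, phi i < phi i.+1)%N /\
    forall i j, j \in s -> (u (phi i) j <= u (phi i.+1) j)%N.
  move=> /(_ (enum 'I_q))[phi [phiP H]]; exists phi; split=> // i; apply/forallP => j.
  by apply: H; rewrite mem_enum.
elim=> [|j s [phi [phiP H]]]; first by exists id.
have [psi [psiP Hj]] := nondecreasing_subseq (fun i => u (phi i) j).
exists (phi \o psi); split=> [i /=|i l]; first exact: increasing_ge.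
rewrite inE => /predU1P[->|ls]; first exact: Hj.
have : forall a b, (a <= b)%N -> (u (phi a) l <= u (phi b) l)%N.
  move=> a; elim=> [|b IH]; first by rewrite leqn0 => /eqP ->.
  rewrite leq_eqVlt => /predU1P[->//|/IH ab]; exact: leq_trans (H b l ls).
by apply; apply: ltnW.
Qed.

(** Otherwise one could choose forever elements of [U] that no earlier choice divides, against
    [expo_subseq]. *)
Lemma dickson q (U : set (expo q)) : exists s : seq (expo q),
  (forall a, a \in s -> U a) /\ forall e, U e -> exists2 a, a \in s & edvd a e.
Proof.
apply: contrapT => nH.
have /choice[c cP] : forall s : seq (expo q), exists e, (forall a, a \in s -> U a) ->
    U e /\ forall a, a \in s -> ~ edvd a e.
  move=> s; case: (pselect (forall a, a \in s -> U a)) => [sU|]; last by exists 0.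
  apply: contrapT => H; apply: nH; exists s; split=> // e Ue.
  apply: contrapT => H'; apply: H; exists e => _; split=> // a sa ae.
  by apply: H'; exists a.
pose L := fix L n := if n is n'.+1 then c (L n') :: L n' else [::].
have LU n a : a \in L n -> U a.
  elim: n a => //= n IH a; rewrite inE => /predU1P[->|/IH//].
  exact: (cP _ IH).1.
have Lc i j : (i < j)%N -> c (L i) \in L j.
  elim: j => //= j IH; rewrite ltnS leq_eqVlt inE => /predU1P[->|/IH ->].
    by rewrite eqxx.
  by rewrite orbT.
have [phi [phiP H]] := expo_subseq (c \o L).
by have [_ /(_ _ (Lc _ _ (phiP 0%N)))] := cP _ (@LU (phi 1%N)); apply; apply: H.
Qed.

End Dickson.

Section LeadIdeals.
Variables (k : fieldType) (q : nat) (rho : expo q -> nat).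
Hypothesis rhoP : monomial_order rho.
Local Notation S := (mseries k q).
Local Notation leads := (leads rho).
Local Notation is_lead := (is_lead rho).
Implicit Types (f g v : S) (a b e m : expo q) (B : set S).

Lemma standard_basis B : exists (s : nat) (g : 'I_s -> S) (mu : 'I_s -> expo q),
  [/\ forall i, B (g i), forall i, is_lead (g i) (mu i) &
      forall e, leads B e -> exists i, edvd (mu i) e].
Proof.
have [s [sB sdiv]] := dickson [set e | leads B e].
have /choice[G GP] : forall i : 'I_(size s), exists f, B f /\ is_lead f (tnth (in_tuple s) i).
  by move=> i; have [f Bf lf] := sB _ (mem_tnth i (in_tuple s)); exists f.
exists (size s), G, (tnth (in_tuple s)); split=> [i|i|e /sdiv[a /seq_tnthP[i ->]]].
- by have [] := GP i.
- by have [] := GP i.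
- by exists i.
Qed.

(** A standard basis of the smaller ideal serves as divisors for the larger one, and division leaves
    no remainder. Hence strict inclusions are visible on leading exponents. *)
Lemma leads_sub_ideal B B' : is_ideal B -> is_ideal B' -> B `<=` B' ->
  (forall e, leads B' e -> leads B e) -> B' `<=` B.
Proof.
move=> HB HB' BB' H v B'v.
have [s [g [mu [Bg lg gdiv]]]] := standard_basis B.
have [h [-> _]] := division rhoP HB' (fun i => BB' _ (Bg i)) lg (fun e le => gdiv e (H e le)) B'v.
by apply: ideal_sum => // i; apply: idealM.
Qed.

(** The leading exponent of [f] is 0, which divides every exponent; the inverse is the quotient of 1
    by [f]. *)
Lemma series_unit f : mcoef f 0 != 0 -> exists h, h * f = 1.
Proof.
move=> f0.
have lf : is_lead f 0 by split=> // e _; apply: mo_ge0.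
have Tdiv e : leads [set: S] e -> exists i : 'I_1, edvd (0 : expo q) e.
  by move=> _; exists ord0; apply/forallP => i; rewrite expo0.
have [h [-> _]] := division rhoP (@is_idealT S) (fun _ : 'I_1 => I : setT f) (fun=> lf) Tdiv (I : setT 1).
by exists (h ord0); rewrite big_ord1.
Qed.

Lemma proper_ideal B f : is_ideal B -> ~ B 1 -> B f -> mcoef f 0 = 0.
Proof.
move=> HB B1 Bf; apply/eqP/negPn/negP => /series_unit[h hf].
by apply: B1; rewrite -hf; apply: idealM.
Qed.

Lemma leads_proper B : is_ideal B -> ~ B 1 -> ~ leads B 0.
Proof. by move=> HB B1 [f /(proper_ideal HB B1) f0 [/eqP]]. Qed.

(** Divide [v] by a standard basis g_i of B + (f). The quotients lose at most the largest weight of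
    a leading exponent, which is [c], and g_i is congruent to a multiple y_i f modulo B, so u is the
    sum of the h_i y_i. *)
Lemma artin_rees (w : 'I_q -> nat) B f : refines w rho -> is_ideal B ->
  exists c, forall N v, ideal_add B (ideal_scale f setT) v -> weight_ideal w N v ->
    exists2 u, weight_ideal w (N - c) u & B (v - u * f).
Proof.
move=> wr HB; pose B' := ideal_add B (ideal_scale f setT).
have HB' : is_ideal B' by apply: ideal_add_ideal => //; apply: ideal_scale_ideal.
have [s [g [mu [Bg lg gdiv]]]] := standard_basis B'.
have /choice[y yP] : forall i, exists y, B (g i - y * f).
  move=> i; have [b [_ [Bb [y _ <-] gE]]] := Bg i.
  by exists y; rewrite gE mulrC addrK.
exists (\max_i wdeg w (mu i))%N => N v Bv Nv.
have [h [vE hP]] := division rhoP HB' Bg lg gdiv Bv.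
exists (\sum_i h i * y i).
  have HN : is_ideal (weight_ideal w (N - \max_i wdeg w (mu i)) : set S).
    exact: weight_ideal_ideal.
  apply: (ideal_sum _ HN) => i; rewrite mulrC; apply: (idealM _ HN).
  move=> e /hP[e0 /Nv Ne0 /(refines_le wr)]; rewrite wdegD.
  by have := @leq_bigmax_cond _ xpredT (fun j : 'I_s => wdeg w (mu j)) i isT; lia.
rewrite [X in B (X - _)]vE mulr_suml -sumrB; apply: ideal_sum => // i.
by rewrite -mulrA -mulrBr; apply: idealM.
Qed.

End LeadIdeals.

(** * Chains of ideals and Hilbert functions *)

Lemma count_ltn (T : eqType) (a a' : pred T) (s : seq T) x :
  subpred a' a -> x \in s -> a x -> ~~ a' x -> (count a' s < count a s)%N.
Proof.
move=> aa' + ax a'x; elim: s => //= y s IH.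
have := sub_count aa' s; rewrite inE => H /predU1P[<-|/IH].
  by rewrite ax (negPf a'x) add0n add1n.
by have := aa' y; case: (a' y) => [->//|_]; case: (a y); lia.
Qed.

Section Chains.
Variables (k : fieldType) (q : nat) (rho : expo q -> nat).
Hypothesis rhoP : monomial_order rho.
Local Notation S := (mseries k q).
Local Notation leads := (leads rho).
Local Notation is_lead := (is_lead rho).
Implicit Types (f g v : S) (a b e m : expo q) (B : set S) (s : seq (expo q)).

Definition nonleads s B := [seq e <- s | ~~ `[< leads B e >]].

Lemma nonleads_sub s B B' : B `<=` B' -> (size (nonleads s B') <= size (nonleads s B))%N.
Proof.
move=> BB'; rewrite !size_filter; apply: sub_count => e /=; apply: contra => /asboolP Be.
exact/asboolP/(leads_sub BB').
Qed.

Lemma nonleads_lt s B B' : is_ideal B -> is_ideal B' -> B `<` B' ->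
  (forall e, e \in s \/ leads B e) ->
  (size (nonleads s B') < size (nonleads s B))%N.
Proof.
rewrite properEneq => HB HB' [/eqP BB' sBB'] sB.
have [e B'e Be] : exists2 e, leads B' e & ~ leads B e.
  apply: contrapT => H; apply: BB'; apply/seteqP; split=> //.
  apply: (leads_sub_ideal rhoP) => // e B'e; apply: contrapT => Be; apply: H.
  by exists e.
have [es|//] := sB e.
rewrite !size_filter; apply: (count_ltn _ es) => [a /=||]; last by apply/negPn/asboolP.
  by apply: contra => /asboolP Ba; apply/asboolP/(leads_sub sBB').
exact/asboolPn.
Qed.

(** Each strict step gains a leading exponent, and it lies in [s] because [s] contains everything
    that does not lead at the start. *)
Lemma nonleads_chain s d (c : nat -> set S) :
  (forall i, (i <= d)%N -> is_ideal (c i)) -> (forall i, (i < d)%N -> c i `<` c i.+1) ->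
  (forall e, e \in s \/ leads (c 0%N) e) ->
  (d + size (nonleads s (c d)) <= size (nonleads s (c 0%N)))%N.
Proof.
move=> cI cS sc.
have c0 i : (i <= d)%N -> c 0%N `<=` c i.
  elim: i => [_ x //|i IH id]; have /properW cc := cS i id.
  exact: classical_sets.subset_trans (IH (ltnW id)) cc.
elim: d cI cS c0 => [|d IH] cI cS c0; first by rewrite add0n.
have dlt : (size (nonleads s (c d.+1)) < size (nonleads s (c d)))%N.
  apply: nonleads_lt (cS _ _) _ => //; [by apply: cI|by apply: cI|].
  by move=> e; have [|/(leads_sub (c0 d _)) ce] := sc e; [left|right; apply: ce].
have := IH (fun i id => cI i (leqW id)) (fun i id => cS i (leqW id)) (fun i id => c0 i (leqW id)).
lia.
Qed.

(** Add to B all series of order at least [rho e], for the [e] of highest rank in [s]: this makes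
    [e] lead but creates no leading exponent of smaller rank, so the rest of [s] remains for the
    next steps. *)
Lemma chain_of_nonleads s B : is_ideal B -> uniq s -> (forall e, e \in s -> ~ leads B e) ->
  exists c : nat -> set S, [/\ forall i, is_ideal (c i), forall i, B `<=` c i,
    c 0%N = B & forall i, (i < size s)%N -> c i `<` c i.+1].
Proof.
elim: {s}(size s) {-2}s (erefl (size s)) B => [|n IH] s sz B HB us sB.
  by exists (fun=> B); split=> [//|i x //|//|i]; rewrite sz.
have [e es emax] : exists2 e, e \in s & forall e', e' \in s -> (rho e' <= rho e)%N.
  have [x s0] : exists x, x \in s by case: s sz {us sB} => // x s _; exists x; rewrite mem_head.
  have ex : exists n, `[< exists2 e, e \in s & rho e = n >].
    by exists (rho x); apply/asboolP; exists x.
  have bd (m : nat) : `[< exists2 e, e \in s & rho e = m >] -> (m <= \max_(e <- s) rho e)%N.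
    by move=> /asboolP[e es <-]; apply: leq_bigmax_seq.
  case: (ex_maxnP ex bd) => m /asboolP[e es <-] H; exists e => // e' e's.
  by apply: H; apply/asboolP; exists e'.
pose G : set S := order_ideal rho (rho e).
have HG : is_ideal G by exact: order_ideal_ideal.
pose B' := ideal_add B G.
have HB' : is_ideal B' by exact: ideal_add_ideal.
have [|||c [cI cB c0 cS]] := IH (rem e s) _ B' HB'.
- by rewrite size_rem // sz.
- exact: rem_uniq.
- move=> e' e's [f [g [h [Bg Gh ->]]] [fe' fmin]].
  have e's' : e' \in s by apply: mem_rem e's.
  have lt : (rho e' < rho e)%N.
    rewrite ltn_neqAle emax // andbT; apply/eqP => /(mo_inj rhoP) E.
    by move: e's; rewrite E mem_rem_uniq // inE eqxx.
  have h0 a : (rho a < rho e)%N -> mcoef h a = 0.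
    by move=> ae; apply/eqP/negPn/negP => /Gh; rewrite leqNgt ae.
  apply: (sB e' e's'); exists g => //; split.
    by move: fe'; rewrite mcoefD h0 // addr0.
  move=> a ga; rewrite leqNgt; apply/negP => ae'.
  have : mcoef (g + h) a != 0 by rewrite mcoefD h0 ?addr0 //; apply: ltn_trans lt.
  by move/fmin; rewrite leqNgt ae'.
exists (fun i => if i is j.+1 then c j else B); split=> //.
- by case.
- case=> // i; exact: classical_sets.subset_trans (ideal_addl HG) (cB i).
- case=> [_|i]; last by rewrite sz ltnS => id; apply: cS; rewrite size_rem // sz.
  rewrite c0 properEneq; split; last exact: ideal_addl.
  apply/eqP => BB'; apply: (sB e es); rewrite BB'.
  exists (mono 1 e); last by apply: lead_mono; rewrite oner_eq0.
  apply: ideal_addr => // a; rewrite mcoef_mono.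
  by case: (eqVneq a e) => [->|_ /eqP].
Qed.

End Chains.

(** * Hilbert functions along chains of primes *)

Section Dimension.
Variables (k : fieldType) (q : nat) (rho : expo q -> nat) (w : 'I_q -> nat).
Hypotheses (rhoP : monomial_order rho) (wr : refines w rho) (w_gt0 : forall i, (0 < w i)%N).
Local Notation S := (mseries k q).
Local Notation leads := (leads rho).
Implicit Types (f g v : S) (a b e m : expo q) (B : set S) (s : seq (expo q)).

Definition low_expos N : seq (expo q) :=
  [seq e <- map (@unbox q N) (enum {: {ffun 'I_q -> 'I_N.+1}}) | (wdeg w e < N)%N].

Lemma low_expos_uniq N : uniq (low_expos N).
Proof. by rewrite filter_uniq // map_inj_uniq ?enum_uniq //; exact: unbox_inj. Qed.

Lemma mem_low_expos N e : (e \in low_expos N) = (wdeg w e < N)%N.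
Proof.
rewrite mem_filter andb_idr // => eN.
have [|a <-] := @unbox_surj q N e; last by apply: map_f; rewrite mem_enum.
by move=> i; apply: leq_trans (leq_wdeg e (w_gt0 i)) (ltnW eN).
Qed.

Lemma leads_add_weight B N e : (wdeg w e < N)%N ->
  leads (ideal_add B (weight_ideal w N)) e -> leads B e.
Proof.
move=> eN [_ [g [h [Bg Nh ->]]] [fe fmin]].
have h0 a : (rho a <= rho e)%N -> mcoef h a = 0.
  move=> /(refines_le wr) ae; apply/eqP/negPn/negP => /Nh.
  by rewrite leqNgt (leq_ltn_trans ae eN).
exists g => //; split; first by move: fe; rewrite mcoefD h0 // addr0.
move=> a ga; rewrite leqNgt; apply/negP => ae.
have : mcoef (g + h) a != 0 by rewrite mcoefD h0 ?addr0 // ltnW.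
by move/fmin; rewrite leqNgt ae.
Qed.

Lemma leads_weight N e : (N <= wdeg w e)%N -> leads (weight_ideal w N : set S) e.
Proof.
move=> Ne; exists (mono 1 e); last by apply: lead_mono; rewrite oner_eq0.
by move=> a; rewrite mcoef_mono; case: (eqVneq a e) => [->|_ /eqP].
Qed.

(** When [rho] refines [w], this is the Hilbert-Samuel function of the quotient by B for the
    filtration by weight: the length modulo B and all series of weight at least N. *)
Definition hilbert B N := size (nonleads rho (low_expos N) B).

Lemma hilbert_homo B N N' : (N <= N')%N -> (hilbert B N <= hilbert B N')%N.
Proof.
move=> NN'; apply: uniq_leq_size; first by rewrite filter_uniq ?low_expos_uniq.
move=> e; rewrite mem_filter => /andP[Be]; rewrite mem_low_expos => eN.
by rewrite mem_filter Be mem_low_expos (leq_trans eN).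
Qed.

(* Multiplying by f in Q outside P a chain of ideals above P + (weight >= N - c) gives, by
   Artin-Rees and the primality of P, a strict chain above P + (weight >= N) inside Q. *)
Lemma hilbert_step (P Q : set S) : prime_ideal P -> is_ideal Q -> P `<` Q ->
  exists c, forall N, (hilbert Q N + hilbert P (N - c) <= hilbert P N)%N.
Proof.
move=> [HP P1 Pprime] HQ [PQ /existsNP[f /not_implyP[Qf Pf]]].
have [c AR] := artin_rees rhoP f wr HP; exists c => N.
have HN M : is_ideal (weight_ideal w M : set S) by exact: weight_ideal_ideal.
pose t := nonleads rho (low_expos (N - c)) P.
have HB : is_ideal (ideal_add P (weight_ideal w (N - c))) by exact: ideal_add_ideal.
have [||C [CI CB C0 CS]] := chain_of_nonleads rhoP HB (s := t).
- by rewrite filter_uniq ?low_expos_uniq.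
- move=> e; rewrite mem_filter mem_low_expos => /andP[/asboolPn Pe eN].
  by move=> /(leads_add_weight eN).
pose PN := ideal_add P (weight_ideal w N).
have HPN : is_ideal PN by exact: ideal_add_ideal.
pose D i := ideal_add PN (ideal_scale f (C i)).
have HD i : is_ideal (D i) by apply: ideal_add_ideal => //; apply: ideal_scale_ideal.
have PD i : P `<=` D i.
  by apply: (classical_sets.subset_trans (ideal_addl (HN N))); apply: ideal_addl; apply: ideal_scale_ideal.
have ND i : weight_ideal w N `<=` D i.
  by apply: (classical_sets.subset_trans (ideal_addr HP)); apply: ideal_addl; apply: ideal_scale_ideal.
have DS i : (i < size t)%N -> D i `<` D i.+1.
  move=> /CS[Cii Cni]; split=> [|DD].
    apply: ideal_add_sub => //; first by apply: ideal_addl; apply: ideal_scale_ideal.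
    move=> _ [y Cy <-]; apply: ideal_addr => //; exists y => //; exact: Cii.
  apply: Cni => b Cb.
  have [_ [_ [[p [v [Pp Nv ->]]] [b' Cb' <-] fbE]]] : D i (f * b).
    by apply: DD; apply: ideal_addr => //; exists b.
  have vE : v = - p + f * (b - b') by rewrite mulrBr fbE; ring.
  (* Artin-Rees replaces [v] modulo P by [u * f] with [u] of weight at least N - c. Then [f] cancels
     modulo the prime P, so [b] is [b'] plus an element of P plus [u], and all three lie in
     [C i]. *)
  have [|u Nu Pu] := AR N v _ Nv.
    by exists (- p), (f * (b - b')); split=> //; [apply: idealN|exists (b - b')].
  have : P (f * (b - b' - u)).
    have -> : f * (b - b' - u) = (v - u * f) + p by rewrite vE; ring.
    exact: idealD.
  case/Pprime => // Pb.
  have -> : b = b' + ((b - b' - u) + u) by ring.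
  apply: idealD => //; apply: (CB i); exists (b - b' - u), u; split=> //.
have sD e : e \in low_expos N \/ leads (D 0%N) e.
  rewrite mem_low_expos; case: ltnP => eN; first by left.
  by right; apply: leads_sub (leads_weight eN); apply: ND.
have := @nonleads_chain _ _ _ rhoP (low_expos N) (size t) D (fun i _ => HD i) DS sD.
have H1 := @nonleads_sub _ _ rho (low_expos N) _ _ (PD 0%N).
(* The top of the chain is still inside Q + (weight >= N), which leaves at least [hilbert Q N]
   exponents of weight below N that do not lead. *)
suff : (hilbert Q N <= size (nonleads rho (low_expos N) (D (size t))))%N.
  by rewrite /hilbert -/t; lia.
apply: (@leq_trans (size (nonleads rho (low_expos N) (ideal_add Q (weight_ideal w N))))); last first.
  apply: nonleads_sub; have HQN : is_ideal (ideal_add Q (weight_ideal w N)) by exact: ideal_add_ideal.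
  apply: ideal_add_sub => //.
    apply: ideal_add_sub => //; last exact: ideal_addr.
    exact: classical_sets.subset_trans PQ (ideal_addl (HN N)).
  move=> _ [y _ <-]; apply: ideal_addl => //; rewrite mulrC; exact: idealM.
rewrite /hilbert !size_filter; apply/eq_leq/eq_in_count => e; rewrite mem_low_expos => eN.
congr (~~ _); apply/asbool_equiv_eq; split; last exact: leads_add_weight.
by apply: leads_sub; apply: ideal_addl.
Qed.

(** Along multiples of a fixed step, [hilbert_step] becomes the recursion of Pascal's triangle. *)
Lemma hilbert_chain d (c : nat -> set S) : (forall i, (i <= d)%N -> prime_ideal (c i)) ->
  (forall i, (i < d)%N -> c i `<` c i.+1) ->
  exists M, forall N, ('C(N, d) <= hilbert (c 0%N) (N * M).+1)%N.
Proof.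
elim: d c => [|d IH] c cP cS.
  exists 1%N => N; rewrite bin0.
  have [HP P1 _] := cP 0%N isT.
  have : 0 \in nonleads rho (low_expos (N * 1).+1) (c 0%N).
    rewrite mem_filter mem_low_expos wdeg0 andbT; apply/asboolPn.
    exact: leads_proper.
  by rewrite /hilbert; case: nonleads.
have [M HM] := IH (c \o succn) (fun i => cP i.+1) (fun i => cS i.+1).
have [x Hx] := hilbert_step (cP 0%N isT) (let: And3 H _ _ := cP 1%N isT in H) (cS 0%N isT).
(* Here [x] absorbs the shift in [hilbert_step], and [M] is the step already needed by the shorter
   chain. *)
exists (M + x)%N; elim=> [|N IHN]; first by rewrite bin0n.
rewrite binS; apply: leq_trans (Hx _); rewrite addnC; apply: leq_add.
  rewrite (leq_trans _ (leq_trans (HM N) _)) //; apply: hilbert_homo; nia.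
by apply: leq_trans IHN _; apply: hilbert_homo; nia.
Qed.

Lemma chain_length_le3 d (c : nat -> set S) A : (forall i, (i <= d)%N -> prime_ideal (c i)) ->
  (forall i, (i < d)%N -> c i `<` c i.+1) ->
  (forall N, hilbert (c 0%N) N <= A * N ^ 3)%N -> (d <= 3)%N.
Proof.
move=> cP cS HA; rewrite leqNgt; apply/negP => d4.
have [M HM] := hilbert_chain (fun i id => cP i (leq_trans id d4)) (fun i id => cS i (leq_trans id d4)).
(* For K >= 3 one has K^4 <= 24 C(K+3, 4) and (K+3) M + 1 <= K (2M+1). Growth of degree 4 under a
   cubic bound thus gives K^4 <= B K^3, which fails once K > B. *)
pose B := (24 * A * (2 * M + 1) ^ 3)%N.
have [K [BK K3]] : exists K, (B < K /\ 3 <= K)%N by exists (B + 3)%N; lia.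
have := leq_trans (HM (K + 3)%N) (HA _).
have : (K ^ 4 <= 24 * 'C(K + 3, 4))%N.
  have := bin_ffact (K + 3) 4; rewrite mulnC => ->; rewrite !ffactnS ffactn0 muln1 addn3 /=.
  by rewrite !expnS expn0 muln1; do !(apply: leq_mul; first by lia); lia.
have : (((K + 3) * M).+1 ^ 3 <= (K * (2 * M + 1)) ^ 3)%N by rewrite leq_exp2r //; nia.
rewrite expnMn => H1 H2 H3.
have : (K ^ 4 <= 24 * (A * (K ^ 3 * (2 * M + 1) ^ 3)))%N.
  by apply: leq_trans H2 _; rewrite leq_mul2l /=; apply: leq_trans H3 _; rewrite leq_mul2l H1 orbT.
have -> : (24 * (A * (K ^ 3 * (2 * M + 1) ^ 3)) = B * K ^ 3)%N by rewrite /B; ring.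
by rewrite expnS leq_pmul2r ?expn_gt0; lia.
Qed.

End Dimension.

(** * Quotients of power series rings *)

Lemma nat_supremumE (A : set nat) n : A n -> ubound A n -> supremum 0%N A = n.
Proof.
move=> An An'; rewrite /supremum ifF; last by apply/negP => /eqP E; move: An; rewrite E.
case: xgetP => [m _ [Am mA]|/(_ n) H].
  by apply: le_anti; rewrite mA //= Am.
by exfalso; apply: H; split=> // m; apply.
Qed.

Lemma nat_supremum_le (A : set nat) n : ubound A n -> (supremum 0%N A <= n)%N.
Proof.
move=> An; rewrite /supremum; case: eqP => // _.
by case: xgetP => // m _ [_ mA]; apply: mA.
Qed.

Lemma nat_supremum_ge (A : set nat) n m : A m -> ubound A n -> (m <= supremum 0%N A)%N.
Proof.
move=> Am An; rewrite -leEnat; apply: ge_supremum_Nmem => //.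
by apply: nat_supremums_neq0; exists n.
Qed.

Lemma quot_pi0 (R : comPzRingType) (J : set R) : quot_pi J 0 = 0.
Proof. by apply: (addIr (quot_pi J 0)); rewrite -quot_piD !add0r. Qed.

Section Surjection.
Variables (S R : comPzRingType) (phi : {rmorphism S -> R}).
Hypothesis phi_surj : forall y, exists x, phi x = y.
Implicit Types (B C : set S) (I J : set R).

Definition rker : set S := phi @^-1` [set 0].

Lemma preimage_ideal I : is_ideal I -> is_ideal (phi @^-1` I).
Proof.
move=> HI; split=> [|a x y Ix Iy] /=; first by rewrite rmorph0; apply: ideal0.
by rewrite rmorphD rmorphM; apply: HI.2.
Qed.

Lemma rker_ideal : is_ideal rker.
Proof.
apply: preimage_ideal; split=> // a x y -> ->.
by rewrite /= mulr0 addr0.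
Qed.

Lemma rker_sub_preimage I : is_ideal I -> rker `<=` phi @^-1` I.
Proof. by move=> HI x /= ->; apply: ideal0. Qed.

Lemma image_ideal B : is_ideal B -> is_ideal (phi @` B).
Proof.
move=> HB; split; first by exists 0; rewrite ?rmorph0 //; apply: ideal0.
move=> a _ _ [x Bx <-] [y By <-]; have [b <-] := phi_surj a.
by exists (b * x + y); [apply: HB.2|rewrite rmorphD rmorphM].
Qed.

Lemma preimage_image B : phi @^-1` (phi @` B) = ideal_add rker B.
Proof.
apply/seteqP; split=> [x [y By yx]|_ [x [y [kx By ->]]]] /=; last first.
  by exists y => //; rewrite rmorphD kx add0r.
by exists (x - y), y; split=> //; rewrite ?subrK //= /rker /= rmorphB yx subrr.
Qed.

Lemma preimage_mono I J : I `<` J -> phi @^-1` I `<` phi @^-1` J.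
Proof.
move=> [IJ nJI]; split=> [x|H]; first exact: IJ.
by apply: nJI => y; have [x <-] := phi_surj y; apply: H.
Qed.

Lemma image_mono B C : is_ideal B -> rker `<=` B -> B `<` C -> phi @` B `<` phi @` C.
Proof.
move=> HB kB [BC nCB]; split=> [_ [x Bx <-]|H]; first by exists x => //; apply: BC.
apply: nCB => x Cx; have [|y By yx] := H (phi x); first by exists x.
rewrite -(subrK y x); apply: idealD => //; apply: kB.
by rewrite /rker /= rmorphB yx subrr.
Qed.

Lemma preimage_prime I : prime_ideal I -> prime_ideal (phi @^-1` I).
Proof.
move=> [HI I1 IP]; split=> /=; first exact: preimage_ideal.
  by rewrite rmorph1.
by move=> x y; rewrite /= rmorphM; apply: IP.
Qed.

Lemma image_prime B : rker `<=` B -> prime_ideal B -> prime_ideal (phi @` B).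
Proof.
move=> kB [HB B1 BP].
have im x : (phi @` B) (phi x) -> B x.
  move=> [y By yx]; rewrite -(subrK y x); apply: idealD => //; apply: kB.
  by rewrite /rker /= rmorphB yx subrr.
split; first exact: image_ideal.
  by move=> H; apply: B1; apply: im; rewrite rmorph1.
move=> x y; have [a <-] := phi_surj x; have [b <-] := phi_surj y.
rewrite -rmorphM => /im /BP[Ba|Bb]; [left; by exists a|right; by exists b].
Qed.

Lemma krull_dimE n (c : nat -> set S) :
  (forall i, (i <= n)%N -> prime_ideal (c i) /\ rker `<=` c i) ->
  (forall i, (i < n)%N -> c i `<` c i.+1) ->
  (forall d c', (forall i, (i <= d)%N -> prime_ideal (c' i) /\ rker `<=` c' i) ->
     (forall i, (i < d)%N -> c' i `<` c' i.+1) -> (d <= n)%N) ->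
  krull_dim R = n.
Proof.
move=> cP cS ub; apply: nat_supremumE.
  exists (fun i => phi @` c i); split=> i id.
    by have [] := cP i id => ? ?; apply: image_prime.
  by have [[? _ _] ?] := cP i (ltnW id); apply: image_mono => //; apply: cS.
move=> d [c' [c'P c'S]]; apply: (ub d (fun i => phi @^-1` c' i)) => i id.
  split; first by apply: preimage_prime; apply: c'P.
  by apply: rker_sub_preimage; have [] := c'P i id.
by apply: preimage_mono; apply: c'S.
Qed.

Lemma module_chain J d : is_ideal J ->
  chain_lengths (@is_submodule R (quot_ring J : lmodType R)) d ->
  exists c : nat -> set S, [/\ forall i, (i <= d)%N -> is_ideal (c i),
    phi @^-1` J `<=` c 0%N & forall i, (i < d)%N -> c i `<` c i.+1].
Proof.
move=> HJ [c [cP cS]].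
exists (fun i => [set x | c i (quot_pi J (phi x))]); split=> [i id|x Jx /=|i id].
- have [c0 cD] := cP i id; split=> [|a x y cx cy] /=.
    by rewrite rmorph0 quot_pi0.
  by rewrite rmorphD quot_piD rmorphM -quot_piM; apply: cD.
- have -> : quot_pi J (phi x) = 0.
    by rewrite -quot_pi0; apply/quot_pi_eq; rewrite subr0 ideal_gen_id.
  by have [] := cP 0%N isT.
have [cc ncc] := cS i id; split=> [x|H]; first exact: cc.
by apply: ncc; elim/quot_piP => y; have [x <-] := phi_surj y; apply: H.
Qed.

Lemma chain_module J d (c : nat -> set S) : is_ideal J ->
  (forall i, is_ideal (c i)) -> (forall i, phi @^-1` J `<=` c i) ->
  (forall i, (i < d)%N -> c i `<` c i.+1) ->
  chain_lengths (@is_submodule R (quot_ring J : lmodType R)) d.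
Proof.
move=> HJ cI cJ cS; exists (fun i => [set quot_pi J (phi x) | x in c i]); split=> [i _|i id].
  split; first by exists 0; rewrite ?rmorph0 ?quot_pi0 //; apply: ideal0.
  move=> a _ _ [x cx <-] [y cy <-]; have [b <-] := phi_surj a.
  exists (b * x + y); first by apply: (cI i).2.
  rewrite rmorphD quot_piD rmorphM; congr (_ + _); symmetry; exact: quot_piM.
have [cc ncc] := cS i id; split=> [_ [x cx <-]|H]; first by exists x => //; apply: cc.
apply: ncc => x cx; have [|y cy /esym/quot_pi_eq] := H (quot_pi J (phi x)); first by exists x.
rewrite ideal_gen_id // -rmorphB => Jxy.
by rewrite -(subrK y x); apply: idealD => //; apply: cJ.
Qed.

End Surjection.

(** * Lengths and primary ideals in a quotient of a power series ring *)

Section LocalPresentation.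
Variables (k : fieldType) (q : nat) (rho : expo q -> nat) (R : comPzRingType).
Hypothesis rhoP : monomial_order rho.
Local Notation S := (mseries k q).
Variable phi : {rmorphism S -> R}.
Hypothesis phi_surj : forall y, exists x, phi x = y.
Local Notation leads := (leads rho).
Implicit Types (B C : set S) (I J : set R) (s : seq (expo q)) (e : expo q).

Lemma colength_le J s : is_ideal J -> (forall e, e \in s \/ leads (phi @^-1` J) e) ->
  (colength J <= size s)%N.
Proof.
move=> HJ sJ; apply: nat_supremum_le => d /(module_chain phi_surj HJ)[c [cI c0 cS]].
have := @nonleads_chain _ _ _ rhoP s d c cI cS.
have sc e : e \in s \/ leads (c 0%N) e.
  by have [|/(leads_sub c0)] := sJ e; [left|right].
move=> /(_ sc) => H; have : (size (nonleads rho s (c 0%N)) <= size s)%N.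
  by rewrite size_filter count_size.
by move: H; rewrite leEnat; lia.
Qed.

(** The supremum in [nat] is 0 for unbounded lengths, so even a lower bound requires finiteness: the
    finite list [s'] provides it. *)
Lemma colength_ge J s s' : is_ideal J -> (forall e, e \in s' \/ leads (phi @^-1` J) e) ->
  uniq s -> (forall e, e \in s -> ~ leads (phi @^-1` J) e) -> (size s <= colength J)%N.
Proof.
move=> HJ s'J us sJ.
have [c [cI cJ c0 cS]] := chain_of_nonleads rhoP (preimage_ideal phi HJ) us sJ.
apply: (@nat_supremum_ge _ (size s')); first by apply: (chain_module phi_surj HJ cI cJ cS).
move=> d /(module_chain phi_surj HJ)[c' [c'I c'0 c'S]].
have := @nonleads_chain _ _ _ rhoP s' d c' c'I c'S.
have sc e : e \in s' \/ leads (c' 0%N) e.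
  by have [|/(leads_sub c'0)] := s'J e; [left|right].
move=> /(_ sc) => H; have : (size (nonleads rho s' (c' 0%N)) <= size s')%N.
  by rewrite size_filter count_size.
by move: H; rewrite leEnat; lia.
Qed.

Definition series_max : set S := [set f | mcoef f 0 = 0].

Lemma mcoefM0 (f g : S) : mcoef (f * g) 0 = mcoef f 0 * mcoef g 0.
Proof.
rewrite -{1}[0]addr0 mcoefM_one // => a b; rewrite addr0 => ab _ _.
apply/ffunP => i; rewrite expo0.
by have /ffunP/(_ i) := ab; rewrite expoD expo0; case: (a i).
Qed.

Lemma series_max_ideal : is_ideal series_max.
Proof.
split=> // a f g f0 g0; have : mcoef (a * f + g) 0 = 0; last by [].
by rewrite mcoefD mcoefM0 f0 g0 mulr0 addr0.
Qed.

Lemma proper_sub_max B : is_ideal B -> ~ B 1 -> B `<=` series_max.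
Proof. by move=> HB B1 f Bf; apply: (proper_ideal rhoP HB B1 Bf). Qed.

Hypothesis R_nz : (1 : R) != 0.
Let m := phi @` series_max.

Lemma rker_proper : ~ rker phi 1.
Proof. by rewrite /rker /= rmorph1; apply/eqP. Qed.

Lemma max_proper : ~ m 1.
Proof.
move=> [f f0 f1]; have : rker phi (1 - f) by rewrite /rker /= rmorphB rmorph1 f1 subrr.
move=> /(proper_sub_max (rker_ideal phi) rker_proper) E.
have : mcoef (1 - f) 0 = 0 := E; rewrite mcoefB mcoef1 eqxx f0 subr0 => /eqP.
by rewrite oner_eq0.
Qed.

Lemma max_ideal_sub J : is_ideal J -> ~ J 1 -> J `<=` m.
Proof.
move=> HJ J1 y; have [x <-] := phi_surj y => Jx; exists x => //.
apply: (proper_sub_max (preimage_ideal phi HJ)) => //=.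
by rewrite rmorph1.
Qed.

Lemma max_maximal : maximal_ideal m.
Proof.
split; [exact: image_ideal series_max_ideal|exact: max_proper|].
by move=> J HJ J1 mJ; apply/seteqP; split=> //; apply: max_ideal_sub.
Qed.

(** The powers of the variables in I are what makes the heights over an octant finite, and zero far
    from the corner. *)
Lemma max_primaryP I : max_primary I ->
  [/\ is_ideal I, ~ (phi @^-1` I) 1 & forall i, exists a, (phi @^-1` I) (mono 1 (eunit i *+ a))].
Proof.
move=> [HI [Hr r1 rmax]]; split=> //.
  by rewrite /= rmorph1 => I1; apply: r1; exists 1%N; rewrite expr1.
move=> i.
have mr : m `<=` radical I.
  by rewrite (rmax m) //; [exact: image_ideal series_max_ideal|exact: max_proper|exact: max_ideal_sub].
have [|a ma] := mr (phi (mono 1 (eunit i))).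
  exists (mono 1 (eunit i)) => //; rewrite /series_max /=.
  by case: (eqVneq 0 (eunit i)) => // /ffunP/(_ i); rewrite expo0 eunitE eqxx.
by exists a; rewrite /= -[1](expr1n _ a) -monoX rmorphXn.
Qed.

Lemma max_primary_weight (w : 'I_q -> nat) N : (forall i, (0 < w i)%N) -> (0 < N)%N ->
  max_primary (phi @` weight_ideal w N).
Proof.
move=> w0 N0.
have HF : is_ideal (weight_ideal w N : set S) by exact: weight_ideal_ideal.
split; first exact: image_ideal.
have Fm : weight_ideal w N `<=` series_max.
  move=> f Ff; rewrite /series_max /=; apply/eqP/negPn/negP => /Ff.
  by rewrite wdeg0; lia.
suff -> : radical (phi @` weight_ideal w N) = m by exact: max_maximal.
apply/seteqP; split=> [y|_ [f f0 <-]].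
  have [x <-] := phi_surj y => -[n]; rewrite -rmorphXn => -[g Fg gx].
  exists x => //; rewrite /series_max /=; apply/eqP/negPn/negP => /(series_unit rhoP)[h hx].
  apply: max_proper; exists (h ^+ n * g); last by rewrite rmorphM gx -rmorphM -exprMn hx expr1n rmorph1.
  by apply: (idealM _ series_max_ideal); apply: Fm.
exists N; rewrite -rmorphXn; exists (f ^+ N) => //.
elim: {N0 HF Fm}N => [|N IH] e; first by [].
rewrite exprS => /mcoefM_supp[a [b [<- fa /IH]]]; rewrite wdegD => bN.
suff : (0 < wdeg w a)%N by lia.
by rewrite wdeg_gt0 //; apply: contra fa => /eqP ->; apply/eqP.
Qed.

End LocalPresentation.

(** * Interpolation on the triangulated quadrant *)

Section TriangleSums.
Local Open Scope nat_scope.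
Implicit Types (m n x a b : nat).

Lemma sum_le_box x n : \sum_(b < n) (b <= x : nat) <= minn n x.+1.
Proof.
elim: n => [|n IH]; rewrite ?big_ord0 // big_ord_recr /=.
by move: IH; set A := \sum_(b < n) _; lia.
Qed.

Lemma sum_gt_box x n : \sum_(b < n) (x < b : nat) <= n - x.+1.
Proof.
elim: n => [|n IH]; rewrite ?big_ord0 // big_ord_recr /=.
by move: IH; set A := \sum_(b < n) _; lia.
Qed.

Lemma sum_sub x n : 2 * \sum_(b < n) (x - b) + (x - n) * (x - n).+1 <= x * x.+1.
Proof.
elim: n => [|n IH]; first by rewrite big_ord0 subn0.
rewrite big_ord_recr /= mulnDr; apply: leq_trans IH.
case: (leqP x n) => xn.
  have [-> ->] : x - n = 0 /\ x - n.+1 = 0 by lia.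
  by rewrite muln0 !mul0n !addn0.
rewrite (_ : x - n = (x - n.+1).+1); last by lia.
by move: (\sum_(b < n) _) (x - n.+1) => A y; nia.
Qed.

Lemma sum_addsub a m n : a <= m -> 2 * \sum_(b < n) (a + b - m) <= (a + n - m) * (a + n - m).
Proof.
move=> am; elim: n => [|n IH]; first by rewrite big_ord0 muln0.
rewrite big_ord_recr /= mulnDr.
case: (ltnP (a + n) m) => mn; last first.
  rewrite (_ : a + n.+1 - m = (a + n - m).+1); last by lia.
  by move: IH; move: (\sum_(b < n) _) (a + n - m) => A y; nia.
by rewrite (_ : a + n - m = 0) ?muln0 ?addn0 in IH *; [apply: leq_trans IH _|lia].
Qed.

(** This is the sum of a x - a^2, with the sum of squares moved to the left so that no subtraction
    in [nat] remains in the closed form. *)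
Lemma sum_parabola x n : n <= x ->
  6 * (\sum_(a < n.+1) a * (x - a)) + n * n.+1 * (2 * n + 1) = 3 * x * n * n.+1.
Proof.
elim: n => [|n IH] nx; first by rewrite big_ord1 !muln0 !mul0n.
rewrite big_ord_recr /= mulnDr; have := IH (ltnW nx).
set A := \sum_(a < n.+1) _; have [y xE] : exists y, x = n.+1 + y by exists (x - n.+1); lia.
rewrite (_ : x - n.+1 = y); last by lia.
by clearbody A; rewrite xE; nia.
Qed.

Lemma sum_parabola_le m : 6 * (\sum_(a < m) a * (m.+1 - a)) <= m * m.+1 * m.+2.
Proof.
case: m => [|m]; first by rewrite big_ord0.
have := @sum_parabola m.+2 m (leqW (leqnSn m)).
by set A := \sum_(a < m.+1) _; nia.
Qed.

Lemma sum_triangle n : 3 * (\sum_(a < n) a.+1 * a.+2) <= n * n.+1 * n.+2.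
Proof.
elim: n => [|n IH]; first by rewrite big_ord0.
by rewrite big_ord_recr /=; move: IH; move: (\sum_(a < n) _) => A; nia.
Qed.

(* The six coefficients of the interpolation over a square of side [m] cut
   along its antidiagonal; each sums to [m^3/6] up to [O(m^2)]. *)
Definition lower_sum m (f : nat -> nat -> nat) := \sum_(a < m) \sum_(b < m) (a + b <= m : nat) * f a b.
Definition upper_sum m (f : nat -> nat -> nat) := \sum_(a < m) \sum_(b < m) (m < a + b : nat) * f a b.

Lemma sum_lo_sub m : 6 * lower_sum m (fun a b => m - a - b) <= m * m.+1 * m.+2.
Proof.
apply: leq_trans (sum_triangle m); rewrite (_ : 6 = 3 * 2) // -mulnA leq_mul2l /=.
rewrite /lower_sum (reindex_inj rev_ord_inj) big_distrr /=; apply: leq_sum => a _.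
have := sum_sub a.+1 m; apply: leq_trans; apply: leq_trans (leq_addr _ _); rewrite leq_mul2l /=.
by apply: leq_sum => b _; have := ltn_ord a; case: (leqP _ m) => _; lia.
Qed.

Lemma sum_lo_l m : 6 * lower_sum m (fun a b => a) <= m * m.+1 * m.+2.
Proof.
apply: leq_trans (sum_parabola_le m); rewrite leq_mul2l /=; apply: leq_sum => a _.
rewrite -big_distrl /= mulnC leq_mul2l; apply/orP; right.
have am := ltn_ord a; apply: (@leq_trans (\sum_(b < m) (b <= m - a : nat))).
  by apply: leq_sum => b _; lia.
by apply: leq_trans (sum_le_box _ _) _; lia.
Qed.

Lemma sum_lo_r m : 6 * lower_sum m (fun a b => b) <= m * m.+1 * m.+2.
Proof.
apply: leq_trans (sum_lo_l m); rewrite leq_mul2l /= /lower_sum exchange_big /=.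
by apply: leq_sum => a _; apply: leq_sum => b _; rewrite addnC.
Qed.

Lemma sum_hi_l m : 6 * upper_sum m (fun a b => m - a) <= m * m.+1 * m.+2.
Proof.
apply: leq_trans (sum_parabola_le m); rewrite leq_mul2l /=; apply: leq_sum => a _.
rewrite -big_distrl /=; have am := ltn_ord a; apply: leq_mul; last by lia.
apply: (@leq_trans (\sum_(b < m) (m - a < b : nat))).
  by apply: leq_sum => b _; lia.
by apply: leq_trans (sum_gt_box _ _) _; lia.
Qed.

Lemma sum_hi_r m : 6 * upper_sum m (fun a b => m - b) <= m * m.+1 * m.+2.
Proof.
apply: leq_trans (sum_hi_l m); rewrite leq_mul2l /= /upper_sum exchange_big /=.
by apply: leq_sum => a _; apply: leq_sum => b _; rewrite addnC.
Qed.

Lemma sum_hi_add m : 6 * upper_sum m (fun a b => a + b - m) <= m * m.+1 * m.+2.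
Proof.
apply: leq_trans (sum_triangle m); rewrite (_ : 6 = 3 * 2) // -mulnA leq_mul2l /=.
rewrite /upper_sum big_distrr /=; apply: leq_sum => a _.
apply: (@leq_trans (a * a)); last by apply: leq_mul; lia.
have := @sum_addsub a m m (ltnW (ltn_ord a)); rewrite addnK; apply: leq_trans.
by rewrite leq_mul2l /=; apply: leq_sum => b _; case: (ltnP m _); lia.
Qed.

(** This is m times the linear interpolation of [G] at (a + u/m, b + v/m): the coefficients are m
    times the barycentric coordinates in the lower or upper triangle of the unit square at (a,
    b). *)
Definition interpolation m (G : nat -> nat -> nat) a b u v :=
  if u + v <= m then (m - u - v) * G a b + u * G a.+1 b + v * G a b.+1
  else (m - v) * G a.+1 b + (m - u) * G a b.+1 + (u + v - m) * G a.+1 b.+1.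

(** The weights 1, 2, 2, 1 count, for each corner of the square, the triangles that contain it; each
    barycentric coordinate sums to at most m (m+1) (m+2) / 6. *)
Lemma sum_interpolation m G a b :
  6 * (\sum_(u < m) \sum_(v < m) interpolation m G a b u v) <=
  m * m.+1 * m.+2 * (G a b + 2 * G a.+1 b + 2 * G a b.+1 + G a.+1 b.+1).
Proof.
rewrite (_ : \sum_(u < m) \sum_(v < m) interpolation m G a b u v =
  lower_sum m (fun u v => m - u - v) * G a b + lower_sum m (fun u v => u) * G a.+1 b + lower_sum m (fun u v => v) * G a b.+1 +
  (upper_sum m (fun u v => m - v) * G a.+1 b + upper_sum m (fun u v => m - u) * G a b.+1 +
   upper_sum m (fun u v => u + v - m) * G a.+1 b.+1)).
  move: (sum_lo_sub m) (sum_lo_l m) (sum_lo_r m) (sum_hi_l m) (sum_hi_r m) (sum_hi_add m).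
  move: (lower_sum m _) (lower_sum m _) (lower_sum m _) (upper_sum m _) (upper_sum m _) (upper_sum m _) (m * m.+1 * m.+2) => *.
  move: (G _ _) (G _ _) (G _ _) (G _ _) => *; nia.
rewrite /lower_sum /upper_sum !big_distrl -!big_split /=; apply: eq_bigr => u _.
rewrite !big_distrl -!big_split /=; apply: eq_bigr => v _.
rewrite /interpolation; case: leqP => _ /=; lia.
Qed.

End TriangleSums.

(** * Heights of initial ideals and the bound on colengths *)

Section Bigcat.
Variable T : eqType.

Lemma size_bigcat (I : Type) (r : seq I) (F : I -> seq T) :
  size (\big[cat/[::]]_(i <- r) F i) = (\sum_(i <- r) size (F i))%N.
Proof. by elim/big_rec2: _ => //= i n s _ <-; rewrite size_cat. Qed.

Lemma mem_bigcat (I : finType) (F : I -> seq T) i x :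
  x \in F i -> x \in \big[cat/[::]]_(j : I) F j.
Proof.
move=> xi; have : i \in index_enum I by rewrite mem_index_enum.
elim: (index_enum I) => // j r IH; rewrite inE big_cons mem_cat => /predU1P[<-|/IH ->].
  by rewrite xi.
by rewrite orbT.
Qed.

Lemma bigcat_mem (I : finType) (F : I -> seq T) x :
  x \in \big[cat/[::]]_(j : I) F j -> exists i, x \in F i.
Proof.
elim: (index_enum I) => [|j r IH]; first by rewrite big_nil.
by rewrite big_cons mem_cat => /orP[xj|/IH//]; exists j.
Qed.

Lemma uniq_bigcat (I : finType) (F : I -> seq T) : (forall i, uniq (F i)) ->
  (forall i j x, x \in F i -> x \in F j -> i = j) -> uniq (\big[cat/[::]]_(j : I) F j).
Proof.
move=> Fu Fd; have := index_enum_uniq I.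
elim: (index_enum I) => [|j r IH]; first by rewrite big_nil.
rewrite /= big_cons cat_uniq => /andP[jr /IH ->]; rewrite Fu /= andbT.
apply/hasPn => x xr; apply/negP => xj; case/negP: jr.
elim: r xr {IH} => [|l r IH]; first by rewrite big_nil.
rewrite big_cons mem_cat inE => /orP[xl|/IH ->]; last by rewrite orbT.
by rewrite (Fd _ _ _ xj xl) eqxx.
Qed.

End Bigcat.

Section Faces.
Variable p : nat.
Implicit Types (i j : 'I_p) (a b c : nat) (e : expo p.+1).

(* The exponents of x_i^a x_(i+1)^b T^c: the variable T is [ord0] and x_i is [lift ord0 i]. *)
Definition face i a b c : expo p.+1 :=
  eunit (lift ord0 i) *+ a + eunit (lift ord0 (ordS i)) *+ b + eunit ord0 *+ c.

Arguments face i (a b c)%_nat_scope.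

(** For p > 2, these are the exponents of the monomials in the Stanley-Reisner ideal of the p-gon,
    with T as cone variable; for p = 3, the multiples of xyz. *)
Definition nonface e := forall i a b c, e <> face i a b c.

Lemma faceT i a b c c' : face i a b (c + c') = face i a b c + eunit ord0 *+ c'.
Proof. by rewrite /face mulrnDr addrA. Qed.

Lemma face_next i b c : face i 0 b c = face (ordS i) b 0 c.
Proof. by rewrite /face !mulr0n add0r addr0; reflexivity. Qed.

Lemma face_zero i j c : face i 0 0 c = face j 0 0 c.
Proof. by rewrite /face !mulr0n !add0r. Qed.

Lemma faceD i a b c a' b' c' : face i (a + a') (b + b') (c + c') = face i a b c + face i a' b' c'.
Proof. by apply/ffunP => l; rewrite /face !(expoD, expoMn) !mulnDr; lia. Qed.

Lemma faceMn i a b c n : face i a b c *+ n = face i (a * n) (b * n) (c * n).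
Proof. by rewrite /face !mulrnDl !mulrnA. Qed.

Lemma faceET i a b c : face i a b c ord0 = c.
Proof. by rewrite /face !(expoD, expoMn, eunitE) !(negPf (neq_lift _ _)) eqxx /= mul1n. Qed.

Lemma faceEx i a b c j : face i a b c (lift ord0 j) = ((j == i) * a + (j == ordS i) * b)%N.
Proof.
rewrite /face !(expoD, expoMn, eunitE) (eq_sym _ ord0) (negPf (neq_lift _ _)) /= addn0.
by rewrite !(inj_eq lift_inj).
Qed.

Lemma ordS_neq i : (1 < p)%N -> ordS i != i.
Proof.
move=> p1; apply/eqP => /(congr1 val) /=; have ip := ltn_ord i.
case: (ltnP i.+1 p) => h; first by rewrite modn_small //; lia.
have -> : i.+1 = p by lia.
by rewrite modnn; lia.
Qed.

Lemma ordSS_neq i : (2 < p)%N -> ordS (ordS i) != i.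
Proof.
move=> p2; apply/eqP => /(congr1 val) /=; have ip := ltn_ord i.
case: (ltnP i.+1 p) => h.
  rewrite (modn_small h); case: (ltnP i.+2 p) => h'; first by rewrite modn_small //; lia.
  have -> : i.+2 = p by lia.
  by rewrite modnn; lia.
have -> : i.+1 = p by lia.
by rewrite modnn modn_small; lia.
Qed.

(** A positive first exponent makes the octants half open: a wall point belongs only to the octant
    that starts with its variable. So they are disjoint and cover the faces off the T-axis. For p =
    2 two octants would share both walls. *)
Lemma face_inj i j a b c a' b' c' : (2 < p)%N ->
  face i a.+1 b c = face j a'.+1 b' c' -> [/\ i = j, a = a', b = b' & c = c'].
Proof.
move=> p3 /ffunP E; have p2 : (1 < p)%N by lia.
have cc : c = c' by have := E ord0; rewrite !faceET.
have Ex l := E (lift ord0 l); move: Ex; move=> Ex.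
have ij : i = j.
  apply/eqP/negPn/negP => ij.
  have := Ex i; have := Ex j; rewrite !faceEx !eqxx /= (negPf ij) eq_sym (negPf ij) /=.
  case: (eqVneq i (ordS j)) => [iE|]; last by rewrite /= mul0n; lia.
  case: (eqVneq j (ordS i)) => [jE|]; last by rewrite /= mul0n; lia.
  by have := ordSS_neq j p3; rewrite -iE -jE eqxx.
subst j; split=> //.
  by have := Ex i; rewrite !faceEx eqxx eq_sym (negPf (ordS_neq i p2)) /=; lia.
by have := Ex (ordS i); rewrite !faceEx eqxx (negPf (ordS_neq i p2)) /=; lia.
Qed.

End Faces.

Arguments face {p} i (a b c)%_nat_scope.

Section IdealPow.
Variables (R : comPzRingType).

Lemma ideal_pow_prod (J : set R) m1 m2 x y : ideal_pow J m1 x -> ideal_pow J m2 y ->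
  ideal_pow J (m1 + m2) (x * y).
Proof.
move=> Hx Hy; have HI n : is_ideal (ideal_pow J n) by exact: ideal_gen_ideal.
have Hxy (z : R) : (exists2 f : 'I_m1 -> R, (forall i, J (f i)) & \prod_(i < m1) f i = z) ->
    ideal_pow J (m1 + m2) (z * y).
  move=> [f Jf <-]; move: y Hy.
  apply: (@ideal_gen_sub _ _ [set y | ideal_pow J (m1 + m2) ((\prod_(i < m1) f i) * y)]).
    split=> [|a u v /= Hu Hv]; first by rewrite /= mulr0; apply: ideal0.
    by rewrite mulrDr mulrCA; apply: (HI _).2.
  move=> _ [g Jg <-] /=; apply: sub_ideal_gen.
  exists (fun i => match fintype.split i with inl j => f j | inr j => g j end).
    by move=> i; case: (fintype.split i).
  rewrite big_split_ord /=; congr (_ * _); apply: eq_bigr => i _.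
    by rewrite -[lshift _ i]/(unsplit (inl i)) unsplitK.
  by rewrite -[rshift _ i]/(unsplit (inr i)) unsplitK.
move: x Hx; apply: (@ideal_gen_sub _ _ [set x | ideal_pow J (m1 + m2) (x * y)]).
  split=> [|a u v /= Hu Hv]; first by rewrite /= mul0r; apply: ideal0.
  by rewrite mulrDl -mulrA; apply: (HI _).2.
by move=> z [f Jf fz]; apply: Hxy; exists f.
Qed.

Lemma ideal_pow_exp (J : set R) x m : J x -> ideal_pow J m (x ^+ m).
Proof.
by move=> Jx; apply: sub_ideal_gen; exists (fun=> x) => //; rewrite prodr_const card_ord.
Qed.

End IdealPow.

(** * Colengths of powers against the heights of one initial ideal *)

Section LechBound.
Variables (k : fieldType) (p : nat) (rho : expo p.+1 -> nat) (R : comPzRingType).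
Hypotheses (p_gt2 : (2 < p)%N) (rhoP : monomial_order rho).
Local Notation S := (mseries k p.+1).
Variable phi : {rmorphism S -> R}.
Hypothesis phi_surj : forall y, exists x, phi x = y.
Hypothesis nonface_leads : forall e, nonface e -> leads rho (rker phi) e.
Local Notation leads := (leads rho).
Implicit Types (B C : set S) (i j : 'I_p) (e : expo p.+1).

Lemma leads_exp (J : set R) e m : leads (phi @^-1` J) e ->
  leads (phi @^-1` ideal_pow J m) (e *+ m).
Proof.
move=> [f Jf fe]; exists (f ^+ m); first by rewrite /= rmorphXn; apply: ideal_pow_exp.
elim: m => [|m IH]; first by rewrite expr0 mulr0n -mono1; apply: lead_mono; rewrite oner_eq0.
by rewrite exprS mulrS; apply: (lead_mul rhoP fe IH).1.
Qed.

Lemma leads_mul (J : set R) e e' m m' : leads (phi @^-1` ideal_pow J m) e ->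
  leads (phi @^-1` ideal_pow J m') e' -> leads (phi @^-1` ideal_pow J (m + m')) (e + e').
Proof.
move=> [f Jf fe] [g Jg ge]; exists (f * g); last exact: (lead_mul rhoP fe ge).1.
by rewrite /= rmorphM; apply: ideal_pow_prod.
Qed.

Lemma leads_pow3 (J : set R) i m1 m2 m3 a1 b1 c1 a2 b2 c2 a3 b3 c3 :
  leads (phi @^-1` J) (face i a1 b1 c1) -> leads (phi @^-1` J) (face i a2 b2 c2) ->
  leads (phi @^-1` J) (face i a3 b3 c3) ->
  leads (phi @^-1` ideal_pow J (m1 + m2 + m3))
    (face i (a1 * m1 + a2 * m2 + a3 * m3) (b1 * m1 + b2 * m2 + b3 * m3) (c1 * m1 + c2 * m2 + c3 * m3)).
Proof.
move=> l1 l2 l3; rewrite !faceD -!faceMn.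
by do !apply: leads_mul; apply: leads_exp.
Qed.

Section Ideal.
Variable J : set R.
Hypothesis HJ : is_ideal J.
Hypothesis J1 : ~ (phi @^-1` J) 1.
Hypothesis Jvar : forall l : 'I_p.+1, exists a, (phi @^-1` J) (mono 1 (eunit l *+ a)).
Local Notation B := (phi @^-1` J).

Let HB : is_ideal B. Proof. exact: preimage_ideal. Qed.

Let lead_var (l : 'I_p.+1) : exists a, leads B (eunit l *+ a).
Proof.
have [a Ja] := Jvar l; exists a, (mono 1 (eunit l *+ a)) => //.
by apply: lead_mono; rewrite oner_eq0.
Qed.

Let height_exists i a b : exists c, `[< leads B (face i a b c) >].
Proof.
have [c lc] := lead_var ord0; exists c; apply/asboolP.
by rewrite -[c]add0n faceT addrC; apply: leads_add.
Qed.

Definition height i a b := ex_minn (height_exists i a b).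

Arguments height i (a b)%_nat_scope.

Lemma heightP i a b c : (height i a b <= c)%N = `[< leads B (face i a b c) >].
Proof.
rewrite /height; case: ex_minnP => h /asboolP lh hmin; apply/idP/asboolP => [hc|lc].
  by rewrite -(subnKC hc) faceT; apply: leads_add.
by apply: hmin; apply/asboolP.
Qed.

Lemma height_lead i a b : leads B (face i a b (height i a b)).
Proof. by apply/asboolP; rewrite -heightP. Qed.

Lemma height_eq i a b i' a' b' : (forall c, face i a b c = face i' a' b' c) ->
  height i a b = height i' a' b'.
Proof.
move=> E; apply/eqP; rewrite eqn_leq !heightP.
by apply/andP; split; apply/asboolP; [rewrite E|rewrite -E]; apply: height_lead.
Qed.

Lemma height_next i b : height i 0 b = height (ordS i) b 0.
Proof. by apply: height_eq => c; exact: face_next. Qed.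

Lemma height_zero i j : height i 0 0 = height j 0 0.
Proof. by apply: height_eq => c; exact: face_zero. Qed.

Lemma height_gt0 i : (0 < height i 0 0)%N.
Proof.
rewrite lt0n; apply/eqP => h0; have := height_lead i 0 0.
rewrite h0 /face !mulr0n !addr0; exact: leads_proper.
Qed.

Lemma height_eventually0 : exists D,
  forall i a b, (D <= a)%N || (D <= b)%N -> height i a b = 0%N.
Proof.
have /choice[A AP] : forall l : 'I_p.+1, exists a, leads B (eunit l *+ a) := lead_var.
exists (\max_l A l).+1 => i a b H.
apply/eqP; rewrite -leqn0 heightP; apply/asboolP.
have AD l : (A l <= \max_l A l)%N by exact: leq_bigmax.
case/orP: H => /ltnW H; rewrite /face mulr0n addr0.
  by have /subnKC <- := leq_trans (AD (lift ord0 i)) H; rewrite mulrnDr -addrA; apply: leads_add.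
have /subnKC <- := leq_trans (AD (lift ord0 (ordS i))) H.
by rewrite addrC mulrnDr -addrA; apply: leads_add.
Qed.

Variable D : nat.
Hypothesis HD : forall i a b, (D <= a)%N || (D <= b)%N -> height i a b = 0%N.

Lemma interpolation_lead m i a b u v c : (u < m)%N -> (v < m)%N ->
  (interpolation m (height i) a b u v <= c)%N ->
  leads (phi @^-1` ideal_pow J m) (face i (m * a + u) (m * b + v) c).
Proof.
move=> um vm; rewrite /interpolation.
have HP : is_ideal (phi @^-1` ideal_pow J m).
  by apply: preimage_ideal; apply: ideal_gen_ideal.
case: (leqP (u + v)%N m) => uv /subnKC <-; rewrite faceT; apply: leads_add => //.
  have := leads_pow3 (m - u - v) u v (height_lead i a b) (height_lead i a.+1 b) (height_lead i a b.+1).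
  have -> : (m - u - v + u + v = m)%N by lia.
  congr (leads _ (face _ _ _ _)); nia.
have := leads_pow3 (m - v) (m - u) (u + v - m)
  (height_lead i a.+1 b) (height_lead i a b.+1) (height_lead i a.+1 b.+1).
have -> : (m - v + (m - u) + (u + v - m) = m)%N by lia.
congr (leads _ (face _ _ _ _)); nia.
Qed.

(** Closed octants are listed, so wall points occur more than once. There are O(m) of them, of
    height O(m), and the leading coefficient in m does not see them. *)
Definition pow_cover m : seq (expo p.+1) :=
  \big[cat/[::]]_(i < p) \big[cat/[::]]_(a < D) \big[cat/[::]]_(b < D)
  \big[cat/[::]]_(u < m) \big[cat/[::]]_(v < m)
    [seq face i (m * a + u) (m * b + v) c | c <- iota 0 (interpolation m (height i) a b u v)].

Lemma pow_coverP m e : (0 < m)%N -> e \in pow_cover m \/ leads (phi @^-1` ideal_pow J m) e.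
Proof.
move=> m0; have HP : is_ideal (ideal_pow J m) by exact: ideal_gen_ideal.
case: (pselect (nonface e)) => [/nonface_leads le|].
  by right; apply: leads_sub le; apply: rker_sub_preimage.
move=> /existsNP[i /existsNP[A /existsNP[B' /existsNP[c /contrapT ->]]]].
rewrite (divn_eq A m) (divn_eq B' m) ![(_ %/ m * m)%N]mulnC.
have Au := ltn_pmod A m0; have Bv := ltn_pmod B' m0.
move: (A %/ m)%N (A %% m)%N (B' %/ m)%N (B' %% m)%N Au Bv => a u b v um vm.
case: (leqP (interpolation m (height i) a b u v) c) => H.
  by right; apply: interpolation_lead.
left; have [aD bD] : (a < D /\ b < D)%N.
  split; rewrite ltnNge; apply/negP => Dx; move: H; rewrite /interpolation.
    by rewrite !HD ?Dx ?(leqW Dx) // !muln0; case: ifP.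
  by rewrite !HD ?Dx ?(leqW Dx) ?orbT // !muln0; case: ifP.
apply: (mem_bigcat (i := i)); apply: (mem_bigcat (i := Ordinal aD)).
apply: (mem_bigcat (i := Ordinal bD)); apply: (mem_bigcat (i := Ordinal um)).
apply: (mem_bigcat (i := Ordinal vm)).
by apply: map_f; rewrite mem_iota.
Qed.

(** For large D, the number of standard exponents off the T-axis, by half-open octants; those on the
    axis number [height i0 0 0]. *)
Definition std_count := (\sum_(i < p) \sum_(a < D) \sum_(b < D) height i a.+1 b)%N.

Let i0 : 'I_p := Ordinal (ltn_trans (isT : 0 < 2)%N p_gt2).

(** Heights vanish from [D] on, so an index shift changes a sum only by a wall. With Y the half-open
    octant and U, V the sums over its walls a = 0 and b = 0, one octant contributes 6 Y + 3 U - 3 V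
    + h(0, 0), and the walls cancel after gluing. *)
Lemma sum_heights :
  (\sum_(i < p) \sum_(a < D) \sum_(b < D)
    (height i a b + 2 * height i a.+1 b + 2 * height i a b.+1 + height i a.+1 b.+1) =
   6 * std_count + p * height i0 0 0)%N.
Proof.
have shiftl i : (\sum_(a < D) \sum_(b < D) height i a b =
    \sum_(a < D) \sum_(b < D) height i a.+1 b + \sum_(b < D) height i 0 b)%N.
  have -> : (\sum_(a < D) \sum_(b < D) height i a b =
             \sum_(a < D.+1) \sum_(b < D) height i a b)%N.
    rewrite big_ord_recr /= [X in (_ + X)%N]big1 ?addn0 // => b _.
    by rewrite HD ?leqnn.
  by rewrite big_ord_recl addnC.
have shiftr i a : (\sum_(b < D) height i a b =
    \sum_(b < D) height i a b.+1 + height i a 0)%N.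
  have -> : (\sum_(b < D) height i a b = \sum_(b < D.+1) height i a b)%N.
    by rewrite big_ord_recr /= (@HD i a D) ?leqnn ?orbT ?addn0.
  by rewrite big_ord_recl addnC.
pose V i := (\sum_(a < D) height i a 0)%N.
(* The wall a = 0 of octant i is the wall b = 0 of octant i + 1, so cyclic reindexing identifies the
   two totals. *)
have VU : (\sum_(i < p) \sum_(b < D) height i 0 b = \sum_(i < p) V i)%N.
  under eq_bigr do under eq_bigr do rewrite height_next.
  rewrite [RHS](reindex_inj (can_inj (@ordSK p))) //.
have V1 i : V i = (\sum_(a < D) height i a.+1 0 + height i 0 0)%N.
  have -> : V i = (\sum_(a < D.+1) height i a 0)%N.
    by rewrite big_ord_recr /= (@HD i D 0%N) ?leqnn ?addn0.
  by rewrite big_ord_recl addnC.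
pose Y i := (\sum_(a < D) \sum_(b < D) height i a.+1 b)%N.
pose U i := (\sum_(b < D) height i 0 b)%N.
(* The term 3 V stands on the left to avoid subtraction. *)
have E i : (\sum_(a < D) \sum_(b < D)
    (height i a b + 2 * height i a.+1 b + 2 * height i a b.+1 + height i a.+1 b.+1) + 3 * V i =
    6 * Y i + 3 * U i + height i0 0 0)%N.
  have E1 : (\sum_(a < D) \sum_(b < D) height i a b =
    \sum_(a < D) \sum_(b < D) height i a b.+1 + V i)%N.
    by rewrite -big_split /=; apply: eq_bigr => a _; exact: shiftr.
  have E2 : (Y i = \sum_(a < D) \sum_(b < D) height i a.+1 b.+1 + \sum_(a < D) height i a.+1 0)%N.
    by rewrite -big_split /=; apply: eq_bigr => a _; exact: shiftr.
  have -> : (\sum_(a < D) \sum_(b < D)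
      (height i a b + 2 * height i a.+1 b + 2 * height i a b.+1 + height i a.+1 b.+1) =
    \sum_(a < D) \sum_(b < D) height i a b + 2 * Y i +
    2 * (\sum_(a < D) \sum_(b < D) height i a b.+1) +
    \sum_(a < D) \sum_(b < D) height i a.+1 b.+1)%N.
    rewrite !big_distrr -!big_split; apply: eq_bigr => a _.
    by rewrite !big_distrr -!big_split.
  move: E1 E2 (shiftl i) (V1 i); rewrite -/(Y i) -/(U i) (height_zero i i0); lia.
have : (\sum_(i < p) \sum_(a < D) \sum_(b < D)
    (height i a b + 2 * height i a.+1 b + 2 * height i a b.+1 + height i a.+1 b.+1) +
    3 * \sum_(i < p) V i =
    6 * std_count + 3 * (\sum_(i < p) U i) + \sum_(i < p) height i0 0 0)%N.
  by rewrite /std_count !big_distrr -!big_split; apply: eq_bigr => i _; exact: E.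
by rewrite VU sum_nat_const card_ord; lia.
Qed.

Lemma colength_pow_le m : (0 < m)%N ->
  (6 * colength (ideal_pow J m) <= m * m.+1 * m.+2 * (6 * std_count + p * height i0 0 0))%N.
Proof.
move=> m0; apply: (@leq_trans (6 * size (pow_cover m))).
  rewrite leq_mul2l /=; have HP : is_ideal (ideal_pow J m) by exact: ideal_gen_ideal.
  by apply: (colength_le rhoP phi_surj HP) => e; apply: pow_coverP.
rewrite -sum_heights size_bigcat !big_distrr /=; apply: leq_sum => i _.
rewrite size_bigcat !big_distrr /=; apply: leq_sum => a _.
rewrite size_bigcat !big_distrr /=; apply: leq_sum => b _.
apply: leq_trans (sum_interpolation m (height i) a b).
rewrite leq_mul2l /= size_bigcat; apply: leq_sum => u _.
rewrite size_bigcat; apply: leq_sum => v _.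
by rewrite size_map size_iota.
Qed.

Lemma colength_ge_std : (height i0 0 0 + std_count <= colength J)%N.
Proof.
pose s1 := [seq face i0 0 0 c | c <- iota 0 (height i0 0 0)].
pose s2 := \big[cat/[::]]_(i < p) \big[cat/[::]]_(a < D) \big[cat/[::]]_(b < D)
  [seq face i a.+1 b c | c <- iota 0 (height i a.+1 b)].
have s2P e : e \in s2 -> exists i a b c, e = face i a.+1 b c /\ (c < height i a.+1 b)%N.
  move=> /bigcat_mem[i /bigcat_mem[a /bigcat_mem[b /mapP[c]]]].
  by rewrite mem_iota => /= cH ->; exists i, a, b, c.
pose s' := \big[cat/[::]]_(i < p) \big[cat/[::]]_(a < D) \big[cat/[::]]_(b < D)
  [seq face i a b c | c <- iota 0 (height i a b)].
have <- : size (s1 ++ s2) = (height i0 0 0 + std_count)%N.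
  rewrite size_cat size_map size_iota; congr (_ + _)%N.
  rewrite size_bigcat; apply: eq_bigr => i _; rewrite size_bigcat; apply: eq_bigr => a _.
  by rewrite size_bigcat; apply: eq_bigr => b _; rewrite size_map size_iota.
apply: (colength_ge rhoP phi_surj (s' := s') HJ).
- move=> e; case: (pselect (nonface e)) => [/nonface_leads le|].
    by right; apply: leads_sub le; apply: rker_sub_preimage.
  move=> /existsNP[i /existsNP[a /existsNP[b /existsNP[c /contrapT ->]]]].
  case: (leqP (height i a b) c) => H; first by right; apply/asboolP; rewrite -heightP.
  left; have [aD bD] : (a < D /\ b < D)%N.
    by split; rewrite ltnNge; apply/negP => Dx; move: H; rewrite HD ?Dx ?orbT.
  apply: (mem_bigcat (i := i)); apply: (mem_bigcat (i := Ordinal aD)).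
  by apply: (mem_bigcat (i := Ordinal bD)); apply: map_f; rewrite mem_iota.
- rewrite cat_uniq; apply/and3P; split.
  + by rewrite map_inj_uniq ?iota_uniq // => c c' /(congr1 (fun e : expo _ => e ord0)); rewrite !faceET.
  + apply/hasPn => e /s2P[i [a [b [c [-> _]]]]]; apply/negP => /mapP[c' _].
    move=> /(congr1 (fun e : expo _ => e (lift ord0 i))); rewrite !faceEx eqxx !muln0 /=; lia.
  apply: uniq_bigcat => [i|i j e]; last first.
    move=> /bigcat_mem[a /bigcat_mem[b /mapP[c _ ->]]] /bigcat_mem[a' /bigcat_mem[b' /mapP[c' _]]].
    by case/face_inj.
  apply: uniq_bigcat => [a|a a' e]; last first.
    move=> /bigcat_mem[b /mapP[c _ ->]] /bigcat_mem[b' /mapP[c' _]].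
    by case/face_inj => // _ /val_inj.
  apply: uniq_bigcat => [b|b b' e]; last first.
    by move=> /mapP[c _ ->] /mapP[c' _]; case/face_inj => // _ _ /val_inj.
  by rewrite map_inj_uniq ?iota_uniq // => c c' /face_inj[].
- move=> e; rewrite mem_cat => /orP[/mapP[c]|/s2P[i [a [b [c [-> cH]]]]]].
    rewrite mem_iota /= add0n => cH -> /asboolP; rewrite -heightP leqNgt.
    by rewrite cH.
  by move/asboolP; rewrite -heightP leqNgt cH.
Qed.

End Ideal.
End LechBound.

(** * Multiplicities *)

Section Limits.
Variable K : realType.

(* No convergence is needed: the limit of a divergent sequence is 0 by convention. *)
Lemma limn_cubic_le (f : nat -> nat) (A : nat) :
  (forall m, (0 < m)%N -> (6 * f m <= m * m.+1 * m.+2 * A)%N) ->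
  limn (fun m => 3`!%:R * (f m)%:R / m%:R ^+ 3 : K) <= A%:R.
Proof.
move=> fA; set u : nat -> K := (X in limn X).
have [cu|/dvgP ->] := pselect (cvg (u @ \oo)); last exact: ler0n.
apply/ler_addgt0Pr => e e0; apply: limr_le => //; near=> m.
have m0 : (0 < m)%N by near: m; exists 1%N.
have m1 : 1 <= m%:R :> K by rewrite ler1n.
have mr : 0 < m%:R :> K by rewrite ltr0n.
(* As m (m+1) (m+2) <= m^3 + 5 m^2, the error is at most 5 A / m. *)
have em : 5 * A%:R / e <= m%:R by near: m; exact: nbhs_infty_ger.
rewrite ler_pdivrMr // in em.
rewrite /u ler_pdivrMr ?exprn_gt0 //.
have := fA m m0; rewrite -(ler_nat K) !natrM -(natr1 m.+1) -(natr1 m) => H.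
apply: le_trans H _.
have : 0 <= A%:R :> K by []. move: (A%:R : K) em => a em a0.
have : 3 * a * m%:R <= 3 * a * (m%:R * m%:R) by rewrite ler_wpM2l ?ler_peMl //; nra.
have : 5 * a * (m%:R * m%:R) <= m%:R * e * (m%:R * m%:R) by rewrite ler_wpM2r //; nra.
rewrite !exprS expr0; nra.
Unshelve. all: by end_near.
Qed.

(** The constant 5 comes from j (j+1) (j+2) = j^3 + 3 j^2 + 2 j, which is at most j^3 + 5 j^2; the
    lower binomial deviates by less. *)
Lemma cubic_sandwich (E h j : nat) : (E * 'C(j, 3) <= h <= E * 'C(j + 2, 3))%N ->
  `|E%:R * j%:R ^+ 3 - 6 * h%:R| <= 5 * E%:R * j%:R ^+ 2 :> K.
Proof.
case/andP=> lo hi; case: j lo hi => [|j lo hi].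
  rewrite !bin0n muln0 leqn0 => _ /= /eqP ->.
  by rewrite !expr0n /= !mulr0 subr0 normr0.
have c6 n : ('C(n, 3) * 6 = n * (n.-1 * n.-2))%N.
  by have := bin_ffact n 3; rewrite !ffactnS ffactn0 muln1.
have scale x y : (x <= y -> E * x <= E * y)%N by move=> xy; rewrite leq_mul2l xy orbT.
have lo2 : (E * j.+1 ^ 3 <= 6 * h + 5 * E * j.+1 ^ 2)%N.
  have : (j.+1 ^ 3 <= 'C(j.+1, 3) * 6 + 5 * j.+1 ^ 2)%N.
    by rewrite c6 !expnS expn0 /= {lo hi}; case: j => [|j] /=; nia.
  move/scale; move: (j.+1 ^ 3)%N (j.+1 ^ 2)%N ('C(j.+1, 3)) lo => x y c lo; lia.
have hi2 : (6 * h <= E * j.+1 ^ 3 + 5 * E * j.+1 ^ 2)%N.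
  have : ('C(j.+1 + 2, 3) * 6 <= j.+1 ^ 3 + 5 * j.+1 ^ 2)%N.
    by rewrite c6 !expnS expn0 addn2 /= {lo hi}; nia.
  move/scale; move: (j.+1 ^ 3)%N (j.+1 ^ 2)%N ('C(j.+1 + 2, 3)) hi => x y c hi; lia.
move: lo2 hi2; rewrite -!(ler_nat K) !(natrD, natrM, natrX) => lo2 hi2.
rewrite ler_norml; apply/andP; split; lra.
Qed.

Lemma cubic_limit (H : nat -> nat) (E N : nat) :
  (forall j, (E * 'C(j, 3) <= H j <= E * 'C(j + 2, 3))%N) ->
  (fun m => 3`!%:R * (H (N * m)%N)%:R / m%:R ^+ 3 : K) @ \oo --> (E%:R * N%:R ^+ 3 : K).
Proof.
move=> HE; apply/cvgrPdist_le => e e0; near=> m.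
have m0 : (0 < m)%N by near: m; exists 1%N.
have mr : 0 < m%:R :> K by rewrite ltr0n.
have em : 5 * E%:R * N%:R ^+ 2 / e <= m%:R by near: m; exact: nbhs_infty_ger.
rewrite ler_pdivrMr // in em.
have -> : E%:R * N%:R ^+ 3 - 3`!%:R * (H (N * m)%N)%:R / m%:R ^+ 3 =
    (E%:R * (N * m)%:R ^+ 3 - 6 * (H (N * m)%N)%:R) / m%:R ^+ 3 :> K.
  rewrite natrM -[3`!%N]/6%N; field; exact: lt0r_neq0.
rewrite normrM normfV (ger0_norm (exprn_ge0 3 (ltW mr))) ler_pdivrMr ?exprn_gt0 //.
apply: le_trans (cubic_sandwich (HE _)) _.
have := ler_wpM2r (exprn_ge0 2 (ltW mr)) em.
by congr (_ <= _); rewrite ?natrM; ring.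
Unshelve. all: by end_near.
Qed.

End Limits.

Section Bounds.
Variables (K : realType) (k : fieldType) (p : nat) (rho : expo p.+1 -> nat) (R : comPzRingType).
Hypotheses (p_gt2 : (2 < p)%N) (rhoP : monomial_order rho).
Local Notation S := (mseries k p.+1).
Variable phi : {rmorphism S -> R}.
Hypothesis phi_surj : forall y, exists x, phi x = y.
Hypothesis R_nz : (1 : R) != 0.
Hypothesis nonface_leads : forall e, nonface e -> leads rho (rker phi) e.
Hypothesis dimR : krull_dim R = 3%N.

(** From h + A <= B follows 6 A + p h <= 6 B - (6 - p) h for p <= 6. Keeping h > 0 explicit is what
    makes the inequality strict for p < 6, so that 1 is not attained. *)
Lemma lech_ratio_bound (I : set R) : max_primary I -> exists A B h : nat,
  [/\ (0 < h)%N, (h + A <= B)%N & lech_ratio K I <= (6 * A + p * h)%N%:R / (6 * B)%N%:R].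
Proof.
move=> /(max_primaryP rhoP phi_surj R_nz)[HI I1 Ivar].
have [D HD] := height_eventually0 rhoP HI Ivar.
pose h := height rhoP HI Ivar (Ordinal (ltn_trans (isT : 0 < 2)%N p_gt2)) 0 0.
exists (std_count rhoP HI Ivar D), (colength I), h; split.
- exact: height_gt0.
- exact: colength_ge_std.
rewrite /lech_ratio /multiplicity dimR natrM -[3`!%N]/6%N.
apply: ler_wpM2r; first by rewrite invr_ge0 mulr_ge0.
by apply: limn_cubic_le => m m0; apply: colength_pow_le.
Qed.

Lemma lech_ratio_le1 (I : set R) : (p <= 6)%N -> max_primary I -> lech_ratio K I <= 1.
Proof.
move=> p6 /lech_ratio_bound[A [B [h [h0 AB]]]] /le_trans; apply.
by rewrite ler_pdivrMr ?ltr0n ?mul1r ?ler_nat; nia.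
Qed.

Lemma lech_ratio_lt1 (I : set R) : (p < 6)%N -> max_primary I -> lech_ratio K I < 1.
Proof.
move=> p6 /lech_ratio_bound[A [B [h [h0 AB]]]] /le_lt_trans; apply.
by rewrite ltr_pdivrMr ?ltr0n ?mul1r ?ltr_nat; nia.
Qed.

End Bounds.

(** * Powers of the maximal ideal *)

Section Powers.
Variables (K : realType) (k : fieldType) (q : nat) (rho : expo q -> nat) (R : comPzRingType).
Local Notation S := (mseries k q).
Local Notation w1 := (fun _ : 'I_q => 1%N).
Hypotheses (rhoP : monomial_order rho) (w1r : refines w1 rho).
Variable phi : {rmorphism S -> R}.
Hypothesis phi_surj : forall y, exists x, phi x = y.
Hypothesis R_nz : (1 : R) != 0.
Hypothesis dimR : krull_dim R = 3%N.

Local Notation F N := (phi @` weight_ideal w1 N).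

Lemma wdeg_split (e : expo q) N : (N <= wdeg w1 e)%N -> exists a b, e = a + b /\ wdeg w1 a = N.
Proof.
elim: N e => [|N IH] e Ne; first by exists 0, e; rewrite add0r wdeg0.
have /existsP[i ei] : [exists i, (0 < e i)%N].
  apply: contraTT Ne => /existsPn H; rewrite -ltnNge /wdeg big1 // => i _.
  by have := H i; rewrite lt0n negbK => /eqP ->.
have /esubK eE : edvd (eunit i) e.
  by apply/forallP => j; rewrite eunitE; case: eqVneq => // ->.
have [|a [b [eab aN]]] := IH (esub e (eunit i)).
  by move: Ne; rewrite -{1}eE wdegD wdeg_eunit add1n.
exists (eunit i + a), b; split; first by rewrite -addrA -eab eE.
by rewrite wdegD wdeg_eunit aN.
Qed.

Lemma weight_ideal_mul N M (f g : S) : weight_ideal w1 N f -> weight_ideal w1 M g ->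
  weight_ideal w1 (N + M) (f * g).
Proof.
move=> Nf Mg e /mcoefM_supp[a [b [<- /Nf Na /Mg Mb]]].
by rewrite wdegD leq_add.
Qed.

Lemma mono_pow N m e : wdeg w1 e = (N * m)%N -> ideal_pow (F N) m (phi (mono 1 e)).
Proof.
elim: m e => [|m IH] e eN.
  have -> : e = 0.
    by apply/eqP; apply: contraTT isT; rewrite -(@wdeg_gt0 _ w1) // eN muln0.
  by rewrite mono1 rmorph1 -[1](expr0 1); apply: sub_ideal_gen; exists (fun=> 0);
    [case|rewrite big_ord0 expr0].
have [|a [b [eab aN]]] := @wdeg_split e N; first by rewrite eN mulnS leq_addr.
have -> : mono 1 e = mono 1 a * mono 1 b :> S by rewrite monoM mulr1 eab.
rewrite rmorphM -[m.+1]add1n; apply: ideal_pow_prod.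
  rewrite -[phi _]expr1; apply: ideal_pow_exp; exists (mono 1 a) => //.
  move=> c; rewrite mcoef_mono; case: (eqVneq c a) => [->|_]; last by rewrite eqxx.
  by rewrite aN.
by apply: IH; move: eN; rewrite eab wdegD aN mulnS => /addnI.
Qed.

(** A series of order at least N m is an infinite sum of monomials, whereas an ideal power allows
    only finite combinations. Dickson's lemma leaves finitely many monomials of degree N m, and
    division by them gives the finite combination. *)
Lemma weight_ideal_pow N m : ideal_pow (F N) m = F (N * m).
Proof.
have HF M : is_ideal (weight_ideal w1 M : set S) by exact: weight_ideal_ideal.
apply/seteqP; split.
  apply: ideal_gen_sub; first exact: image_ideal.
  move=> _ [f Ff <-].
  have /choice[g gP] : forall i, exists g, weight_ideal w1 N g /\ phi g = f i.
    by move=> i; have [g Ng gf] := Ff i; exists g.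
  exists (\prod_i g i); last by rewrite rmorph_prod; apply: eq_bigr => i _; case: (gP i).
  elim: m f g {Ff} gP => [|m IH] f g gP; first by rewrite muln0 => e.
  rewrite big_ord_recl mulnS; apply: weight_ideal_mul; first by case: (gP ord0).
  by apply: (IH (fun i => f (lift ord0 i))) => i; apply: gP.
move=> _ [f Ff <-].
have HP : is_ideal (ideal_pow (F N) m) by exact: ideal_gen_ideal.
have [s [sB sdiv]] := dickson [set e | wdeg w1 e = (N * m)%N].
pose mu := tnth (in_tuple s).
have muN i : wdeg w1 (mu i) = (N * m)%N by apply: sB; apply: mem_tnth.
have Bmu i : weight_ideal w1 (N * m) (mono 1 (mu i) : S).
  move=> e; rewrite mcoef_mono; case: (eqVneq e (mu i)) => [->|_]; last by rewrite eqxx.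
  by rewrite muN.
have lmu i : is_lead rho (mono 1 (mu i) : S) (mu i) by apply: lead_mono; rewrite oner_eq0.
have mu_div e : leads rho (weight_ideal w1 (N * m) : set S) e -> exists i, edvd (mu i) e.
  move=> [g Fg [/Fg eN _]]; have [a [b [-> aN]]] := wdeg_split eN.
  have [c /seq_tnthP[i ->] ca] := sdiv a aN; exists i.
  by case/edvdP: ca => d ->; apply/edvdP; exists (d + b); rewrite addrA.
have [h [-> _]] := division rhoP (HF (N * m)%N) Bmu lmu mu_div Ff.
rewrite rmorph_sum; apply: (ideal_sum _ HP) => i; rewrite rmorphM; apply: (idealM _ HP).
exact: mono_pow.
Qed.

Lemma colength_weight N : colength (F N) = hilbert rho w1 (rker phi) N.
Proof.
have HF : is_ideal (weight_ideal w1 N : set S) by exact: weight_ideal_ideal.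
have HJ : is_ideal (F N) by exact: image_ideal.
have cov e : ~~ (wdeg w1 e < N)%N -> leads rho (phi @^-1` F N) e.
  rewrite -leqNgt => Ne; apply: leads_sub (leads_weight _ _ Ne).
  by move=> f Ff; exists f.
apply/eqP; rewrite eqn_leq; apply/andP; split.
  apply: (colength_le rhoP phi_surj HJ) => e.
  case: (boolP (e \in nonleads rho (low_expos w1 N) (rker phi))) => [|]; first by left.
  rewrite mem_filter mem_low_expos // negb_and negbK => H; right.
  case/orP: H => [/asboolP le|/cov//].
  by apply: leads_sub le; apply: rker_sub_preimage.
apply: (colength_ge rhoP phi_surj (s' := low_expos w1 N) HJ).
- by move=> e; case: (boolP (e \in low_expos w1 N)) => [|]; [left|rewrite mem_low_expos // => /cov; right].
- by rewrite filter_uniq // low_expos_uniq.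
move=> e; rewrite mem_filter mem_low_expos // => /andP[/asboolP nl eN].
by rewrite preimage_image // => /(leads_add_weight w1r eN).
Qed.

Variable E : nat.
Hypothesis E_gt0 : (0 < E)%N.
Hypothesis hilbertE : forall j,
  (E * 'C(j, 3) <= hilbert rho w1 (rker phi) j <= E * 'C(j + 2, 3))%N.

Lemma multiplicity_weight N : multiplicity K (F N) = E%:R * N%:R ^+ 3.
Proof.
rewrite /multiplicity dimR; apply: cvg_lim => //.
under eq_fun do rewrite weight_ideal_pow colength_weight.
exact: cubic_limit.
Qed.

Lemma lech_ratio_weight N : lech_ratio K (F N) =
  E%:R * N%:R ^+ 3 / (6 * (hilbert rho w1 (rker phi) N)%:R).
Proof. by rewrite /lech_ratio multiplicity_weight dimR colength_weight. Qed.

Lemma lech_mumford_ge1 : (1%E <= lech_mumford K R)%E.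
Proof.
apply/lee_subgt0Pr => e e0.
(* The ratio for the N-th power is at least N^3 / (N (N+1) (N+2)), hence at least 1 - 5 / N. *)
have [N [N0 Ne]] : exists N, (0 < N)%N /\ 5 / e <= N%:R :> K.
  have [N _ HN] := nbhs_infty_ger (5 / e : K).
  by exists N.+1; split=> //; apply: (HN N.+1) => /=; apply: leqnSn.
apply: (@le_trans _ _ (lech_ratio K (F N))%:E); last first.
  by apply: ereal_sup_ubound; exists (F N) => //; apply: (max_primary_weight rhoP phi_surj).
rewrite -EFinB lee_fin lech_ratio_weight.
have /andP[lo hi] := hilbertE N; have := lech_ratio_weight N.
rewrite /lech_ratio multiplicity_weight dimR colength_weight => _.
have H0 : (0 < hilbert rho w1 (rker phi) N)%N.
  have : (0 : expo q) \in nonleads rho (low_expos w1 N) (rker phi).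
    rewrite mem_filter mem_low_expos // wdeg0 N0 andbT; apply/asboolPn.
    by apply: (leads_proper rhoP (rker_ideal phi)); apply: rker_proper.
  by rewrite /hilbert; case: nonleads.
have {}hi : (6 * hilbert rho w1 (rker phi) N <= E * (N * N.+1 * N.+2))%N.
  have := bin_ffact (N + 2) 3; rewrite addn2 !ffactnS ffactn0 muln1 /= => c6.
  have := leq_mul (leqnn 6) hi; rewrite addn2 mulnCA [(6 * 'C(_, _))%N]mulnC c6.
  by move=> /leq_trans; apply; rewrite leq_mul2l; apply/orP; right; lia.
rewrite ler_pdivlMr ?mulr_gt0 ?ltr0n //.
move: hi; rewrite -(ler_nat K) !natrM -(natr1 N.+1) -(natr1 N) => hi.
rewrite ler_pdivrMr // in Ne.
have N1 : 1 <= N%:R :> K by rewrite ler1n.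
have h0 : 0 <= (hilbert rho w1 (rker phi) N)%:R :> K by [].
move: h0 hi Ne N1; have : 0 <= E%:R :> K by [].
move: (E%:R : K) (N%:R : K) ((hilbert rho w1 (rker phi) N)%:R : K) => x n h x0 h0 hi Ne n1.
case: (lerP (1 - e) 0) => e1.
  by apply: (@le_trans _ _ 0); [rewrite mulr_le0_ge0 // mulr_ge0|rewrite mulr_ge0 // exprn_ge0 //; lra].
apply: le_trans (ler_wpM2l (ltW e1) hi) _; rewrite mulrCA ler_wpM2l //.
have : 5 * (n * n + 3 * n + 2) <= n * e * (n * n + 3 * n + 2) by rewrite ler_wpM2r //; nra.
rewrite !exprS expr0; nra.
Qed.

End Powers.

(** * A[[T]] as a quotient of a power series ring *)

Section Convolution.
Variable R : comPzRingType.

Lemma mcoefM_sub q (f g : mseries R q) (m : expo q) N : (forall i, m i <= N)%N ->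
  mcoef (f * g) m = \sum_(a : {ffun 'I_q -> 'I_N.+1} | edvd (unbox a) m)
    mcoef f (unbox a) * mcoef g (esub m (unbox a)).
Proof.
move=> mN; rewrite (mcoefME _ _ mN) [RHS]big_mkcond; apply: eq_bigr => a _.
case: ifP => [am|/negP am]; last first.
  by rewrite big1 // => b /eqP ab; case: am; rewrite -ab edvdD.
have [|b bE] := @unbox_surj q N (esub m (unbox a)).
  by move=> i; apply: leq_trans (mN i); rewrite ffunE leq_subr.
rewrite (big_pred1 b) ?bE // => b'.
by rewrite /= -[in LHS](esubK am) -bE (inj_eq (@expo_addrI _ _)) (inj_eq (@unbox_inj q N)).
Qed.

Lemma mcoefM1 (f g : mseries R 1) c : mcoef (f * g) [ffun=> c] =
  \sum_(i < c.+1) mcoef f [ffun=> val i] * mcoef g [ffun=> (c - i)%N].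
Proof.
rewrite (@mcoefM_sub _ _ _ _ c) => [|i]; last by rewrite ffunE.
rewrite (reindex (fun i : 'I_c.+1 => [ffun _ : 'I_1 => i])) /=; last first.
  exists (fun a : {ffun 'I_1 -> 'I_c.+1} => a ord0) => [i _|a _]; first by rewrite ffunE.
  by apply/ffunP => j; rewrite ffunE (ord1 j).
rewrite big_mkcond; apply: eq_bigr => i _; rewrite ifT; last first.
  by apply/forallP => j; rewrite !ffunE -ltnS ltn_ord.
by congr (mcoef f _ * mcoef g _); apply/ffunP => j; rewrite !ffunE.
Qed.

Variable p : nat.
Implicit Types (e : expo p.+1) (m : expo p) (f g : mseries R p.+1).

Definition econs c m : expo p.+1 :=
  [ffun j => if unlift ord0 j is Some i then m i else c].

Definition etail e : expo p := [ffun i => e (lift ord0 i)].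

Lemma econs0 c m : econs c m ord0 = c. Proof. by rewrite ffunE unlift_none. Qed.

Lemma econsS c m i : econs c m (lift ord0 i) = m i. Proof. by rewrite ffunE liftK. Qed.

Lemma econsK e : econs (e ord0) (etail e) = e.
Proof.
apply/ffunP => j; case: (unliftP ord0 j) => [i ->|->]; last by rewrite econs0.
by rewrite econsS ffunE.
Qed.

Lemma etail_cons c m : etail (econs c m) = m.
Proof. by apply/ffunP => i; rewrite ffunE econsS. Qed.

Lemma econsD c d m m' : econs c m + econs d m' = econs (c + d) (m + m').
Proof.
apply/ffunP => j; rewrite expoD; case: (unliftP ord0 j) => [i ->|->].
  by rewrite !econsS expoD.
by rewrite !econs0.
Qed.

(* The coefficient of T^c. *)
Definition slice f c : mseries R p := MSeries (fun m => mcoef f (econs c m)).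

(** This identifies series in p + 1 variables with series in T over the series in p variables, as
    rings. *)
Lemma sliceM f g c : slice (f * g) c = \sum_(i < c.+1) slice f i * slice g (c - i).
Proof.
apply: mseriesP => m; rewrite mcoef_sum -[LHS]/(mcoef (f * g) (econs c m)).
pose N := maxn c (\max_i m i); have mN i : (m i <= N)%N by rewrite leq_max leq_bigmax orbT.
have cN : (c <= N)%N by rewrite leq_max leqnn.
rewrite (@mcoefM_sub _ _ _ _ N) => [|j]; last first.
  by case: (unliftP ord0 j) => [i ->|->]; rewrite ?econsS ?econs0.
pose pack (x : 'I_N.+1 * {ffun 'I_p -> 'I_N.+1}) : {ffun 'I_p.+1 -> 'I_N.+1} :=
  [ffun j => if unlift ord0 j is Some i then x.2 i else x.1].
have packE x : unbox (pack x) = econs x.1 (unbox x.2).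
  by apply/ffunP => j; rewrite !ffunE; case: (unliftP ord0 j) => //= i; rewrite ffunE.
rewrite (reindex pack) /=; last first.
  exists (fun a : {ffun 'I_p.+1 -> 'I_N.+1} => (a ord0, [ffun i => a (lift ord0 i)])) => [[i a] _|a _].
    rewrite /pack /=; congr (_, _); first by rewrite ffunE unlift_none.
    by apply/ffunP => j; rewrite !ffunE liftK.
  by apply/ffunP => j; rewrite ffunE /=; case: (unliftP ord0 j) => [i ->|->] //=; rewrite ffunE.
have edvd_cons i a : edvd (econs i a) (econs c m) = (i <= c)%N && edvd a m.
  apply/forallP/andP => [H|[ic /forallP am] j].
    split; first by have := H ord0; rewrite !econs0.
    by apply/forallP => j; have := H (lift ord0 j); rewrite !econsS.
  by case: (unliftP ord0 j) => [l ->|->]; rewrite ?econsS ?econs0.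
under eq_bigl do rewrite packE edvd_cons.
rewrite -(pair_big_dep (fun i : 'I_N.+1 => (i <= c)%N) (fun _ a => edvd (unbox a) m)
  (fun i a => mcoef f (unbox (pack (i, a))) * mcoef g (esub (econs c m) (unbox (pack (i, a)))))) /=.
rewrite (big_ord_widen N.+1 (fun i => mcoef (slice f i * slice g (c - i)%N) m)) //.
apply: eq_bigr => i _; rewrite (@mcoefM_sub _ _ _ _ N) //; apply: eq_bigr => a _.
rewrite packE /=; congr (_ * mcoef g _); apply/ffunP => j.
by rewrite !ffunE; case: (unlift ord0 j) => [l|]; rewrite ?ffunE.
Qed.

End Convolution.

Section ConePresentation.
Variables (k : fieldType) (p : nat) (X : set (mseries k p)).
Local Notation S := (mseries k p.+1).
Local Notation R := (mseries (quot_ring X) 1).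

Definition cone_map (f : S) : R := MSeries (fun c => quot_pi X (slice f (c ord0))).

Lemma quot_pi_sum (I : Type) (r : seq I) (F : I -> mseries k p) :
  quot_pi X (\sum_(i <- r) F i) = \sum_(i <- r) quot_pi X (F i).
Proof. exact: (big_morph _ (@quot_piD _ X) (quot_pi0 X)). Qed.

Fact cone_map_nmod : nmod_morphism cone_map.
Proof.
split; first by apply: mseriesP => c /=; rewrite -quot_pi0.
by move=> f g; apply: mseriesP => c /=; rewrite -quot_piD.
Qed.

Let expo1 (c : expo 1) : c = [ffun=> c ord0].
Proof. by apply/ffunP => j; rewrite ffunE (ord1 j). Qed.

Lemma slice1 c : slice (1 : S) c = if c == 0%N then 1 else 0.
Proof.
apply: mseriesP => m; rewrite -[LHS]/(mcoef (1 : S) (econs c m)) mcoef1.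
have -> : (econs c m == 0) = (c == 0%N) && (m == 0).
  apply/eqP/andP => [/ffunP H|[/eqP -> /eqP ->]].
    split; first by have := H ord0; rewrite econs0 expo0 => ->.
    by apply/eqP/ffunP => j; have := H (lift ord0 j); rewrite econsS !expo0.
  by apply/ffunP => j; case: (unliftP ord0 j) => [l ->|->]; rewrite ?econsS ?econs0 !expo0.
by case: eqP.
Qed.

Fact cone_map_monoid : monoid_morphism cone_map.
Proof.
split.
  apply: mseriesP => c; rewrite mcoef1 /= slice1.
  have -> : (c ord0 == 0%N) = (c == 0).
    apply/eqP/eqP => [c0|->]; last by rewrite ffunE.
    by rewrite (expo1 c) c0; apply/ffunP => j; rewrite !ffunE.
  by case: ifP => _ //; rewrite quot_pi0.
move=> f g; apply: mseriesP => c; rewrite [in RHS](expo1 c) mcoefM1 /= sliceM quot_pi_sum.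
apply: eq_bigr => i _; rewrite !ffunE; symmetry; exact: quot_piM.
Qed.

HB.instance Definition _ := Algebra.isNmodMorphism.Build S R cone_map cone_map_nmod.
HB.instance Definition _ := GRing.isMonoidMorphism.Build S R cone_map cone_map_monoid.

Lemma cone_map_surj (y : R) : exists x, cone_map x = y.
Proof.
have /choice[g gP] : forall c : nat, exists x, quot_pi X x = mcoef y [ffun=> c].
  move=> c; elim/quot_piP: (mcoef y [ffun=> c]) => x; by exists x.
exists (MSeries (fun e => mcoef (g (e ord0)) (etail e))).
apply: mseriesP => c; rewrite [in RHS](expo1 c) /= -gP; congr quot_pi.
by apply: mseriesP => m /=; rewrite econs0 etail_cons.
Qed.

Lemma cone_kerP f : rker cone_map f <-> forall c, ideal_gen X (slice f c).
Proof.
split=> [H c|H].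
  have /(congr1 (fun y : R => mcoef y [ffun=> c])) /= : cone_map f = 0 := H.
  by rewrite ffunE -(quot_pi0 X) => /quot_pi_eq; rewrite subr0.
apply: mseriesP => c /=; rewrite -(quot_pi0 X); apply/quot_pi_eq.
by rewrite subr0.
Qed.

End ConePresentation.

(** * Primes and counting of faces *)

Section CoordinateIdeals.
Variables (k : fieldType) (q : nat) (rho : expo q -> nat).
Hypothesis rhoP : monomial_order rho.
Local Notation S := (mseries k q).
Implicit Types (f g : S) (e : expo q) (s t : pred 'I_q).

Definition supported s e := [forall l, ~~ s l ==> (e l == 0%N)].

Lemma supportedP s e : reflect (forall l, ~~ s l -> e l = 0%N) (supported s e).
Proof.
by apply: (iffP forallP) => H l; have := H l; [move=> /implyP + sl => /(_ sl)/eqP|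
  move=> Hl; apply/implyP => /Hl ->].
Qed.

Lemma supportedD s a b : supported s (a + b) = supported s a && supported s b.
Proof.
apply/supportedP/andP => [H|[/supportedP Ha /supportedP Hb] l sl]; last by rewrite expoD Ha ?Hb.
by split; apply/supportedP => l /H; rewrite expoD; lia.
Qed.

(* The prime generated by the variables outside [s]. *)
Definition coord_ideal s : set S := [set f | forall e, supported s e -> mcoef f e = 0].

Lemma coord_ideal_ideal s : is_ideal (coord_ideal s).
Proof.
split=> [e _ //|a f g f0 g0 e se]; rewrite mcoefD g0 // addr0.
apply/eqP/negPn/negP => /mcoefM_supp[x [y [xy _]]].
by rewrite f0 ?eqxx //; move: se; rewrite -xy supportedD => /andP[].
Qed.

Lemma coord_ideal_prime s : prime_ideal (coord_ideal s).
Proof.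
split; first exact: coord_ideal_ideal.
  move=> /(_ 0); rewrite mcoef1 eqxx => /(_ _)/eqP; rewrite oner_eq0 => H.
  by suff : false by []; apply: H; apply/supportedP => l _; rewrite expo0.
(* Setting the variables outside [s] to 0. A sum of exponents is supported in [s] exactly when both
   summands are, so the leading terms of the restrictions multiply without cancellation. *)
pose res f : S := MSeries (fun e => if supported s e then mcoef f e else 0).
have lead f : ~ coord_ideal s f -> exists e, [/\ supported s e, mcoef f e != 0 &
    forall e', supported s e' -> mcoef f e' != 0 -> (rho e <= rho e')%N].
  move=> nf; have /(lead_exists rho)[e [/= fe emin]] : res f != 0.
    apply/eqP => r0; apply: nf => e se.
    by have /(congr1 (fun h => mcoef h e)) /= := r0; rewrite se.
  move: fe; case: ifP => [se fe|]; last by rewrite eqxx.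
  by exists e; split=> // e' se' fe'; apply: emin; rewrite /= se'.
move=> f g fg; apply: contrapT => /not_orP[/lead[a [sa fa amin]] /lead[b [sb gb bmin]]].
have : mcoef (f * g) (a + b) = mcoef f a * mcoef g b.
  apply: mcoefM_one => a' b' ab fa' gb'.
  have /andP[sa' sb'] : supported s a' && supported s b' by rewrite -supportedD ab supportedD sa.
  by have [] := mo_eqD rhoP (amin _ sa' fa') (bmin _ sb' gb') ab.
rewrite fg ?supportedD ?sa // => /esym/eqP.
by rewrite mulf_eq0 (negPf fa) (negPf gb).
Qed.

Lemma coord_ideal_lt s t l : (forall i, t i -> s i) -> s l -> ~~ t l ->
  coord_ideal s `<` coord_ideal t.
Proof.
move=> ts sl tl; split=> [f f0 e /supportedP te|H].
  by apply: f0; apply/supportedP => i si; apply: te; apply: contra si; apply: ts.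
have : coord_ideal s (mono 1 (eunit l)).
  apply: H => e /supportedP/(_ l tl) el; rewrite mcoef_mono; case: eqVneq => // eE.
  by move: el; rewrite eE eunitE eqxx.
move=> /(_ (eunit l)); rewrite mcoef_mono eqxx => H1.
suff /H1/eqP : supported s (eunit l) by rewrite oner_eq0.
by apply/supportedP => i; rewrite eunitE; case: eqVneq => // ->; rewrite sl.
Qed.

End CoordinateIdeals.

Section TetrahedralCount.

Definition tetra n := (\sum_(a < n) \sum_(b < n) (n - a - b))%N.

Lemma sum_sub_bin x n : (x <= n)%N -> (\sum_(b < n) (x - b))%N = 'C(x.+1, 2).
Proof.
elim: n x => [|n IH] x; first by rewrite leqn0 big_ord0 => /eqP ->.
case: x => [|x] xn; first by rewrite big1 // => b _; rewrite sub0n.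
by rewrite big_ord_recl /= subn0 binS bin1 addnC -(IH x xn); congr (_ + _)%N.
Qed.

Lemma tetraE n : tetra n = 'C(n + 2, 3).
Proof.
rewrite /tetra; under eq_bigr do rewrite (sum_sub_bin (leq_subr _ _)).
elim: n => [|n IH]; first by rewrite big_ord0.
rewrite big_ord_recl /= subn0 addSn [RHS]binS [RHS]addnC -IH addn2; congr (_ + _)%N.
Qed.

End TetrahedralCount.

(** * Counting faces by degree, and the dimension *)

Section FaceCounts.
Variables (k : fieldType) (p : nat).
Local Notation S := (mseries k p.+1).
Implicit Types (P : set S) (i : 'I_p) (e : expo p.+1).

Lemma wdeg1_face i a b c : wdeg (fun=> 1%N) (face i a b c) = (a + b + c)%N.
Proof. by rewrite /face !wdegD !wdegMn !wdeg_eunit !mul1n. Qed.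

Definition simplex_faces N i : seq (expo p.+1) :=
  \big[cat/[::]]_(a < N) \big[cat/[::]]_(b < N) [seq face i a b c | c <- iota 0 (N - a - b)].

Lemma size_simplex_faces N i : size (simplex_faces N i) = 'C(N + 2, 3).
Proof.
rewrite -tetraE size_bigcat; apply: eq_bigr => a _; rewrite size_bigcat.
by apply: eq_bigr => b _; rewrite size_map size_iota.
Qed.

Lemma mem_simplex_faces N i a b c : (a + b + c < N)%N -> face i a b c \in simplex_faces N i.
Proof.
move=> abc; have aN : (a < N)%N by lia.
have bN : (b < N)%N by lia.
apply: (mem_bigcat (i := Ordinal aN)); apply: (mem_bigcat (i := Ordinal bN)).
by apply: map_f; rewrite mem_iota /=; lia.
Qed.

Lemma simplex_facesP N i e : e \in simplex_faces N i ->
  exists a b c, (a + b + c < N)%N /\ e = face i a b c.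
Proof.
move=> /bigcat_mem[a /bigcat_mem[b /mapP[c]]]; rewrite mem_iota => /andP[_ cN] ->.
by exists a, b, c; split=> //; move: cN; rewrite add0n; lia.
Qed.

Hypothesis p_gt2 : (2 < p)%N.

Lemma face_eq i a b c a' b' c' : face i a b c = face i a' b' c' -> [/\ a = a', b = b' & c = c'].
Proof.
move=> /ffunP E; have := E ord0; rewrite !faceET => cc.
have := E (lift ord0 i); have := E (lift ord0 (ordS i)); rewrite !faceEx !eqxx.
by rewrite [i == _]eq_sym !(negPf (ordS_neq i _)) /=; [split; lia|lia].
Qed.

Lemma simplex_faces_uniq N i : uniq (simplex_faces N i).
Proof.
apply: uniq_bigcat => [a|a a' e]; last first.
  move=> /bigcat_mem[b /mapP[c _ ->]] /bigcat_mem[b' /mapP[c' _]].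
  by case/face_eq => /val_inj.
apply: uniq_bigcat => [b|b b' e]; last first.
  by move=> /mapP[c _ ->] /mapP[c' _]; case/face_eq => _ /val_inj.
by rewrite map_inj_uniq ?iota_uniq // => c c' /face_eq[].
Qed.

Variables (rho : expo p.+1 -> nat) (w : 'I_p.+1 -> nat) (R : comPzRingType).
Hypotheses (rhoP : monomial_order rho) (w_refines : refines w rho).
Hypothesis w_gt0 : forall l, (0 < w l)%N.
Variable phi : {rmorphism S -> R}.
Hypothesis phi_surj : forall y, exists x, phi x = y.
Hypothesis nonface_leads : forall e, nonface e -> leads rho (rker phi) e.

(** A cube of side N in each octant is a crude cover, but only the cubic order of growth matters for
    the dimension. *)
Lemma hilbert_faces P N : rker phi `<=` P -> (hilbert rho w P N <= p * N ^ 3)%N.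
Proof.
move=> kP; pose s : seq (expo p.+1) := \big[cat/[::]]_(i < p) \big[cat/[::]]_(a < N)
  \big[cat/[::]]_(b < N) [seq face i a b c | c <- iota 0 N].
have -> : (p * N ^ 3 = size s)%N.
  rewrite size_bigcat (eq_bigr (fun=> N ^ 3)%N) ?sum_nat_const ?card_ord // => i _.
  rewrite size_bigcat (eq_bigr (fun=> N ^ 2)%N) ?sum_nat_const ?card_ord // => a _.
  rewrite size_bigcat (eq_bigr (fun=> N)%N) ?sum_nat_const ?card_ord // => b _.
  by rewrite size_map size_iota.
apply: uniq_leq_size; first by rewrite filter_uniq ?low_expos_uniq.
move=> e; rewrite mem_filter mem_low_expos // => /andP[/asboolPn nl eN].
case: (pselect (nonface e)) => [/nonface_leads le|].
  by case: nl; apply: leads_sub le.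
move=> /existsNP[i /existsNP[a /existsNP[b /existsNP[c /contrapT eE]]]].
have lt l : (e l < N)%N by apply: leq_ltn_trans eN; apply: leq_wdeg.
have aN : (a < N)%N by have := lt (lift ord0 i); rewrite eE faceEx eqxx /=; lia.
have bN : (b < N)%N by have := lt (lift ord0 (ordS i)); rewrite eE faceEx eqxx /=; lia.
have cN : (c < N)%N by have := lt ord0; rewrite eE faceET.
rewrite eE; apply: (mem_bigcat (i := i)); apply: (mem_bigcat (i := Ordinal aN)).
by apply: (mem_bigcat (i := Ordinal bN)); apply: map_f; rewrite mem_iota.
Qed.

Lemma krull_dim3 (c : nat -> set S) : (forall j : nat, (j <= 3)%N -> prime_ideal (c j)) ->
  rker phi `<=` c 0%N -> (forall j : nat, (j < 3)%N -> c j `<` c j.+1) -> krull_dim R = 3%N.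
Proof.
move=> cP k0 cS; apply: (krull_dimE phi_surj (c := c)) => [i i3|//|d c' c'P c'S].
  split; first exact: cP.
  elim: i i3 => [//|i IH] i3; have /properW cc := cS i i3.
  exact: classical_sets.subset_trans (IH (ltnW i3)) cc.
apply: (chain_length_le3 rhoP w_refines w_gt0 (fun j jd => (c'P j jd).1) c'S).
by move=> N; apply: hilbert_faces; have [] := c'P 0%N isT.
Qed.

End FaceCounts.

(** * Polygonal cones, n >= 3 *)

Section Criterion.
Variables (K : realType) (k : fieldType) (p : nat) (X : set (mseries k p)).
Local Notation S := (mseries k p.+1).
Local Notation R := (mseries (quot_ring X) 1).
Local Notation w1 := (fun _ : 'I_p.+1 => 1%N).
Local Notation rho1 := (weight_order w1).
Local Notation ker := (rker (cone_map X)).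
Variables (rho : expo p.+1 -> nat) (P : set S) (E : nat).
Hypotheses (p_gt2 : (2 < p)%N) (rhoP : monomial_order rho).
Hypothesis nonface_leads : forall e, nonface e -> leads rho ker e.
Hypothesis dimR : krull_dim R = 3%N.
Hypotheses (P_prime : prime_ideal P) (kerP : ker `<=` P).
Hypothesis E_gt0 : (0 < E)%N.
Hypothesis hilbertE : forall j,
  (E * 'C(j, 3) <= hilbert rho1 w1 ker j <= E * 'C(j + 2, 3))%N.

Let rho1P : monomial_order rho1. Proof. exact: weight_orderP. Qed.

Let rho1w : refines w1 rho1. Proof. exact: weight_order_refines. Qed.

Let R_nz : (1 : R) != 0.
Proof.
apply/eqP => R0; have [_ P1 _] := P_prime; apply: P1; apply: kerP.
by rewrite /rker /= rmorph1.
Qed.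

Lemma cone_lech_mumford_ge1 : (1%E <= lech_mumford K R)%E.
Proof. exact: (lech_mumford_ge1 K rho1P rho1w (@cone_map_surj _ _ X) R_nz dimR E_gt0 hilbertE). Qed.

Lemma cone_semistable : (p <= 6)%N -> semistable K (quot_ring X).
Proof.
move=> p6; apply/eqP; rewrite eq_le cone_lech_mumford_ge1 andbT.
apply: ge_ereal_sup => _ [I HI <-]; rewrite lee_fin.
exact: (lech_ratio_le1 K p_gt2 rhoP (@cone_map_surj _ _ X) R_nz nonface_leads dimR p6 HI).
Qed.

Lemma cone_stable : (p < 6)%N -> stable K (quot_ring X).
Proof.
move=> p6; have ss : semistable K (quot_ring X) by apply: cone_semistable; lia.
split=> // -[I HI]; rewrite ss => -[I1].
have := lech_ratio_lt1 K p_gt2 rhoP (@cone_map_surj _ _ X) R_nz nonface_leads dimR p6 HI.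
by rewrite I1 ltxx.
Qed.

Let m : set R := cone_map X @` weight_ideal w1 1.

Lemma lech_ratio_max : lech_ratio K m = E%:R / 6.
Proof.
rewrite (lech_ratio_weight K rho1P rho1w (@cone_map_surj _ _ X) dimR hilbertE).
suff -> : hilbert rho1 w1 ker 1 = 1%N by rewrite !expr1n !mulr1.
apply/eqP; rewrite eqn_leq; apply/andP; split.
  apply: (@leq_trans (size [:: 0 : expo p.+1])) => //.
  apply: uniq_leq_size; first by rewrite filter_uniq ?low_expos_uniq.
  move=> e; rewrite mem_filter mem_low_expos // => /andP[_ e1]; rewrite inE.
  by apply: contraLR e1; rewrite -(@wdeg_gt0 _ w1) // -leqNgt.
have : (0 : expo p.+1) \in nonleads rho1 (low_expos w1 1) ker.
  rewrite mem_filter mem_low_expos // wdeg0 andbT; apply/asboolPn.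
  by apply: (leads_proper rho1P (rker_ideal _)); apply: rker_proper.
by rewrite /hilbert; case: nonleads.
Qed.

Let m_primary : max_primary m.
Proof. exact: (max_primary_weight rho1P (@cone_map_surj _ _ X) R_nz). Qed.

Lemma cone_not_stable : E = 6%N -> ~ stable K (quot_ring X).
Proof.
move=> E6 [ss]; apply; exists m; first exact: m_primary.
by rewrite ss lech_ratio_max E6 divff // pnatr_eq0.
Qed.

Lemma cone_not_semistable : (6 < E)%N -> ~ semistable K (quot_ring X).
Proof.
move=> E6 ss; have : ((lech_ratio K m)%:E <= lech_mumford K R)%E.
  by apply: ereal_sup_ubound; exists m => //; exact: m_primary.
by rewrite ss lee_fin lech_ratio_max ler_pdivrMr // mul1r (ler_nat K E 6) leqNgt E6.
Qed.

End Criterion.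

Section Polygon.
Variables (k : fieldType) (p : nat).
Hypothesis p_gt2 : (2 < p)%N.
Local Notation S := (mseries k p.+1).
Local Notation w1 := (fun _ : 'I_p.+1 => 1%N).
Local Notation rho1 := (weight_order w1).
Local Notation X := (\bigcap_(i in [set: 'I_p]) @polygon_prime k p i).
Local Notation ker := (rker (cone_map X)).
Implicit Types (i j l : 'I_p) (e : expo p.+1).

Let rho1P : monomial_order rho1. Proof. exact: weight_orderP. Qed.

(** If no variable of P_i divided the monomial, it would involve only the two consecutive variables
    that P_i omits, and so be a face. *)
Lemma polygon_mono c (m : expo p) : nonface (econs c m) -> X (mono 1 m).
Proof.
move=> nf i _; have p0 : (0 < p)%N by lia.
have : exists l, (0 < m l)%N /\ exists2 j : nat, (j < p - 2)%N & l = ((i + j) %% p)%N :> nat.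
  apply: contrapT => H.
  (* The omitted variables have indices i + p - 2 and i + p - 1, modulo p. *)
  pose u : 'I_p := Ordinal (ltn_pmod (i + (p - 2)) p0).
  apply: (nf u (m u) (m (ordS u)) c); apply/ffunP => x.
  case: (unliftP ord0 x) => [l ->|->]; last by rewrite econs0 faceET.
  rewrite econsS faceEx; case: (eqVneq l u) => [->|lu].
    by rewrite eq_sym (negPf (ordS_neq u _)) ?mul1n ?addn0 //; lia.
  case: (eqVneq l (ordS u)) => [->|lSu]; first by rewrite mul1n.
  apply/eqP; rewrite eqn0Ngt; apply/negP => ml; apply: H; exists l; split=> //.
  exists ((l + (p - i)) %% p)%N; last first.
    by rewrite modnDmr addnCA subnKC ?modnDr ?modn_small // ltnW.
  have lp := ltn_ord l; have ip := ltn_ord i.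
  have tp := ltn_pmod (l + (p - i)) p0.
  have lE : (l = (i + (l + (p - i)) %% p) %% p :> nat)%N.
    by rewrite modnDmr addnCA subnKC ?modnDr ?modn_small // ltnW.
  rewrite ltnNge; apply/negP => t2.
  have [t|t] : ((l + (p - i)) %% p = p - 2 \/ (l + (p - i)) %% p = p - 1)%N by lia.
    by case/eqP: lu; apply/val_inj; rewrite /= lE t.
  case/eqP: lSu; apply/val_inj; rewrite /= lE t -[((i + (p - 2)) %% p).+1]addn1 modnDml -addnA.
  by congr ((_ + _) %% _)%N; lia.
move=> [l [ml lP]].
have /esubK <- : edvd (eunit l) m.
  by apply/forallP => j; rewrite eunitE; case: eqVneq => // ->.
have -> : mono 1 (eunit l + esub m (eunit l)) =
    mono 1 (esub m (eunit l)) * mono 1 (eunit l) :> mseries k p.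
  by rewrite monoM mulr1 addrC.
apply: (idealM _ (ideal_gen_ideal _)).
by apply: sub_ideal_gen; exists l => //; rewrite mvarE.
Qed.

Lemma slice_mono c (m : expo p) d : slice (mono 1 (econs c m) : S) d = if d == c then mono 1 m else 0.
Proof.
apply: mseriesP => m'; rewrite -[LHS]/(mcoef (mono 1 (econs c m)) (econs d m')) mcoef_mono.
have -> : (econs d m' == econs c m) = (d == c) && (m' == m).
  apply/eqP/andP => [E|[/eqP -> /eqP ->]] //.
  by rewrite -(etail_cons d m') E etail_cons -[d](econs0 d m') E econs0.
by case: eqP.
Qed.

Lemma polygon_ker_mono e : nonface e -> ker (mono 1 e).
Proof.
move=> nf; apply/cone_kerP => d; rewrite -(econsK e) slice_mono; case: ifP => _.
  by apply: sub_ideal_gen; apply: (@polygon_mono (e ord0)); rewrite econsK.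
by apply: ideal0; apply: ideal_gen_ideal.
Qed.

Lemma polygon_ker_face f i a b c : ker f -> mcoef f (face i a b c) = 0.
Proof.
move=> /cone_kerP/(_ c) kf; have p0 : (0 < p)%N by lia.
pose s := [pred l : 'I_p | (l == i) || (l == ordS i)].
(* P_(i+2) is generated by all variables except x_i and x_(i+1). *)
pose u : 'I_p := ordS (ordS i).
have Ps : polygon_prime (k := k) u `<=` coord_ideal s.
  apply: ideal_gen_sub; first exact: coord_ideal_ideal.
  move=> _ [l [j jp lE] <-] e /supportedP se; rewrite mvarE mcoef_mono.
  case: eqVneq => // eE; have : e l = 0%N.
    apply: se; rewrite inE; have ip := ltn_ord i.
    have {}lE : l = ((i + j.+2) %% p)%N :> nat.
      by rewrite lE /= modnDml addSn -addn1 -addnA modnDml !addSn addn1 !addnS.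
    have neq x : (x < 2)%N -> (l == (i + x) %% p :> nat)%N = false.
      by move=> x2; rewrite lE eqn_modDl !modn_small; lia.
    apply/norP; split; rewrite -val_eqE /=.
      by have := neq 0%N isT; rewrite addn0 modn_small // => ->.
    by have := neq 1%N isT; rewrite addn1 => ->.
  by rewrite eE eunitE eqxx.
have : coord_ideal s (slice f c).
  move: kf; apply: ideal_gen_sub; first exact: coord_ideal_ideal.
  by move=> g /(_ u I)/Ps.
move=> /(_ (etail (face i a b c))) <-.
  by rewrite /= -[in LHS](econsK (face i a b c)) faceET.
apply/supportedP => l; rewrite inE => /norP[li lSi].
by rewrite ffunE faceEx (negPf li) (negPf lSi).
Qed.

(** Membership in the kernel forces the coefficients on faces to vanish, and every nonface monomial
    lies in it, so the leading exponents are the same for all orders. *)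
Lemma polygon_leads rho e : monomial_order rho -> (leads rho ker e <-> nonface e).
Proof.
move=> rhoP; split=> [[f kf [fe _]] i a b c eE|nf].
  by case/eqP: fe; rewrite eE polygon_ker_face.
exists (mono 1 e); first exact: polygon_ker_mono.
by apply: lead_mono; rewrite oner_eq0.
Qed.

(** Below: the half-open octants, that is, full octants multiplied by x_i, are disjoint, and the
    shift costs one degree, whence [j.-1]. Above: the closed octants cover. *)
Lemma polygon_hilbert (j : nat) : (p * 'C(j, 3) <= hilbert rho1 w1 ker j <= p * 'C(j + 2, 3))%N.
Proof.
apply/andP; split.
  pose s := \big[cat/[::]]_(i < p) map (+%R (eunit (lift ord0 i))) (simplex_faces j.-1 i).
  apply: (@leq_trans (size s)).
    rewrite size_bigcat -[X in (X * _)%N]card_ord -sum_nat_const; apply: leq_sum => i _.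
    by rewrite size_map size_simplex_faces leq_bin2l //; lia.
  have sP e : e \in s -> exists i a b c, (a + b + c < j.-1)%N /\ e = face i a.+1 b c.
    move=> /bigcat_mem[i /mapP[_ /simplex_facesP[a [b [c [abc ->]]]] ->]].
    by exists i, a, b, c; split=> //; rewrite /face !addrA -mulrS.
  apply: uniq_leq_size => [|e].
    apply: uniq_bigcat => [i|i i' e].
      by rewrite map_inj_uniq ?simplex_faces_uniq //; apply: expo_addrI.
    move=> /mapP[_ /simplex_facesP[a [b [c [_ ->]]]] ->].
    move=> /mapP[_ /simplex_facesP[a' [b' [c' [_ ->]]]]].
    by rewrite /face !addrA -!mulrS => /face_inj[].
  move=> /sP[i [a [b [c [abc ->]]]]].
  rewrite mem_filter mem_low_expos // wdeg1_face; apply/andP; split; last by lia.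
  by apply/asboolPn; rewrite (polygon_leads _ rho1P) => /(_ i a.+1 b c).
pose s := \big[cat/[::]]_(i < p) simplex_faces j i.
have <- : size s = (p * 'C(j + 2, 3))%N.
  rewrite size_bigcat (eq_bigr (fun=> 'C(j + 2, 3))) ?sum_nat_const ?card_ord // => i _.
  exact: size_simplex_faces.
apply: uniq_leq_size; first by rewrite filter_uniq ?low_expos_uniq.
move=> e; rewrite mem_filter mem_low_expos // => /andP[/asboolPn nl ej].
have /existsNP[i /existsNP[a /existsNP[b /existsNP[c /contrapT eE]]]] : ~ nonface e.
  by move=> nf; apply: nl; apply/(polygon_leads _ rho1P).
apply: (mem_bigcat (i := i)); rewrite eE; apply: mem_simplex_faces.
by move: ej; rewrite eE wdeg1_face.
Qed.

Let i0 : 'I_p := Ordinal (ltn_trans (isT : 0 < 2)%N p_gt2).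

(** Shrinking sets of free variables give growing primes, from the component of one octant up to the
    maximal ideal. *)
Let coords (d : nat) : pred 'I_p.+1 := fun x =>
  nth false [:: (x == ord0) || (x == lift ord0 i0) || (x == lift ord0 (ordS i0));
   (x == ord0) || (x == lift ord0 i0); x == ord0; false] d.

Lemma polygon_ker_prime : prime_ideal (coord_ideal (coords 0) : set S) /\ ker `<=` coord_ideal (coords 0).
Proof.
split; first exact: (coord_ideal_prime _ rho1P).
move=> f kf e /supportedP se.
suff -> : e = face i0 (e (lift ord0 i0)) (e (lift ord0 (ordS i0))) (e ord0).
  exact: polygon_ker_face.
apply/ffunP => y; case: (unliftP ord0 y) => [x ->|->]; last by rewrite faceET.
rewrite faceEx; case: (eqVneq x i0) => [->|xi].
  by rewrite eq_sym (negPf (ordS_neq i0 _)) ?mul1n ?addn0 //; lia.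
case: (eqVneq x (ordS i0)) => [->|xSi]; first by rewrite mul1n.
by apply: se; rewrite /coords /= !(inj_eq lift_inj) (negPf xi) (negPf xSi).
Qed.

Lemma polygon_dim : krull_dim (mseries (quot_ring X) 1) = 3%N.
Proof.
apply: (krull_dim3 p_gt2 rho1P (weight_order_refines _) _ (@cone_map_surj _ _ X)
  _ (c := fun d => coord_ideal (coords d))) => //.
- by move=> e /(polygon_leads _ rho1P).
- by move=> j _; apply: (coord_ideal_prime _ rho1P).
- exact: polygon_ker_prime.2.
move=> [|[|[|//]]] _.
- apply: (@coord_ideal_lt _ _ _ _ (lift ord0 (ordS i0))); rewrite /coords /= ?eqxx ?orbT //.
    by move=> x ->.
  by rewrite (inj_eq lift_inj) (negPf (ordS_neq i0 _)) //; lia.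
- apply: (@coord_ideal_lt _ _ _ _ (lift ord0 i0)); rewrite /coords /= ?eqxx ?orbT //.
  by move=> x ->.
- by apply: (@coord_ideal_lt _ _ _ _ ord0).
Qed.

End Polygon.

(** * The cones for n = 1 and n = 2 *)

Section PrimeAvoidingMultiplicativeSet.
Variables (R : comPzRingType) (I M : set R).
Hypotheses (HI : is_ideal I) (M1 : M 1) (MM : forall x y, M x -> M y -> M (x * y)).
Hypothesis IM : forall x, I x -> ~ M x.

Lemma prime_avoiding : exists P, [/\ prime_ideal P, I `<=` P & forall x, P x -> ~ M x].
Proof.
(* Zorn's lemma for unions also meets the empty chain, whose union is empty; joining I to every set
   makes the empty set good. *)
pose good A := is_ideal (I `|` A) /\ forall x, (I `|` A) x -> ~ M x.
have [F Fgood Ftot|A [[HA AM] Amax]] := @Zorn_bigcup R good.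
  split; last first.
    by move=> x [/IM//|[X FX Xx]]; have [_ H] := Fgood X FX; apply: H; right.
  split=> [|a x y Ux Uy]; first by left; apply: ideal0.
  suff : exists2 X, X = set0 \/ F X & (I `|` X) x /\ (I `|` X) y.
    move=> [X [->|FX] [IXx IXy]].
      by rewrite !setU0 in IXx IXy; left; apply: HI.2.
    have [[_ /(_ a x y IXx IXy)[Ia|Xa]] _] := Fgood X FX; first by left.
    by right; exists X.
  case: Ux Uy => [Ix|[X FX Xx]] [Iy|[Y FY Yy]].
  - by exists set0; [left|split; left].
  - by exists Y; [right|split; [left|right]].
  - by exists X; [right|split; [right|left]].
  - have [XY|YX] := Ftot X Y FX FY; [exists Y|exists X]; try by right.
      by split; right => //; apply: XY.
    by split; right => //; apply: YX.
pose P := I `|` A.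
have IP : I `<=` P by move=> x; left.
have Pmax Q : is_ideal Q -> P `<` Q -> exists2 x, Q x & M x.
  move=> HQ [PQ nQP]; apply: contrapT => nQM; apply: (Amax Q).
    split=> [x Ax|QA]; first by apply: PQ; right.
    by apply: nQP => x /QA Ax; right.
  have QE : I `|` Q = Q by apply/setUidPr => x Ix; apply/PQ/IP.
  by split; rewrite QE // => x Qx Mx; apply: nQM; exists x.
have Padd x : ~ P x -> exists a, exists2 z, P z & M (z + a * x).
  move=> Px; pose Q := ideal_add P (ideal_scale x setT).
  have Hx : is_ideal (ideal_scale x setT) by apply: ideal_scale_ideal; apply: is_idealT.
  have HQ : is_ideal Q by apply: ideal_add_ideal.
  have [|_ [z [_ [Pz [a _ <-] ->]]] Mza] := Pmax Q HQ; last by exists a, z => //; rewrite mulrC.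
  split; first exact: ideal_addl.
  by move=> /(_ x); apply: contra_not Px; apply; apply: ideal_addr => //; exists 1; rewrite ?mulr1.
exists P; split=> //; split=> // [P1|x y Pxy]; first exact: (AM 1).
apply: contrapT => /not_orP[/Padd[a [z Pz Mz]] /Padd[b [t Pt Mt]]].
apply: (AM _ _ (MM Mz Mt)).
have -> : (z + a * x) * (t + b * y) = (t + b * y) * z + ((a * x) * t + (a * b) * (x * y)) by ring.
by do !(apply: idealD => //); apply: idealM.
Qed.

End PrimeAvoidingMultiplicativeSet.

Section LeadUnique.
Variables (k : fieldType) (q : nat) (rho : expo q -> nat).
Hypothesis rhoP : monomial_order rho.

Lemma lead_unique (f : mseries k q) a b : is_lead rho f a -> is_lead rho f b -> a = b.
Proof.
move=> [fa amin] [fb bmin]; apply: (mo_inj rhoP); apply/eqP.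
by rewrite eqn_leq amin // bmin.
Qed.

End LeadUnique.

Section DoublePoint.
Variables (k : fieldType) (c : k).
Local Notation S := (mseries k 4).
Implicit Types (e : expo 4) (f g h : S).

Definition iX : 'I_4 := lift ord0 (0 : 'I_3).
Definition iY : 'I_4 := lift ord0 (1 : 'I_3).
Definition iZ : 'I_4 := lift ord0 (2 : 'I_3).
Local Notation eX := (eunit iX).
Local Notation eY := (eunit iY).
Local Notation eZ := (eunit iZ).

(* The equation x^2 - xyz + c y^3: c = 1 gives the 1-cone, c = 0 the 2-cone. *)
Definition cone_eq : mseries k 3 :=
  mono 1 (eunit 0 *+ 2) - mono 1 (eunit 0 + eunit 1 + eunit 2) + mono c (eunit 1 *+ 3).

Definition cone_eqT : S := mono 1 (eX *+ 2) - mono 1 (eX + eY + eZ) + mono c (eY *+ 3).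

Local Notation X := [set cone_eq].
Local Notation ker := (rker (cone_map X)).

Lemma econs_eunit (i : 'I_3) : econs 0 (eunit i) = eunit (lift ord0 i).
Proof.
apply/ffunP => j; rewrite eunitE; case: (unliftP ord0 j) => [l ->|->].
  by rewrite econsS eunitE (inj_eq lift_inj).
by rewrite econs0 (negPf (neq_lift _ _)).
Qed.

Lemma econs0D (a b : expo 3) : econs 0 (a + b) = econs 0 a + econs 0 b.
Proof. by rewrite econsD. Qed.

Lemma slice_mono0 (a : k) (m : expo 3) d :
  slice (mono a (econs 0 m)) d = if d == 0%N then mono a m else 0.
Proof.
apply: mseriesP => m'; rewrite -[LHS]/(mcoef (mono a (econs 0 m)) (econs d m')) mcoef_mono.
have -> : (econs d m' == econs 0 m) = (d == 0%N) && (m' == m).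
  apply/eqP/andP => [E|[/eqP -> /eqP ->]] //.
  by rewrite -(etail_cons d m') E etail_cons -[d](econs0 d m') E econs0.
by case: eqP.
Qed.

Lemma slice_cone_eqT d : slice cone_eqT d = if d == 0%N then cone_eq else 0.
Proof.
have -> : cone_eqT = mono 1 (econs 0 (eunit 0 *+ 2)) -
    mono 1 (econs 0 (eunit 0 + eunit 1 + eunit 2)) + mono c (econs 0 (eunit 1 *+ 3)).
  by rewrite !(mulrS, econs0D, econs_eunit).
rewrite /cone_eq; set a := eunit 0 *+ 2; set b := _ + eunit 2; set d3 := eunit 1 *+ 3.
have -> : slice (mono 1 (econs 0 a) - mono 1 (econs 0 b) + mono c (econs 0 d3)) d =
  slice (mono 1 (econs 0 a)) d - slice (mono 1 (econs 0 b)) d + slice (mono c (econs 0 d3)) d by [].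
by rewrite !slice_mono0; case: ifP => // _; rewrite subrr addr0.
Qed.

(** Each T-coefficient is a multiple of the equation, and the cofactors are assembled into one
    series. *)
Lemma cone_kerE f : ker f <-> exists h, f = h * cone_eqT.
Proof.
have sM h d : slice (h * cone_eqT) d = slice h d * cone_eq.
  rewrite sliceM big_ord_recr /= subnn slice_cone_eqT eqxx big1 ?add0r // => i _.
  by rewrite slice_cone_eqT subn_eq0 leqNgt ltn_ord mulr0.
split=> [/cone_kerP H|[h ->]]; last first.
  apply/cone_kerP => d; rewrite sM; apply: (idealM _ (ideal_gen_ideal _)).
  exact: sub_ideal_gen.
have /choice[h hP] : forall d, exists u : mseries k 3, slice f d = u * cone_eq.
  move=> d; have : ideal_scale cone_eq setT (slice f d).
    apply: ideal_gen_sub (H d); first by apply: ideal_scale_ideal; apply: is_idealT.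
    by move=> _ ->; exists 1; rewrite ?mulr1.
  by move=> [u _ <-]; exists u; rewrite mulrC.
exists (MSeries (fun e => mcoef (h (e ord0)) (etail e))).
apply: mseriesP => e; rewrite -(econsK e).
have : slice f (e ord0) = slice (MSeries (fun e => mcoef (h (e ord0)) (etail e)) * cone_eqT) (e ord0).
  rewrite sM hP; congr (_ * _); apply: mseriesP => m /=.
  by rewrite econs0 etail_cons.
by move=> /(congr1 (fun u => mcoef u (etail e))).
Qed.

Lemma cone_eqT_supp e : mcoef cone_eqT e != 0 ->
  [\/ e = eX *+ 2, e = eX + eY + eZ | e = eY *+ 3].
Proof.
rewrite /cone_eqT mcoefD mcoefB !mcoef_mono.
case: (eqVneq e (eX *+ 2)) => [->|_]; first by constructor 1.
case: (eqVneq e (eX + eY + eZ)) => [->|_]; first by constructor 2.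
case: (eqVneq e (eY *+ 3)) => [->|_]; first by constructor 3.
by rewrite subr0 addr0 eqxx.
Qed.

Section Leads.
Variables (w : 'I_4 -> nat) (rho : expo 4 -> nat).
Hypotheses (rhoP : monomial_order rho) (wr : refines w rho).

Let coordE := (expoD, expoMn, eunitE).

Lemma cone_eqT_mid : mcoef cone_eqT (eX + eY + eZ) = -1.
Proof.
rewrite /cone_eqT mcoefD mcoefB !mcoef_mono eqxx.
case: eqP => [/ffunP/(_ iZ)|_]; first by rewrite !coordE.
case: eqP => [/ffunP/(_ iZ)|_]; first by rewrite !coordE.
by rewrite sub0r addr0.
Qed.

Lemma cone_eqT_sq : mcoef cone_eqT (eX *+ 2) = 1.
Proof.
rewrite /cone_eqT mcoefD mcoefB !mcoef_mono eqxx.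
case: eqP => [/ffunP/(_ iZ)|_]; first by rewrite !coordE.
case: eqP => [/ffunP/(_ iX)|_]; first by rewrite !coordE.
by rewrite subr0 addr0.
Qed.

Lemma lead_mid : (w iY + w iZ < w iX)%N -> (w iX + w iZ < 2 * w iY)%N ->
  is_lead rho cone_eqT (eX + eY + eZ).
Proof.
move=> w1 w2; split; first by rewrite cone_eqT_mid oppr_eq0 oner_eq0.
move=> e /cone_eqT_supp[->|->|->] //; apply: ltnW; apply: wr;
  rewrite ?wdegMn ?wdegD ?wdeg_eunit; lia.
Qed.

Lemma lead_sq : (w iX < w iY + w iZ)%N -> (2 * w iX < 3 * w iY)%N ->
  is_lead rho cone_eqT (eX *+ 2).
Proof.
move=> w1 w2; split; first by rewrite cone_eqT_sq oner_eq0.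
move=> e /cone_eqT_supp[->|->|->] //; apply: ltnW; apply: wr;
  rewrite ?wdegMn ?wdegD ?wdeg_eunit; lia.
Qed.

Lemma leads_kerE m e : is_lead rho cone_eqT m -> leads rho ker e <-> edvd m e.
Proof.
move=> lm; split=> [[f /cone_kerE[h ->] fe]|/edvdP[d ->]].
  have h0 : h != 0 by apply/eqP => h0; have := lead_neq0 fe; rewrite h0 mul0r eqxx.
  have [a ha] := lead_exists rho h0.
  by rewrite (lead_unique rhoP fe (lead_mul rhoP ha lm).1) addrC edvdD.
exists (mono 1 d * cone_eqT); first by apply/cone_kerE; exists (mono 1 d).
by rewrite addrC; apply: lead_monoM => //; rewrite oner_eq0.
Qed.

End Leads.

Lemma expo4P e e' : e ord0 = e' ord0 -> e iX = e' iX -> e iY = e' iY -> e iZ = e' iZ -> e = e'.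
Proof.
move=> e0 eX' eY' eZ'; apply/ffunP => j; case: (unliftP ord0 j) => [i ->|->] //.
case: i => -[|[|[|//]]] i3.
- by rewrite (_ : Ordinal i3 = 0) //; apply/val_inj.
- by rewrite (_ : Ordinal i3 = 1) //; apply/val_inj.
- by rewrite (_ : Ordinal i3 = 2) //; apply/val_inj.
Qed.

Lemma nonface3 e : nonface e -> edvd (eX + eY + eZ) e.
Proof.
move=> nf; have [x0 [y0 z0]] : (0 < e iX /\ 0 < e iY /\ 0 < e iZ)%N.
  have S0 : ordS (0 : 'I_3) = 1 by apply/val_inj.
  have S1 : ordS (1 : 'I_3) = 2 by apply/val_inj.
  have S2 : ordS (2 : 'I_3) = 0 by apply/val_inj.
  repeat split; rewrite lt0n; apply/eqP => E.
  - by apply: (nf 1 (e iY) (e iZ) (e ord0)); apply: expo4P;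
      rewrite ?faceET ?E // /iX /iY /iZ faceEx S1 /= ?mul1n ?mul0n ?addn0.
  - by apply: (nf 2 (e iZ) (e iX) (e ord0)); apply: expo4P;
      rewrite ?faceET ?E // /iX /iY /iZ faceEx S2 /= ?mul1n ?mul0n ?addn0.
  - by apply: (nf 0 (e iX) (e iY) (e ord0)); apply: expo4P;
      rewrite ?faceET ?E // /iX /iY /iZ faceEx S0 /= ?mul1n ?mul0n ?addn0.
apply/forallP => j; rewrite !expoD !eunitE; case: (unliftP ord0 j) => [i ->|->] //.
case: i => -[|[|[|//]]] i3.
- by rewrite (_ : Ordinal i3 = 0) //; apply/val_inj.
- by rewrite (_ : Ordinal i3 = 1) //; apply/val_inj.
- by rewrite (_ : Ordinal i3 = 2) //; apply/val_inj.
Qed.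

(* Weights of T, x, y, z for which xyz is the smallest monomial of the equation. *)
Definition node_weight (B : nat) (l : 'I_4) : nat := nth 0%N [:: 1; B + 2; B; 1]%N l.

Lemma node_weight_gt0 B l : (0 < B)%N -> (0 < node_weight B l)%N.
Proof. by rewrite /node_weight; case: l => -[|[|[|[|//]]]] ? /=; lia. Qed.

Let node_order B := weight_order (node_weight B).

(** Against x^2 this is B + 1 < B + 2, against y^3 it is B + 3 < 2 B, whence B > 3. The weight of y
    stays free to grow for [node_ker_avoid]. *)
Lemma node_lead B : (3 < B)%N -> is_lead (node_order B) cone_eqT (eX + eY + eZ).
Proof.
move=> B3; have B0 l : (0 < node_weight B l)%N by apply: node_weight_gt0; lia.
by apply: (lead_mid (weight_order_refines B0)); rewrite /node_weight /iX /iY /iZ /=; lia.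
Qed.

Let node_orderP B : (0 < B)%N -> monomial_order (node_order B).
Proof. by move=> B0; apply: weight_orderP => l; apply: node_weight_gt0. Qed.

Lemma nonface3_leads e : nonface e -> leads (node_order 4) ker e.
Proof.
move=> /nonface3 me.
have [_ H] := leads_kerE (@node_orderP 4 isT) e (@node_lead 4 isT); exact: H.
Qed.

Let axis : pred 'I_4 := fun l => (l == ord0) || (l == iZ).

(* If s x^N lay in the ideal of the equation, for s outside (x, y), an order
   with leading monomial xyz giving y a weight beyond the degree of the (z, T)-part of s
   would make xyz divide a monomial free of y. *)
Lemma node_ker_avoid s N : ker (s * mono 1 (eX *+ N)) -> coord_ideal axis s.
Proof.
move=> ks e0 se0; apply/eqP/negPn/negP => fe0.
pose B := (wdeg (fun=> 1%N) e0 + 4)%N.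
have B0 l : (0 < node_weight B l)%N by apply: node_weight_gt0; rewrite /B; lia.
have rhoB := @node_orderP B (leq_trans (isT : 0 < 4)%N (leq_addl _ _)).
have leadB : is_lead (node_order B) cone_eqT (eX + eY + eZ) by apply: node_lead; rewrite /B; lia.
have s0 : s != 0 by apply: contraNneq fe0 => ->.
have [a sa] := lead_exists (node_order B) s0.
have aw : (wdeg (node_weight B) a < B)%N.
  apply: (@leq_ltn_trans (wdeg (node_weight B) e0)); last first.
    have -> : wdeg (node_weight B) e0 = wdeg (fun=> 1%N) e0.
      apply: eq_bigr => l _; have /supportedP se := se0.
      case: (boolP (axis l)) => [/orP[/eqP ->|/eqP ->]|/se ->]; by rewrite ?muln0 // /node_weight /=.
    by rewrite /B; lia.
  by apply: (refines_le (weight_order_refines B0)); apply: sa.2.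
have aY : a iY = 0%N.
  have : (node_weight B iY * a iY <= wdeg (node_weight B) a)%N.
    by rewrite /wdeg (bigD1 iY) //= leq_addr.
  rewrite (_ : node_weight B iY = B) // => H; apply/eqP; rewrite eqn0Ngt; apply/negP => a0.
  by have := leq_trans (leq_pmulr B a0) H; rewrite leqNgt aw.
have [h hE] := (cone_kerE _).1 ks.
have [lm _] := lead_mul rhoB sa (lead_mono (node_order B) (eX *+ N) (oner_neq0 k)).
have h0 : h != 0 by apply/eqP => h0; have := lead_neq0 lm; rewrite hE h0 mul0r eqxx.
have [b hb] := lead_exists (node_order B) h0.
have [lm' _] := lead_mul rhoB hb leadB; rewrite -hE in lm'.
have /ffunP/(_ iY) := lead_unique rhoB lm lm'.
by rewrite !expoD !expoMn !eunitE aY /=; lia.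
Qed.

(** In the avoided set, the elements with N = 0 force P into (x, y), and x itself keeps the
    inclusion strict. For c = 0 this selects a prime that contains x - yz and not x. *)
Lemma node_prime : exists P : set S, [/\ prime_ideal P, ker `<=` P & P `<` coord_ideal axis].
Proof.
pose M : set S := [set u | exists s N, ~ coord_ideal axis s /\ u = s * mono 1 (eX *+ N)].
have axisP : prime_ideal (coord_ideal axis : set S) by apply: (coord_ideal_prime _ (@node_orderP 4 isT)).
have [HA A1 AP] := axisP.
have [||||P [Pp kP PM]] := @prime_avoiding S ker M.
- exact: rker_ideal.
- by exists 1, 0%N; split=> //; rewrite mulr0n mono1 mulr1.
- move=> _ _ [s [N [sA ->]]] [s' [N' [sA' ->]]]; exists (s * s'), (N + N')%N; split.
    by move=> /AP[].
  by rewrite mulrACA monoM mulr1 -mulrnDr.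
- by move=> u ks [s [N [sA uE]]]; apply: sA; apply: (@node_ker_avoid _ N); rewrite -uE.
exists P; split=> //; split=> [f Pf|/(_ (mono 1 eX))].
  apply: contrapT => nf; apply: (PM f Pf); exists f, 0%N; split=> //.
  by rewrite mulr0n mono1 mulr1.
move=> H; apply: (PM (mono 1 eX)); last first.
  by exists 1, 1%N; split=> //; rewrite mul1r mulr1n.
apply: H => e /supportedP/(_ iX isT) eX0; rewrite mcoef_mono; case: eqVneq => // eE.
by move: eX0; rewrite eE eunitE eqxx.
Qed.

Lemma node_dim : krull_dim (mseries (quot_ring X) 1) = 3%N.
Proof.
have [P [Pp kP PA]] := node_prime.
have rho4 := @node_orderP 4 isT.
have w4 l : (0 < node_weight 4 l)%N by apply: node_weight_gt0.
pose C (d : nat) : set S := nth set0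
  [:: P; coord_ideal axis; coord_ideal (pred1 ord0); coord_ideal pred0] d.
apply: (@krull_dim3 k 3 isT _ _ _ rho4 (weight_order_refines w4) w4 _
  (@cone_map_surj _ _ X) nonface3_leads C) => //.
  by move=> [|[|[|[|//]]]] _ //=; apply: (coord_ideal_prime _ rho4).
move=> [|[|[|//]]] _ //=.
- by apply: (@coord_ideal_lt _ _ _ _ iZ) => // l /eqP ->.
- by apply: (@coord_ideal_lt _ _ _ _ ord0) => //=; rewrite eqxx.
Qed.

Local Notation w1 := (fun _ : 'I_4 => 1%N).
Local Notation rho1 := (weight_order w1).

(** In total degree x^2 is the initial term, so the standard exponents form two copies of the (y, z,
    T)-octant, shifted by 1 and by x. The shift by x raises the degree by one, whence [j.-1] in the
    lower bound. *)
Lemma node_hilbert j : (2 * 'C(j, 3) <= hilbert rho1 w1 ker j <= 2 * 'C(j + 2, 3))%N.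
Proof.
have rho1P : monomial_order rho1 by apply: weight_orderP.
have rho1w : refines w1 rho1 by apply: weight_order_refines.
have nl e : ~~ `[< leads rho1 ker e >] = (e iX < 2)%N.
  have lq : is_lead rho1 cone_eqT (eX *+ 2) by apply: (lead_sq rho1w).
  rewrite (asbool_equiv_eq (leads_kerE rho1P e lq)) asboolb ltnNge; congr (~~ _).
  apply/forallP/idP => [/(_ iX)|e2 l]; first by rewrite expoMn eunitE eqxx.
  by rewrite expoMn eunitE; case: eqVneq => // ->.
pose s N := \big[cat/[::]]_(a < 2) map (+%R (eX *+ a)) (simplex_faces N (1 : 'I_3)).
have size_s N : size (s N) = (2 * 'C(N + 2, 3))%N.
  rewrite size_bigcat (eq_bigr (fun=> 'C(N + 2, 3))) ?sum_nat_const ?card_ord // => i _.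
  by rewrite size_map size_simplex_faces.
have shX n a b d : (eX *+ n + face (1 : 'I_3) a b d) iX = n.
  by rewrite expoD expoMn eunitE /iX faceEx eqxx /=; lia.
apply/andP; split.
  apply: (@leq_trans (size (s j.-1))); first by rewrite size_s leq_mul2l leq_bin2l //; lia.
  apply: uniq_leq_size => [|e].
    apply: uniq_bigcat => [a|a a' e].
      by rewrite map_inj_uniq ?simplex_faces_uniq //; apply: expo_addrI.
    move=> /mapP[_ /simplex_facesP[b [d [t [_ ->]]]] ->].
    move=> /mapP[_ /simplex_facesP[b' [d' [t' [_ ->]]]]] /ffunP/(_ iX).
    by rewrite !shX => /val_inj.
  move=> /bigcat_mem[a /mapP[_ /simplex_facesP[b [d [t [bdt ->]]]] ->]].
  have a2 := ltn_ord a; rewrite mem_filter mem_low_expos // nl.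
  rewrite shX wdegD wdegMn wdeg_eunit wdeg1_face; lia.
rewrite -size_s; apply: uniq_leq_size; first by rewrite filter_uniq ?low_expos_uniq.
move=> e; rewrite mem_filter mem_low_expos // nl => /andP[eX2 ej].
have eE : e = eX *+ e iX + face (1 : 'I_3) (e iY) (e iZ) (e ord0).
  have S1 : ordS (1 : 'I_3) = 2 by apply/val_inj.
  by apply: expo4P; rewrite expoD expoMn eunitE ?faceET ?faceEx ?S1 //= /iX /iY /iZ ?faceEx ?S1 /=; lia.
apply: (mem_bigcat (i := Ordinal eX2)); rewrite [X in X \in _]eE; apply: map_f.
apply: mem_simplex_faces; move: ej; rewrite eE wdegD wdegMn wdeg_eunit wdeg1_face.
by rewrite -eE; lia.
Qed.

End DoublePoint.

Section Cones.
Variables (K : realType) (k : fieldType).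

Lemma elliptic_cone1 : elliptic_cone k 1 = quot_ring [set cone_eq (1 : k)].
Proof.
rewrite /elliptic_cone /cone_eq !mvarE !monoX !monoM !expr1n !mulr1.
by [].
Qed.

Lemma elliptic_cone2 : elliptic_cone k 2 = quot_ring [set cone_eq (0 : k)].
Proof.
rewrite /elliptic_cone /cone_eq !mvarE !monoX !monoM !expr1n !mulr1.
have -> : mono (0 : k) (eunit (1 : 'I_3) *+ 3) = 0.
  by apply: mseriesP => m; rewrite mcoef_mono mcoef0; case: ifP.
by rewrite addr0.
Qed.

Lemma node_stable (c : k) : stable K (quot_ring [set cone_eq c]).
Proof.
have [P [Pp kP _]] := node_prime c.
have rhoP : monomial_order (weight_order (node_weight 4)).
  by apply: weight_orderP => l; apply: node_weight_gt0.
exact: (cone_stable K _ rhoP (@nonface3_leads _ c) (node_dim c) Pp kP _ (node_hilbert c)).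
Qed.

End Cones.

Theorem proposition7p2p1 (K : realType) (k : fieldType) (n : nat)
    (n_ge1 : (1 <= n)%N) :
  (semistable K (elliptic_cone k n) <-> (1 <= n <= 6)%N) /\
  ((1 <= n <= 5)%N -> stable K (elliptic_cone k n)) /\
  (n = 6%N ->
     semistable K (elliptic_cone k n) /\ ~ stable K (elliptic_cone k n)).
Proof.
case: n n_ge1 => [//|[|[|n]]] _.
- have H : stable K (elliptic_cone k 1) by rewrite elliptic_cone1; apply: node_stable.
  by split; [split=> // _; case: H|split].
- have H : stable K (elliptic_cone k 2) by rewrite elliptic_cone2; apply: node_stable.
  by split; [split=> // _; case: H|split].
pose p := n.+3.
have p2 : (2 < p)%N by [].
have p0 : (0 < p)%N by [].
have rhoP : monomial_order (weight_order (fun _ : 'I_p.+1 => 1%N)) by apply: weight_orderP.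
have nf e : nonface e -> leads (weight_order (fun _ => 1%N))
    (rker (cone_map (\bigcap_(i in [set: 'I_p]) @polygon_prime k p i))) e.
  by move=> ?; apply/(polygon_leads _ p2 _ rhoP).
have [Pp kP] := polygon_ker_prime k p2.
have dimR := polygon_dim k p2.
have hil := polygon_hilbert k p2.
have ss : (p <= 6)%N -> semistable K (elliptic_cone k p).
  exact: (cone_semistable K p2 rhoP nf dimR Pp kP p0 hil).
have st : (p < 6)%N -> stable K (elliptic_cone k p).
  exact: (cone_stable K p2 rhoP nf dimR Pp kP p0 hil).
split; [split=> [sp|/andP[_ /ss//]]|split=> [/andP[_ /st//]|p6]].
  rewrite /= leqNgt; apply/negP => p7.
  exact: (cone_not_semistable dimR Pp kP hil p7 sp).
split; first by apply: ss; rewrite /p p6.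
exact: (cone_not_stable dimR Pp kP hil p6).
Qed.
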